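(* Let $z\in\mathbb{D}^\infty$. (i) If $\displaystyle\limsup_{n\to\infty}\frac{1}{\log n}\sum_{j=1}^n (z_j^* )^2<\frac12$, then $z\in\operatorname{mon}H_\infty(\mathbb{D}^\infty)$. (ii) If $z\in\operatorname{mon}H_\infty(\mathbb{D}^\infty)$, then $\displaystyle\limsup_{n\to\infty}\frac{1}{\log n}\sum_{j=1}^n (z_j^* )^2\le 1$.
   Context: $\mathbb{D}^\infty$ denotes the open unit ball of the complex Banach space $\ell_\infty$ of bounded sequences. $H_\infty(\mathbb{D}^\infty)$ is the Banach space of all bounded holomorphic (i.e. Fréchet complex-differentiable) functions $f:\mathbb{D}^\infty\to\mathbb{C}$ with the sup norm. $\mathbb{N}_0^{(\mathbb{N})}$ is the set of finitely supported sequences $\alpha$ of non-negative integers (with $\mathbb{N}_0^k$ identified with those supported in the first $k$ coordinates), and $z^\alpha=\prod_jz_j^{\alpha_j}$. The monomial coefficients $c_\alpha(f)$ of $f$ are the unique complex numbers such that for every $k$ and every $z\in\mathbb{D}^k$ (the polydisc, identified with $\mathbb{D}^k\times\{0\}\subseteq\mathbb{D}^\infty$), $f(z)=\sum_{\alpha\in\mathbb{N}_0^k}c_\alpha(f)z^\alpha$. The set of monomial convergence is $$\operatorname{mon}H_\infty(\mathbb{D}^\infty)=\Big\{z\in\mathbb{D}^\infty : \forall f\in H_\infty(\mathbb{D}^\infty),\ f(z)=\sum_{\alpha\in\mathbb{N}_0^{(\mathbb{N})}}c_\alpha(f)z^\alpha\Big\},$$ where the equality means that the series converges absolutely (as a net)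 and its sum is $f(z)$. For $z\in\ell_\infty$ the decreasing rearrangement is $z_n^*=\inf\{\sup_{j\in\mathbb{N}\setminus J}|z_j| : J\subseteq\mathbb{N},\ \operatorname{card}(J)<n\}$. *)

(* Defs.v *)
From HB Require Import structures.
From mathcomp Require Import all_boot all_order all_algebra finmap.
From mathcomp Require Import all_classical all_reals all_analysis.
From mathcomp Require Import complex.
From mathcomp.analysis.showcase Require summability.

Set Implicit Arguments.
Unset Strict Implicit.
Unset Printing Implicit Defensive.

Import Order.TTheory GRing.Theory Num.Theory.
Import numFieldNormedType.Exports.

Local Open Scope classical_set_scope.
Local Open Scope ring_scope.
Local Open Scope complex_scope.

HB.instance Definition _ (R : rcfType) := GRing.ComAlgebra.copy R[i] R[i]^o.
HB.instance Definition _ (R : rcfType) := NormedModule.copy R[i] R[i]^o.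

Section Linfty.
Variable R : realType.
Local Notation C := R[i].
Local Notation normc := Normc.normc.

Definition linfty_pred : {pred nat -> C} :=
  mem [set x : nat -> C | bounded_fun x].

Lemma bounded_seqP (x : nat -> C) :
  bounded_fun x <-> exists M, forall n, `|x n| <= M.
Proof.
have FF : ProperFilter (globally [set: nat])
  by exact: (@globally_properfilter _ _ 0%N).
split=> [/(@ex_bound _ _ _ _ _ FF)[M xM]|[M xM]].
  by exists M => n; exact: xM.
by apply/(@ex_bound _ _ _ _ _ FF); exists M => n _; exact: xM.
Qed.

Lemma linfty_submod_closed : submod_closed linfty_pred.
Proof.
split=> [|a x y].
  by rewrite inE; apply/bounded_seqP; exists 0 => n; rewrite normr0.
rewrite !inE => /bounded_seqP[M xM] /bounded_seqP[N yN].
apply/bounded_seqP; exists (`|a| * M + N) => n.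
apply: (le_trans (ler_normD _ _)); apply: lerD; last exact: yN.
by rewrite normrM ler_wpM2l.
Qed.

HB.instance Definition _ :=
  GRing.isSubmodClosed.Build _ _ linfty_pred linfty_submod_closed.

Record linfty := Linfty {
  linfty_fun :> nat -> C;
  linfty_funP : linfty_fun \in linfty_pred }.

HB.instance Definition _ := [isSub for linfty_fun].
HB.instance Definition _ := [Choice of linfty by <:].
HB.instance Definition _ := [SubChoice_isSubLmodule of linfty by <:].

(* The scalar field is R[i], so norms take their values in R[i]. *)
Definition linfty_norm (x : linfty) : C :=
  (sup (range (fun n => normc (x n))))%:C.

Lemma normr_normc (a : C) : `|a| = (normc a)%:C.
Proof. by case: a. Qed.

Lemma normc_ge0 (a : C) : 0 <= normc a.
Proof. by case: a => x y; exact: sqrtr_ge0. Qed.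

Lemma linfty_has_sup (x : linfty) : has_sup (range (fun n => normc (x n))).
Proof.
split; first by exists (normc (x 0)); exists 0.
have := linfty_funP x; rewrite inE => /bounded_seqP[M xM].
exists (complex.Re M) => _ [n _ <-].
by have := xM n; rewrite normr_normc lecE => /andP[].
Qed.

Lemma linfty_norm_ub (x : linfty) n :
  normc (x n) <= sup (range (fun k => normc (x k))).
Proof. by apply: ub_le_sup; [case: (linfty_has_sup x)|exists n]. Qed.

Lemma ler_linfty_normD (x y : linfty) :
  linfty_norm (x + y) <= linfty_norm x + linfty_norm y.
Proof.
rewrite /linfty_norm -rmorphD lecR.
apply: ge_sup; first by case: (linfty_has_sup (x + y)).
move=> _ [n _ <-]; apply: (le_trans (@le_normcD R (x n) (y n))).
by apply: lerD; exact: linfty_norm_ub.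
Qed.

Lemma linfty_normZ (a : C) (x : linfty) :
  linfty_norm (a *: x) = `|a| * linfty_norm x.
Proof.
rewrite /linfty_norm normr_normc -rmorphM; congr (_%:C).
have axE n : normc ((a *: x) n) = normc a * normc (x n) by rewrite -Normc.normcM.
have a0 := normc_ge0 a.
apply/le_anti/andP; split.
  apply: ge_sup; first by case: (linfty_has_sup (a *: x)).
  by move=> _ [n _ <-]; rewrite axE ler_wpM2l// linfty_norm_ub.
have [->|an0] := eqVneq a 0.
  rewrite Normc.normc0 mul0r.
  exact: le_trans (normc_ge0 _) (linfty_norm_ub _ 0).
have {}a0 : 0 < normc a.
  by rewrite lt_neqAle a0 andbT eq_sym; apply: contra an0 => /eqP/Normc.eq0_normc ->.
rewrite mulrC -ler_pdivlMr//.
apply: ge_sup; first by case: (linfty_has_sup x).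
move=> _ [n _ <-]; rewrite ler_pdivlMr// mulrC -axE.
exact: linfty_norm_ub.
Qed.

Lemma linfty_norm0_eq0 (x : linfty) : linfty_norm x = 0 -> x = 0.
Proof.
move=> [x0]; apply/val_inj/funext => n; apply: Normc.eq0_normc.
apply/le_anti/andP; split; last exact: normc_ge0.
by rewrite -x0 linfty_norm_ub.
Qed.

HB.instance Definition _ := Lmodule_isNormed.Build C linfty
  ler_linfty_normD linfty_normZ linfty_norm0_eq0.

End Linfty.

Section MonomialConvergence.
Variable R : realType.
Local Notation C := R[i].
Local Notation normc := Normc.normc.

Definition Dinfty : set (linfty R) := ball (0 : linfty R) 1.

(* Functions on the ball are represented by total functions; their values
   outside the ball are irrelevant. *)
Definition Hinfty : set (linfty R -> C) :=
  [set f | (forall z, Dinfty z -> differentiable f z) /\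
           [bounded f z | z in Dinfty]].

Definition multi_index := {fsfun nat -> nat with 0%N}.

Definition monomial (z : linfty R) (alpha : multi_index) : C :=
  \prod_(j <- finsupp alpha) z j ^+ alpha j.

Definition has_abs_sum (I : choiceType) (D : set I) (u : I -> C) (s : C) :=
  (\esum_(i in D) (normc (u i))%:E < +oo)%E /\
  summability.partial_sum (patch (fun=> 0) D u) @ summability.totally --> s.

Definition first_indices (k : nat) : set multi_index :=
  [set alpha | forall j, (k <= j)%N -> alpha j = 0%N].

Definition first_coords (k : nat) : set (linfty R) :=
  [set z | forall j, (k <= j)%N -> z j = 0].

Definition is_monomial_coefs (f : linfty R -> C) : set (multi_index -> C) :=
  [set c | forall k z, Dinfty z -> first_coords k z ->
     has_abs_sum (first_indices k) (fun alpha => c alpha * monomial z alpha)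
       (f z)].

(* Definite description: the coefficients exist and are unique for every f in
   Hinfty; the default value 0 is never used for such f. *)
Definition monomial_coef (f : linfty R -> C) : multi_index -> C :=
  xget (fun=> 0) (is_monomial_coefs f).

Definition mon_Hinfty : set (linfty R) :=
  [set z | Dinfty z /\ forall f, Hinfty f ->
     has_abs_sum setT (fun alpha => monomial_coef f alpha * monomial z alpha)
       (f z)].

(* The rank n is 1-based (n = 1 gives the supremum of all |z_j|), while the
   coordinates of z are indexed from 0. *)
Definition decr_rearr (z : linfty R) (n : nat) : R :=
  inf [set sup [set normc (z j) | j in [set j | j \notin J]]
      | J in [set J : {fset nat} | (#|` J| < n)%N]].

End MonomialConvergence.

(* Main.v *)
(* (i) Let [f] be a polynomial bounded by [M] on the polydisc. Averaging over the
   circle against partial sums of [(1 + tau^* x^-n) / (1 + tau x^n)] shows, for one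
   variable, that [|c_0|^2 + \sum_n k_n |c_n|^2] is at most the square of the L^1
   mean, where [k_1] may be taken as close to 1/2 as desired; this tensorizes to
   several variables. Order the variables by decreasing [|z_j|] and group the
   monomials by the last variable that they contain. On each group, Cauchy-Schwarz
   and the previous inequality, applied to a partial derivative of the dilated
   polynomial [f (r x)], reduce the sum of the [|c_alpha z^alpha|] to the sum over [j]
   of the L^1 norms of these derivatives, which is at most [M r / (1 - r)] by
   Cauchy's estimate. The constant is the square root of the supremum over [n] of
   about [z^*_n ^ 2 exp (2 \sum_(j < n) z^*_j ^ 2)], which is finite when the limsup
   is less than 1/2.

   (ii) If the limsup exceeds 1, then for infinitely many [n] a random polynomial
   [P (w) = \sum_alpha (+-) s^alpha w^alpha], with [alpha] ranging over [{0,1,2}^n] and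
   [s] the [n] largest values [|z_j|], satisfies [|P| <= K (n log n V)^(1/2)] with
   [V = \sum_alpha s^(2 alpha) >= exp (\sum_j s_j^2)], whereas
   [\sum_alpha |c_alpha (P) z^alpha| = V] is much larger. Multiplied by
   powers of a fixed coordinate, such polynomials have disjoint supports, and a
   series of them is a function in [H_infty] whose monomial series does not
   converge absolutely at [z]. *)
From HB Require Import structures.
From mathcomp Require Import all_boot all_order all_algebra finmap.
From mathcomp Require Import all_classical all_reals all_analysis.
From mathcomp Require Import complex cyclic separable cyclotomic.
From mathcomp Require Import zify ring lra.
Require Import Defs.

Set Implicit Arguments.
Unset Strict Implicit.
Unset Printing Implicit Defensive.

Import Order.TTheory GRing.Theory Num.Theory.
Import numFieldNormedType.Exports.

Local Open Scope classical_set_scope.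
Local Open Scope ring_scope.
Local Open Scope complex_scope.

Local Notation normc := Normc.normc.

(** The definite description [monomial_coef] says nothing until existence and uniqueness of the
    coefficients are known. Existence rests on one-variable power series, derived from Goursat's
    theorem in the coordinates exp (s + i t) and iterated over the variables; uniqueness rests on
    averages over roots of unity. Such averages are exact for polynomials of smaller degree, so they
    also replace all integrals over the torus. Absolute summability does not settle (i), since the
    sum must be [f z]. The condition forces z^*_n -> 0, so [z] is the norm limit of its truncations
    to finitely many coordinates, where the expansion is known. The 1/2 in (i) comes from 1 / k_1,
    which is close to 2: if the sum of the z^*_j ^ 2 up to n is at most a log n, monotonicity gives
    z^*_n ^ 2 <= a log n / n, while the exponential factor is about n ^ (2 a). The 1 in (ii) comes
    from comparing V, at least about n ^ b, with n log n, the order of the logarithm of the size of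
    a net in the n-dimensional polydisc. *)

Section Modulus.
Variable R : realType.
Local Notation C := R[i].
Implicit Types x y : C.

Lemma normcX x n : normc (x ^+ n) = normc x ^+ n.
Proof.
elim: n => [|n IH]; first by rewrite !expr0 Normc.normc1.
by rewrite !exprS Normc.normcM IH.
Qed.

Lemma normc_prod (I : Type) (r : seq I) (P : pred I) (F : I -> C) :
  normc (\prod_(i <- r | P i) F i) = \prod_(i <- r | P i) normc (F i).
Proof. exact: (big_morph _ (@Normc.normcM R) (@Normc.normc1 R)). Qed.

Lemma ler_normc_sum (I : Type) (r : seq I) (P : pred I) (F : I -> C) :
  normc (\sum_(i <- r | P i) F i) <= \sum_(i <- r | P i) normc (F i).
Proof.
elim/big_rec2: _ => [|i y1 y2 _ IH]; first by rewrite Normc.normc0.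
by apply: (le_trans (le_normcD _ _)); rewrite lerD2l.
Qed.

Lemma normcR (r : R) : normc r%:C = `|r|.
Proof. by rewrite /= expr0n addr0 sqrtr_sqr. Qed.

Lemma normc_nat n : normc (n%:R : C) = n%:R.
Proof. by rewrite -(rmorph_nat (real_complex R)) normcR ger0_norm ?ler0n. Qed.

Lemma normcB x y : normc (x - y) = normc (y - x).
Proof. by rewrite -normcN opprB. Qed.

Lemma ler_normcB x y : normc (x - y) <= normc x + normc y.
Proof. by rewrite -(normcN y) le_normcD. Qed.

Lemma lerB_normc x y : normc x - normc y <= normc (x - y).
Proof. by rewrite lerBlDr -{1}(subrK y x) le_normcD. Qed.

Lemma normc_eq0 x : (normc x == 0) = (x == 0).
Proof.
by apply/eqP/eqP => [/Normc.eq0_normc //|->]; rewrite Normc.normc0.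
Qed.

Lemma normc_le0 x : normc x <= 0 -> x = 0.
Proof.
move=> h; apply/eqP; rewrite -normc_eq0; apply/eqP/le_anti.
by rewrite h normc_ge0.
Qed.

Lemma normcM2 x : normc x ^+ 2 = complex.Re x ^+ 2 + complex.Im x ^+ 2.
Proof. by case: x => a b /=; rewrite sqr_sqrtr // addr_ge0 ?sqr_ge0. Qed.

Lemma Re_le_normc x : `|complex.Re x| <= normc x.
Proof.
case: x => a b /=; rewrite -sqrtr_sqr ler_wsqrtr // lerDl sqr_ge0 //.
Qed.

Lemma Im_le_normc x : `|complex.Im x| <= normc x.
Proof.
case: x => a b /=; rewrite -sqrtr_sqr ler_wsqrtr // lerDr sqr_ge0 //.
Qed.

Lemma normc_le_ReIm x : normc x <= `|complex.Re x| + `|complex.Im x|.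
Proof.
rewrite -ler_sqr ?nnegrE ?addr_ge0 // ?normc_ge0 //.
rewrite normcM2 sqrrD !real_normK ?num_real // lerD2r lerDl.
by rewrite mulrn_wge0 // mulr_ge0.
Qed.

Lemma normc_conj x : normc x^* = normc x.
Proof. by case: x => a b /=; rewrite sqrrN. Qed.

Lemma mulc_conj x : x * x^* = (normc x ^+ 2)%:C.
Proof.
by rewrite normcM2; case: x => a b; simpc; congr (_ +i* _); rewrite /=; ring.
Qed.

(** Rotating a complex number onto the nonnegative reals lets real arguments, such as the mean value
    theorem, bound its modulus. *)
Lemma normc_phase x : exists2 u : C, normc u = 1 & u * x = (normc x)%:C.
Proof.
have [->|x0] := eqVneq x 0.
  by exists 1; rewrite ?Normc.normc1 // mulr0 Normc.normc0.
have n0 : normc x != 0 by rewrite normc_eq0.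
exists (x^* / (normc x)%:C).
  by rewrite Normc.normcM Normc.normcV normc_conj normcR ger0_norm ?divff ?normc_ge0.
rewrite mulrAC [_^* * _]mulrC mulc_conj -fmorphV -rmorphM expr2 mulfK //.
Qed.

End Modulus.

(** * Roots of unity and discrete orthogonality *)

Section RootsOfUnity.
Variable R : realType.
Local Notation C := R[i].

(** [R[i]] is algebraically closed and 'X^n - 1 is separable in characteristic 0, so it has n
    distinct roots, among which one is primitive. *)
Lemma prim_rootC_exists n : (n > 0)%N -> exists w : C, n.-primitive_root w.
Proof.
move=> n0; have [r rE] := closed_field_poly_normal ('X^n - 1 : {poly C}).
have {}rE : 'X^n - 1 = \prod_(z <- r) ('X - z%:P) :> {poly C}.
  by rewrite {1}rE (monicP (monicXnsubC 1 n0)) scale1r.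
have [|||w _ pw] := hasP (@has_prim_root _ n r n0 _ _ _); last by exists w.
- by apply/allP => z; rewrite -root_prod_XsubC -rE.
- by rewrite -separable_prod_XsubC -rE separable_Xn_sub_1 // pnatr_eq0 -lt0n.
- by rewrite -ltnS -(size_prod_XsubC r id) -rE size_XnsubC.
Qed.

Lemma normc_prim_root n (w : C) : (n > 0)%N -> n.-primitive_root w -> normc w = 1.
Proof.
move=> n0 /prim_expr_order wn; apply/eqP.
rewrite -(@pexpr_eq1 _ _ n) ?normc_ge0 //.
by rewrite -normcX wn Normc.normc1.
Qed.

(** Orthogonality of the characters of Z/n, by the geometric sum: every later average over a circle
    or a torus rests on it. *)
Lemma sum_prim_root n (w : C) k : n.-primitive_root w ->
  \sum_(i < n) (w ^+ i) ^+ k = if (n %| k)%N then n%:R else 0.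
Proof.
move=> pw; under eq_bigr do rewrite -exprM mulnC exprM.
case: ifP => nk.
  rewrite (prim_order_dvd pw) in nk; rewrite (eqP nk).
  by under eq_bigr do rewrite expr1n; rewrite sumr_const card_ord.
have := subrX1 (w ^+ k) n; rewrite -exprM mulnC exprM (prim_expr_order pw).
rewrite expr1n subrr => /esym/eqP; rewrite mulf_eq0 => /orP[|/eqP //].
by rewrite subr_eq0 -(prim_order_dvd pw) nk.
Qed.

End RootsOfUnity.

(** * Goursat's theorem *)

Section RealDerivative.
Variable R : realType.
Local Notation C := R[i].

Lemma is_derive_epsP (f : R -> R) (x df : R) :
  is_derive x 1 f df <->
  (forall e : R, 0 < e -> exists2 d : R, 0 < d & forall h, `|h| < d ->
     `|f (x + h) - f x - h * df| <= e * `|h|).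
Proof.
split=> [fx e e0|H].
  have /derivable_nbhs/eqaddoP := @ex_derive _ _ _ _ _ _ _ fx.
  move=> /(_ _ e0) /nbhs_ballP[d /= d0 Hd].
  exists d => // h hd; have := Hd h; rewrite /ball /= sub0r normrN => /(_ hd).
  rewrite derive_val !fctE /= [_ *: 1]mulr1 opprD addrA (addrC h x).
  by rewrite [_ *: df]mulrC (mulrC h).
have Hc : h^-1 *: (f (h *: 1 + x) - f x) @[h --> 0^'] --> df.
  apply/cvgrPdist_le => e e0; have [d d0 Hd] := H e e0.
  rewrite near_withinE; apply/nbhs_ballP; exists d => //= h.
  rewrite /ball /= sub0r normrN => hd h0.
  rewrite [_ *: 1]mulr1 distrC -(ler_pM2r (_ : 0 < `|h|)) ?normr_gt0 //.
  rewrite -normrM mulrBl [_ *: _ * _]mulrAC mulVf // mul1r [df * h]mulrC.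
  by rewrite addrC (addrC h x) addrC; exact: Hd.
apply: DeriveDef; first by apply/cvg_ex; exists df.
exact/cvg_lim.
Qed.

(** The derivative of a complex function of a real variable, in epsilon form because the normed
    module structure put on [R[i]] has complex scalars. *)
Definition has_der (F : R -> C) (x : R) (d : C) := forall e : R, 0 < e ->
  exists2 r : R, 0 < r & forall h, `|h| < r ->
    normc (F (x + h) - F x - h%:C * d) <= e * `|h|.

Lemma has_derD F G x a b : has_der F x a -> has_der G x b ->
  has_der (fun t => F t + G t) x (a + b).
Proof.
move=> HF HG e e0; have e2 : 0 < e / 2 by rewrite divr_gt0.
have [r r0 Hr] := HF _ e2; have [s s0 Hs] := HG _ e2.
exists (Num.min r s) => [|h]; first by rewrite lt_min r0.
rewrite lt_min => /andP[hr hs].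
have -> : F (x + h) + G (x + h) - (F x + G x) - h%:C * (a + b) =
  (F (x + h) - F x - h%:C * a) + (G (x + h) - G x - h%:C * b) by ring.
apply: (le_trans (le_normcD _ _)).
by rewrite [e]splitr mulrDl lerD ?Hr ?Hs.
Qed.

Lemma has_derZ F x a c : has_der F x a -> has_der (fun t => c * F t) x (c * a).
Proof.
move=> HF e e0; have c0 : 0 < normc c + 1 by rewrite ltr_wpDl ?normc_ge0.
have [r r0 Hr] := HF (e / (normc c + 1)) (divr_gt0 e0 c0).
exists r => // h hr.
have -> : c * F (x + h) - c * F x - h%:C * (c * a) =
  c * (F (x + h) - F x - h%:C * a) by ring.
rewrite Normc.normcM; apply: (le_trans (ler_wpM2l (normc_ge0 _) (Hr h hr))).
rewrite mulrA ler_wpM2r // mulrCA ler_piMr ?ltW // ltr_pdivrMr //.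
by rewrite mul1r ltrDl.
Qed.

Lemma has_derB F G x a b : has_der F x a -> has_der G x b ->
  has_der (fun t => F t - G t) x (a - b).
Proof.
move=> HF HG; have := has_derD HF (has_derZ (-1) HG).
by rewrite mulN1r; under eq_fun do rewrite mulN1r.
Qed.

Lemma has_der_poly (a b c : C) x :
  has_der (fun t => a + b * t%:C + c * (t ^+ 2)%:C) x (b + 2 * c * x%:C).
Proof.
move=> e e0; exists (e / (normc c + 1)) => [|h hr].
  by rewrite divr_gt0 // ltr_wpDl ?normc_ge0.
have -> : a + b * (x + h)%:C + c * ((x + h) ^+ 2)%:C -
   (a + b * x%:C + c * (x ^+ 2)%:C) - h%:C * (b + 2 * c * x%:C) =
   c * h%:C * h%:C by rewrite !rmorphD /= !rmorphXn /= rmorphD /=; ring.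
rewrite !Normc.normcM !normcR ler_wpM2r //.
move/ltW: hr; rewrite ler_pdivlMr ?ltr_wpDl ?normc_ge0 // => hr.
by apply: le_trans hr; rewrite mulrC ler_wpM2l // lerDl.
Qed.

Lemma has_der_Re F x d u : has_der F x d ->
  is_derive x 1 (fun t => complex.Re (u * F t)) (complex.Re (u * d)).
Proof.
move=> /(has_derZ u) H; apply/is_derive_epsP => e e0.
have [r r0 Hr] := H e e0; exists r => // h hr.
apply: le_trans (Hr h hr); apply: le_trans (Re_le_normc _).
rewrite -!raddfB /=; set v := u * F (x + h) - u * F x.
by case: v => a b; case: (u * d) => a' b'; simpc.
Qed.

Lemma has_der_real f g x a b : is_derive x (1 : R) f a -> is_derive x (1 : R) g b ->
  has_der (fun t => f t +i* g t) x (a +i* b).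
Proof.
move=> /is_derive_epsP Hf /is_derive_epsP Hg e e0.
have e2 : 0 < e / 2 by rewrite divr_gt0.
have [r r0 Hr] := Hf _ e2; have [s s0 Hs] := Hg _ e2.
exists (Num.min r s) => [|h]; first by rewrite lt_min r0.
rewrite lt_min => /andP[hr hs].
apply: (le_trans (normc_le_ReIm _)); simpc => /=.
by rewrite [e]splitr mulrDl; apply: lerD; [exact: Hr|exact: Hs].
Qed.

Lemma has_der_bound F d (a b B : R) : a <= b ->
  (forall x, a <= x <= b -> has_der F x (d x)) ->
  (forall x, a <= x <= b -> normc (d x) <= B) ->
  normc (F b - F a) <= B * (b - a).
Proof.
move=> ab HF Hd; have [u u1 uE] := normc_phase (F b - F a).
pose f t := complex.Re (u * F t).
have fd x : x \in `[a, b] -> is_derive x 1 f (complex.Re (u * d x)).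
  by rewrite in_itv => /= xab; exact/has_der_Re/HF.
have fc : {within `[a, b], continuous f}.
  apply: continuous_in_subspaceT => x /[!inE] xab.
  by apply/differentiable_continuous/derivable1_diffP; have := fd x xab; case.
have fdo x : x \in `]a, b[ -> is_derive x 1 f (complex.Re (u * d x)).
  by move=> xab; apply: fd; apply: subset_itv_oo_cc.
have [c cab fE] := MVT_segment ab fdo fc.
have -> : normc (F b - F a) = f b - f a.
  by rewrite /f -raddfB /= -mulrBr uE.
rewrite fE ler_wpM2r ?subr_ge0 //.
apply: le_trans (ler_norm _) (le_trans (Re_le_normc _) _).
by rewrite Normc.normcM u1 mul1r Hd // -in_itv.
Qed.

Lemma has_der0_const F (a b : R) : a <= b ->
  (forall x, a <= x <= b -> has_der F x 0) -> F a = F b.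
Proof.
move=> ab /has_der_bound -/(_ 0 ab); rewrite mul0r => H.
apply/esym/eqP; rewrite -subr_eq0; apply/eqP/normc_le0/H => x _.
by rewrite Normc.normc0.
Qed.

End RealDerivative.

Section Goursat.
Variable R : realType.
Local Notation C := R[i].

Lemma nested_intervals (u v : nat -> R) :
  (forall n, u n <= u n.+1) -> (forall n, v n.+1 <= v n) ->
  (forall n, u n <= v n) -> exists x, forall n, u n <= x <= v n.
Proof.
move=> ui vd uv.
have um m n : (m <= n)%N -> u m <= u n.
  by move/subnK <-; elim: (n - m)%N => // k IH; rewrite addSn; exact: le_trans IH (ui _).
have vm m n : (m <= n)%N -> v n <= v m.
  by move/subnK <-; elim: (n - m)%N => // k IH; rewrite addSn; exact: le_trans (vd _) IH.
have uvm m n : u m <= v n.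
  apply: (le_trans (um _ _ (leq_maxl m n))); apply: (le_trans (uv _)).
  exact: vm (leq_maxr m n).
exists (sup (range u)) => n; apply/andP; split.
  apply: ub_le_sup; last by exists n.
  by exists (v 0%N) => _ [m _ <-].
by apply: ge_sup; [exists (u 0%N), 0%N|move=> _ [m _ <-]].
Qed.

Definition rect := (R * R * R * R)%type.

Definition quarters (q : rect) : seq rect :=
  let: (a, b, c, d) := q in
  [seq (x.1, x.2, y.1, y.2) | x <- [:: (a, (a + b) / 2); ((a + b) / 2, b)],
                              y <- [:: (c, (c + d) / 2); ((c + d) / 2, d)]].

(** The compactness part of Goursat's argument: a bad quarter is chosen again and again, and the
    sides, halved each time, close in on a point. *)
Lemma bisection (bad : rect -> Prop) (A B C D : R) : A < B -> C < D ->
  (forall a b c d, a < b -> c < d -> A <= a -> b <= B -> C <= c -> d <= D ->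
     bad (a, b, c, d) -> exists2 q, q \in quarters (a, b, c, d) & bad q) ->
  bad (A, B, C, D) ->
  exists x y, A <= x <= B /\ C <= y <= D /\ forall n, exists a b c d,
    [/\ A <= a <= x, x <= b <= B, C <= c <= y, y <= d <= D &
    [/\ b - a = (B - A) / 2 ^+ n, d - c = (D - C) / 2 ^+ n & bad (a, b, c, d)]].
Proof.
move=> AB CD Hbad bad0.
pose good q := let: (a, b, c, d) := q : rect in
  [/\ a < b, c < d, A <= a /\ b <= B, C <= c /\ d <= D & bad q].
(* Goodness is put under the existential quantifier so that [choice] yields a function on all
   rectangles, which can be iterated. *)
have step q : exists q', good q -> q' \in quarters q /\ good q'.
  have [gq|ngq] := pselect (good q); last by exists q.
  move: q gq => [[[a b] c] d] [ab cd [Aa bB] [Cc dD] bq].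
  have [q' q'q bq'] := Hbad _ _ _ _ ab cd Aa bB Cc dD bq.
  exists q' => _; split=> //; move: q'q bq'; rewrite !inE.
  by case/or4P => /eqP -> bq' /=; split=> //; try split; lra.
have [f Hf] := choice step.
pose s n := iter n f (A, B, C, D).
have gs n : good (s n).
  elim: n => [|n IH]; first by split=> //; rewrite !lexx.
  by have [] := Hf _ IH.
pose a n := (s n).1.1.1; pose b n := (s n).1.1.2.
pose c n := (s n).1.2; pose d n := (s n).2.
have sE n : s n = (a n, b n, c n, d n) by rewrite /a /b /c /d; case: (s n) => [[[? ?] ?] ?].
have HS n : [/\ a n <= a n.+1, b n.+1 <= b n, c n <= c n.+1, d n.+1 <= d n &
    (b n.+1 - a n.+1 = (b n - a n) / 2) /\ (d n.+1 - c n.+1 = (d n - c n) / 2)].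
  have [+ _] := Hf _ (gs n); have := gs n; rewrite -[f (s n)]/(s n.+1).
  rewrite (sE n) (sE n.+1) !inE => -[ab cd _ _ _].
  by case/or4P => /eqP [-> -> -> ->]; split; try split; lra.
have gab n : a n < b n by have := gs n; rewrite sE => -[].
have gcd n : c n < d n by have := gs n; rewrite sE => -[].
have [|||x Hx] := @nested_intervals a b.
- by move=> n; case: (HS n).
- by move=> n; case: (HS n).
- by move=> n; exact: ltW.
have [|||y Hy] := @nested_intervals c d.
- by move=> n; case: (HS n).
- by move=> n; case: (HS n).
- by move=> n; exact: ltW.
exists x, y; split; first exact: Hx 0%N.
split; first exact: Hy 0%N.
move=> n; exists (a n), (b n), (c n), (d n).
have /andP[ax xb] := Hx n; have /andP[cy yd] := Hy n.
have := gs n; rewrite sE => -[_ _ [Aa bB] [Cc dD] bq].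
split; [by rewrite Aa|by rewrite xb|by rewrite Cc|by rewrite yd|].
split=> //.
  elim: n {ax xb cy yd Aa bB Cc dD bq} => [|n IH]; first by rewrite expr0 divr1.
  by case: (HS n) => _ _ _ _ [-> _]; rewrite IH exprSr invfM mulrA.
elim: n {ax xb cy yd Aa bB Cc dD bq} => [|n IH]; first by rewrite expr0 divr1.
by case: (HS n) => _ _ _ _ [_ ->]; rewrite IH exprSr invfM mulrA.
Qed.

Variables (G P Q : R -> R -> C).

(* The integral of [G (x, y) (dx + i dy)] along the boundary of a rectangle,
   for [P] and [Q] antiderivatives of [G] in [x] and in [y]. *)
Definition contour (q : rect) : C := let: (a, b, c, d) := q in
  (P b c - P a c) - (P b d - P a d) + 'i * ((Q b d - Q b c) - (Q a d - Q a c)).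

Lemma contour_splitx m a b c d :
  contour (a, b, c, d) = contour (a, m, c, d) + contour (m, b, c, d).
Proof. by rewrite /contour; ring. Qed.

Lemma contour_splity m a b c d :
  contour (a, b, c, d) = contour (a, b, c, m) + contour (a, b, m, d).
Proof. by rewrite /contour; ring. Qed.

Definition cdiff_at (x0 y0 : R) := exists D : C, forall e : R, 0 < e ->
  exists2 r : R, 0 < r & forall x y, `|x - x0| < r -> `|y - y0| < r ->
  normc (G x y - G x0 y0 - D * ((x - x0)%:C + 'i * (y - y0)%:C)) <=
    e * (`|x - x0| + `|y - y0|).

Definition antiderivatives (A B C D : R) := forall x y,
  A <= x <= B -> C <= y <= D ->
  has_der (P ^~ y) x (G x y) /\ has_der (Q x) y (G x y).

(** The affine approximation of [G] has zero contour. The remainder is at most e / 2 times the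
    half-perimeter, on a path twice as long as the half-perimeter. *)
Lemma contour_small A B C D x0 y0 : antiderivatives A B C D -> cdiff_at x0 y0 ->
  forall e : R, 0 < e -> exists2 r : R, 0 < r & forall a b c d,
    A <= a <= x0 -> x0 <= b <= B -> C <= c <= y0 -> y0 <= d <= D ->
    (b - a) + (d - c) < r ->
    normc (contour (a, b, c, d)) <= e * ((b - a) + (d - c)) ^+ 2.
Proof.
move=> HPQ [K HK] e e0; have [r r0 Hr] := HK (e / 2) (divr_gt0 e0 (ltr0n _ 2)).
exists r => // a b c d /andP[Aa ax] /andP[xb bB] /andP[Cc cy] /andP[yd dD] small.
pose L := (b - a) + (d - c).
have HG x y : a <= x <= b -> c <= y <= d ->
    normc (G x y - G x0 y0 - K * ((x - x0)%:C + 'i * (y - y0)%:C)) <= e / 2 * L.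
  move=> /andP[ax' xb'] /andP[cy' yd'].
  have hx : `|x - x0| <= b - a by rewrite ler_norml; lra.
  have hy : `|y - y0| <= d - c by rewrite ler_norml; lra.
  have L0 : 0 <= d - c by lra.
  have L1 : 0 <= b - a by lra.
  apply: (le_trans (Hr x y _ _)); [by lra|by lra|].
  by rewrite ler_pM2l ?divr_gt0 // lerD.
(* The increment of [P] is compared with that of a quadratic primitive of the affine approximation,
   which equals the length times the value at the midpoint. *)
have HP y : c <= y <= d ->
    normc (P b y - P a y - (b - a)%:C * (G x0 y0 + K *
      (((a + b) / 2 - x0)%:C + 'i * (y - y0)%:C))) <= e / 2 * L * (b - a).
  move=> cyd.
  pose w := G x0 y0 - K * x0%:C + K * 'i * (y - y0)%:C.
  have := @has_der_bound _ (fun x => P x y - (0 + w * x%:C + (K / 2) * (x ^+ 2)%:C))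
    (fun x => G x y - (w + 2 * (K / 2) * x%:C)) a b (e / 2 * L).
  set lhs := normc _; set rhs := normc _; have -> : lhs = rhs.
    congr normc; rewrite /w; set X := P b y; set Y := P a y; set Z := G _ _.
    rewrite !(rmorphB, rmorphD, rmorphM, rmorphXn, fmorphV, rmorph_nat) /=.
    by field.
  apply; first lra.
    move=> x xab; apply: has_derB; last exact: has_der_poly.
    by have [|//|//] := HPQ x y _ _; move: xab cyd => /andP[? ?] /andP[? ?]; lra.
  move=> x xab; apply: le_trans (HG x y xab cyd); rewrite le_eqVlt; apply/orP; left.
  apply/eqP; congr normc; rewrite /w; set X := G x y; set Y := G x0 y0.
  by rewrite !rmorphB /=; field.
have HQ x : a <= x <= b ->
    normc (Q x d - Q x c - (d - c)%:C * (G x0 y0 + K *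
      ((x - x0)%:C + 'i * ((c + d) / 2 - y0)%:C))) <= e / 2 * L * (d - c).
  move=> axb.
  pose w := G x0 y0 + K * (x - x0)%:C - K * 'i * y0%:C.
  have := @has_der_bound _ (fun y => Q x y - (0 + w * y%:C + (K * 'i / 2) * (y ^+ 2)%:C))
    (fun y => G x y - (w + 2 * (K * 'i / 2) * y%:C)) c d (e / 2 * L).
  set lhs := normc _; set rhs := normc _; have -> : lhs = rhs.
    congr normc; rewrite /w; set X := Q x d; set Y := Q x c; set Z := G _ _.
    rewrite !(rmorphB, rmorphD, rmorphM, rmorphXn, fmorphV, rmorph_nat) /=.
    by field.
  apply; first lra.
    move=> y ycd; apply: has_derB; last exact: has_der_poly.
    by have [|//|//] := HPQ x y _ _; move: axb ycd => /andP[? ?] /andP[? ?]; lra.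
  move=> y ycd; apply: le_trans (HG x y axb ycd); rewrite le_eqVlt; apply/orP; left.
  apply/eqP; congr normc; rewrite /w; set X := G x y; set Y := G x0 y0.
  by rewrite !rmorphB /=; field.
have Pc := HP c; have Pd := HP d; have Qa := HQ a; have Qb := HQ b.
rewrite (_ : contour (a, b, c, d) =
  ((P b c - P a c - (b - a)%:C * (G x0 y0 + K * (((a + b) / 2 - x0)%:C + 'i * (c - y0)%:C)))
  - (P b d - P a d - (b - a)%:C * (G x0 y0 + K * (((a + b) / 2 - x0)%:C + 'i * (d - y0)%:C))))
  + 'i * ((Q b d - Q b c - (d - c)%:C * (G x0 y0 + K * ((b - x0)%:C + 'i * ((c + d) / 2 - y0)%:C)))
  - (Q a d - Q a c - (d - c)%:C * (G x0 y0 + K * ((a - x0)%:C + 'i * ((c + d) / 2 - y0)%:C))))); last first.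
  rewrite /contour; move: (P _ _) (P _ _) (P _ _) (P _ _) (Q _ _) (Q _ _) (Q _ _) (Q _ _).
  by move=> *; rewrite !rmorphB /=; ring.
apply: (le_trans (le_normcD _ _)); rewrite Normc.normcM.
have -> : normc ('i : R[i]) = 1 by rewrite /= expr0n expr1n add0r sqrtr1.
rewrite mul1r; apply: (le_trans (lerD (ler_normcB _ _) (ler_normcB _ _))).
apply: le_trans (lerD (lerD (Pc _) (Pd _)) (lerD (Qb _) (Qa _))) _.
- by apply/andP; split; lra.
- by apply/andP; split; lra.
- by apply/andP; split; lra.
- by apply/andP; split; lra.
by rewrite /L expr2 le_eqVlt; apply/orP; left; apply/eqP; field.
Qed.

End Goursat.

Section GoursatTheorem.
Variable R : realType.

Lemma ltr_expn2 (a r : R) : 0 < r -> exists n, a / 2 ^+ n < r.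
Proof.
move=> r0; have [n _ Hn] := near_infty_natSinv_lt (PosNum r0).
pose m := Num.Def.truncn (`|a| / r); exists m.+1.
rewrite ltr_pdivrMr ?exprn_gt0 //.
have : `|a| / r < (2 ^ m.+1)%:R.
  have /andP[_ h] := truncn_itv (divr_ge0 (normr_ge0 a) (ltW r0)).
  by apply: (lt_le_trans h); rewrite ler_nat ltnW // ltn_expl.
rewrite ltr_pdivrMr // natrX mulrC; exact: le_lt_trans (ler_norm _).
Qed.

Variables (G P Q : R -> R -> R[i]) (A B A' B' : R).
Hypotheses (AB : A < B) (AB' : A' < B').
Hypothesis PQ : antiderivatives G P Q A B A' B'.
Local Notation contour := (contour P Q).

Lemma goursat : (forall x y, A <= x <= B -> A' <= y <= B' -> cdiff_at G x y) ->
  contour (A, B, A', B') = 0.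
Proof.
move=> HG; apply/eqP; rewrite -normc_eq0; apply/negPn/negP => K0.
pose K := normc (contour (A, B, A', B')).
have {}K0 : 0 < K by rewrite lt_neqAle eq_sym K0 normc_ge0.
pose s := (B - A) * (B' - A').
have s0 : 0 < s by rewrite mulr_gt0 // subr_gt0.
(* A rectangle is bad if its contour is at least its share of the total one, in proportion to the
   area. Contours and areas add up, so some quarter of a bad rectangle is bad. *)
pose bad (q : rect R) := let: (a, b, c, d) := q in
  K / s * ((b - a) * (d - c)) <= normc (contour q).
have [||x [y [xAB [yAB Hn]]]] := @bisection _ bad A B A' B' AB AB'.
- move=> a b c d ab cd _ _ _ _ bq; apply: contrapT => Nq.
  have H q : q \in quarters (a, b, c, d) -> ~ bad q.
    by move=> qq bq'; apply: Nq; exists q.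
  move: bq; rewrite /bad => /le_gtF/negP; apply.
  rewrite (contour_splitx _ _ ((a + b) / 2)).
  rewrite (contour_splity _ _ ((c + d) / 2) a) (contour_splity _ _ ((c + d) / 2) _ b).
  have h1 : ~ bad (a, (a + b) / 2, c, (c + d) / 2) by apply: H; rewrite !inE eqxx.
  have h2 : ~ bad (a, (a + b) / 2, (c + d) / 2, d) by apply: H; rewrite !inE eqxx !orbT.
  have h3 : ~ bad ((a + b) / 2, b, c, (c + d) / 2) by apply: H; rewrite !inE eqxx !orbT.
  have h4 : ~ bad ((a + b) / 2, b, (c + d) / 2, d) by apply: H; rewrite !inE eqxx !orbT.
  move: h1 h2 h3 h4; rewrite /bad.
  move=> /negP; rewrite -ltNge => h1 /negP; rewrite -ltNge => h2.
  move=> /negP; rewrite -ltNge => h3 /negP; rewrite -ltNge => h4.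
  apply: le_lt_trans (le_normcD _ _) _.
  apply: le_lt_trans (lerD (le_normcD _ _) (le_normcD _ _)) _.
  apply: lt_le_trans (ltrD (ltrD h1 h2) (ltrD h3 h4)) _.
  by rewrite le_eqVlt; apply/orP; left; apply/eqP; field; rewrite gt_eqF.
- by rewrite /bad -/s divfK ?gt_eqF.
pose w := (B - A) + (B' - A').
have w0 : 0 < w by rewrite addr_gt0 // subr_gt0.
(* With this accuracy the local estimate is half of K / 4 ^ n, the share of the n-th rectangle. *)
have e0 : 0 < K / (2 * w ^+ 2) by rewrite divr_gt0 // mulr_gt0 // exprn_gt0.
have [r r0 Hr] := contour_small PQ (HG x y xAB yAB) e0.
have [n nr] := ltr_expn2 w r0.
have [a [b [c [d [Ha Hb Hc Hd [ba dc bq]]]]]] := Hn n.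
have := Hr a b c d Ha Hb Hc Hd; rewrite ba dc -mulrDl -/w => /(_ nr) h.
move: bq; rewrite /bad ba dc => /le_trans/(_ h); apply/negP; rewrite -ltNge.
have k0 : 0 < (2 ^+ n : R) by rewrite exprn_gt0.
rewrite (_ : _ * (w / 2 ^+ n) ^+ 2 = K / 2 / (2 ^+ n) ^+ 2); last first.
  by field; rewrite !gt_eqF.
rewrite (_ : K / s * _ = K / (2 ^+ n) ^+ 2); last first.
  by rewrite /s; field; rewrite !gt_eqF // subr_gt0.
by rewrite ltr_pM2r ?invr_gt0 ?exprn_gt0 // ltr_pdivrMr // ltr_pMr // ltr1n.
Qed.

End GoursatTheorem.

Section GoursatException.
Variable R : realType.
Variables (G P Q : R -> R -> R[i]) (A B A' B' : R).
Hypothesis PQ : antiderivatives G P Q A B A' B'.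
Local Notation contour := (contour P Q).

Lemma antiderivativesS a b a' b' : A <= a -> b <= B -> A' <= a' -> b' <= B' ->
  antiderivatives G P Q a b a' b'.
Proof.
move=> Aa bB Aa' bB' x y /andP[ax xb] /andP[ay yb].
by apply: PQ; apply/andP; split; lra.
Qed.

(** The point is enclosed in a square of half-side [t], whose contour is at most 8 t M; what
    surrounds it is cut into rectangles to which [goursat] applies. The exception is meant for a
    difference quotient at its base point, where only continuity is at hand. *)
Lemma goursat_exception x0 y0 (M r : R) : A < x0 < B -> A' < y0 < B' -> 0 < r ->
  (forall x y, `|x - x0| < r -> `|y - y0| < r -> normc (G x y) <= M) ->
  (forall x y, A <= x <= B -> A' <= y <= B' -> (x, y) != (x0, y0) ->
     cdiff_at G x y) ->
  contour (A, B, A', B') = 0.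
Proof.
move=> /andP[Ax xB] /andP[Ay yB] r0 HM HG; apply: normc_le0; apply/ler_addgt0Pl => e e0.
rewrite addr0.
have M0 : 0 <= M by apply: le_trans (HM x0 y0 _ _); rewrite ?normc_ge0 ?subrr ?normr0.
pose m1 := Num.min (x0 - A) (B - x0).
pose m2 := Num.min (y0 - A') (B' - y0).
pose m := Num.min (Num.min m1 m2) (Num.min r (e / (8 * (M + 1)))).
have m0 : 0 < m by rewrite !lt_min !subr_gt0 Ax xB Ay yB r0 divr_gt0 ?mulr_gt0 ?ltr_wpDl.
pose t := m / 2.
have t0 : 0 < t by rewrite divr_gt0.
have tm : t < m by rewrite /t; lra.
have := tm; rewrite !lt_min => /andP[/andP[/andP[t1 t2] /andP[t3 t4]] /andP[t5 t6]].
have zero a b a' b' : A <= a -> a < b -> b <= B -> A' <= a' -> a' < b' -> b' <= B' ->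
    (x0 < a) || (b < x0) || (y0 < a') || (b' < y0) -> contour (a, b, a', b') = 0.
  move=> ? ab ? ? ab' ? out; apply: (@goursat _ G) => //.
    exact: antiderivativesS.
  move=> x y /andP[ax xb] /andP[ay yb]; apply: HG; [by apply/andP; split; lra..|].
  apply: contraTneq out => -[xE yE]; rewrite xE yE in ax xb ay yb.
  by rewrite !negb_or -!leNgt ax xb ay yb.
rewrite (contour_splitx _ _ (x0 - t)) zero ?add0r; try lra.
rewrite (contour_splitx _ _ (x0 + t)) [X in _ + X]zero ?addr0; try lra.
rewrite (contour_splity _ _ (y0 - t)) zero ?add0r; try lra.
rewrite (contour_splity _ _ (y0 + t)) [X in _ + X]zero ?addr0; try lra.
have near0 x y : x0 - t <= x <= x0 + t -> y0 - t <= y <= y0 + t ->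
    [/\ normc (G x y) <= M, has_der (P ^~ y) x (G x y) & has_der (Q x) y (G x y)].
  move=> /andP[? ?] /andP[? ?]; split.
  - by apply: HM; rewrite ltr_norml; apply/andP; split; lra.
  - by case: (@PQ x y) => //; apply/andP; split; lra.
  - by case: (@PQ x y) => //; apply/andP; split; lra.
have HP y : y0 - t <= y <= y0 + t ->
    normc (P (x0 + t) y - P (x0 - t) y) <= M * (2 * t).
  move=> yt; rewrite (_ : 2 * t = x0 + t - (x0 - t)); last ring.
  apply: (@has_der_bound _ (P ^~ y) (G ^~ y)); first lra.
    by move=> x xt; case: (near0 x y).
  by move=> x xt; case: (near0 x y).
have HQ x : x0 - t <= x <= x0 + t ->
    normc (Q x (y0 + t) - Q x (y0 - t)) <= M * (2 * t).
  move=> xt; rewrite (_ : 2 * t = y0 + t - (y0 - t)); last ring.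
  apply: (@has_der_bound _ (Q x) (G x)); first lra.
    by move=> y yt; case: (near0 x y).
  by move=> y yt; case: (near0 x y).
apply: le_trans (le_normcD _ _) _; rewrite Normc.normcM.
have -> : normc ('i : R[i]) = 1 by rewrite /= expr0n expr1n add0r sqrtr1.
rewrite mul1r; apply: le_trans (lerD (ler_normcB _ _) (ler_normcB _ _)) _.
apply: le_trans (lerD (lerD (HP _ _) (HP _ _)) (lerD (HQ _ _) (HQ _ _))) _; try lra.
have : t * (8 * (M + 1)) < e by rewrite -ltr_pdivlMr // mulr_gt0 // ltr_wpDl.
have : 0 <= t by lra.
nra.
Qed.

End GoursatException.

(** * Logarithmic polar coordinates *)

Section Polar.
Variable R : realType.

(** This is exp (s + i t). With a logarithmic radius the map is conformal, so Goursat's theorem on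
    rectangles becomes a statement about annuli. *)
Definition polar (s t : R) : R[i] := (expR s * cos t) +i* (expR s * sin t).

Lemma polarD s t h k : polar (s + h) (t + k) = polar s t * polar h k.
Proof.
rewrite /polar; simpc; rewrite expRD cosD sinD.
by congr (_ +i* _); ring.
Qed.

Lemma normc_polar s t : normc (polar s t) = expR s.
Proof.
by rewrite /= !exprMn -mulrDr cos2Dsin2 mulr1 sqrtr_sqr ger0_norm // expR_ge0.
Qed.

Lemma polar_neq0 s t : polar s t != 0.
Proof. by rewrite -normc_eq0 normc_polar gt_eqF // expR_gt0. Qed.

Lemma polarD2pi s t : polar s (t + pi) = polar s (t - pi).
Proof.
have E x : polar s (x + pi *+ 2) = polar s x by rewrite /polar cosD2pi sinD2pi.
by have -> : t + pi = t - pi + pi *+ 2; [rewrite mulr2n; ring|exact: E].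
Qed.

Lemma polar_inj x t x0 t0 : `|t - t0| <= pi -> polar x t = polar x0 t0 ->
  (x, t) = (x0, t0).
Proof.
move=> tpi E; have /expR_inj xx : expR x = expR x0.
  by rewrite -(normc_polar x t) E normc_polar.
subst x; have {}E : polar 0 (t - t0) = 1.
  have : polar (x0 + 0) (t0 + (t - t0)) = polar x0 t0 by rewrite addr0 addrC subrK E.
  by rewrite polarD -[RHS]mulr1 => /(mulfI (polar_neq0 _ _)).
have : cos `|t - t0| = cos 0.
  have -> : cos `|t - t0| = cos (t - t0) by case: (ger0P (t - t0)) => // _; rewrite cosN.
  by move: E => [+ _]; rewrite expR0 mul1r cos0.
move=> ccos; have : `|t - t0| = 0.
  by apply: cos_inj ccos; rewrite !in_itv /= ?lexx ?tpi ?normr_ge0 ?pi_ge0.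
by move=> /normr0_eq0/eqP; rewrite subr_eq0 => /eqP ->.
Qed.

Lemma polar_ex (z : R[i]) : z != 0 ->
  exists t, `|t| <= pi /\ z = polar (ln (normc z)) t.
Proof.
move=> z0; have n0 : 0 < normc z by rewrite lt_neqAle eq_sym normc_eq0 z0 normc_ge0.
have E x y : (x +i* y) = (normc z)%:C * ((x / normc z) +i* (y / normc z)).
  by simpc; rewrite ![normc z * _]mulrC !divfK // gt_eqF.
have := E (complex.Re z) (complex.Im z).
set a := _ / _; set b := _ / _ => zE.
have ab : a ^+ 2 + b ^+ 2 = 1.
  by rewrite !expr_div_n -mulrDl -normcM2 divff // sqrf_eq0 gt_eqF.
have a1 : -1 <= a <= 1.
  rewrite -ler_norml -(@ler_pXn2r _ 2) ?nnegrE // expr1n real_normK ?num_real //.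
  by rewrite -ab lerDl sqr_ge0.
have zE' : z = (normc z)%:C * (a +i* b) by rewrite -zE; case: (z).
have p0 := acos_ge0 a1; have p1 := acos_lepi a1.
have [b0|b0] := leP 0 b.
  exists (acos a); split; first by rewrite ger0_norm.
  rewrite {1}zE' /polar lnK // acosK // sin_acos // -{1}ab addrAC subrr add0r.
  by rewrite sqrtr_sqr ger0_norm //; simpc.
exists (- acos a); split; first by rewrite normrN ger0_norm.
rewrite {1}zE' /polar lnK // cosN sinN acosK // sin_acos // -{1}ab addrAC subrr add0r.
by rewrite sqrtr_sqr ltr0_norm // opprK; simpc.
Qed.

Lemma polar_expansion e : 0 < e -> exists2 r : R, 0 < r & forall h k,
  `|h| < r -> `|k| < r ->
  normc (polar h k - 1 - (h%:C + 'i * k%:C)) <= e * (`|h| + `|k|).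
Proof.
move=> e0; pose d := Num.min (e / 6) 1.
have d0 : 0 < d by rewrite lt_min ltr01 divr_gt0.
have [a a0 Ha] := (is_derive_epsP _ _ _).1 (is_derive_expR (0 : R)) d d0.
have [b b0 Hb] := (is_derive_epsP _ _ _).1 (is_derive_cos (0 : R)) d d0.
have [c c0 Hc] := (is_derive_epsP _ _ _).1 (is_derive_sin (0 : R)) d d0.
exists (Num.min (Num.min a (d / 2)) (Num.min b c)).
  by rewrite !lt_min a0 b0 c0 divr_gt0.
move=> h k; rewrite !lt_min => /andP[/andP[ha hd] _] /andP[_ /andP[kb kc]].
have {Ha} := Ha h ha; rewrite add0r expR0 mulr1 => Ha.
have {Hb} := Hb k kb; rewrite add0r cos0 sin0 oppr0 mulr0 subr0 => Hb.
have {Hc} := Hc k kc; rewrite add0r cos0 sin0 subr0 mulr1 => Hc.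
have d1 : d <= 1 by rewrite ge_min lexx orbT.
have de : d <= e / 6 by rewrite ge_min lexx.
have e1 : `|expR h - 1| <= d.
  rewrite -[_ - 1](subrK h); apply: le_trans (ler_normD _ _) _.
  have := normr_ge0 h; nra.
have e2 : 0 <= expR h <= 2.
  rewrite expR_ge0 /=; move: e1; rewrite ler_norml => /andP[_]; lra.
apply: (le_trans (normc_le_ReIm _)); simpc => /=.
have -> : expR h * cos k - 1 - h = (expR h - 1 - h) + expR h * (cos k - 1) by ring.
have -> : expR h * sin k - k = expR h * (sin k - k) + (expR h - 1) * k by ring.
have A1 : `|expR h * (cos k - 1)| <= 2 * d * `|k|.
  rewrite normrM ger0_norm ?expR_ge0 // -mulrA; apply: ler_pM => //; lra.
have A2 : `|expR h * (sin k - k)| <= 2 * d * `|k|.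
  rewrite normrM ger0_norm ?expR_ge0 // -mulrA; apply: ler_pM => //; lra.
have A3 : `|(expR h - 1) * k| <= d * `|k| by rewrite normrM ler_wpM2r.
apply: le_trans (lerD (ler_normD _ _) (ler_normD _ _)) _.
have := normr_ge0 h; have := normr_ge0 k; nra.
Qed.

Definition holo_at (f : R[i] -> R[i]) (z : R[i]) := exists D : R[i],
  forall e : R, 0 < e -> exists2 r : R, 0 < r & forall w, normc (w - z) < r ->
  normc (f w - f z - D * (w - z)) <= e * normc (w - z).

Definition cont_at (f : R[i] -> R[i]) (z : R[i]) := forall e : R, 0 < e ->
  exists2 r : R, 0 < r & forall w, normc (w - z) < r -> normc (f w - f z) <= e.

Lemma holo_cont f z : holo_at f z -> cont_at f z.
Proof.
move=> [D HD] e e0; have [r r0 Hr] := HD 1 ltr01.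
have D0 : 0 < normc D + 1 by rewrite ltr_wpDl ?normc_ge0.
exists (Num.min r (e / (normc D + 1))) => [|w]; first by rewrite lt_min r0 divr_gt0.
rewrite lt_min => /andP[wr we]; rewrite -[_ - _](subrK (D * (w - z))).
apply: le_trans (le_normcD _ _) _.
rewrite Normc.normcM; apply: le_trans (lerD (Hr w wr) (lexx _)) _.
rewrite mul1r -{1}[normc (w - z)]mul1r -mulrDl addrC mulrC -ler_pdivlMr //.
exact: ltW.
Qed.

Lemma polar_cont s t e : 0 < e -> exists2 r : R, 0 < r & forall x y,
  `|x - s| < r -> `|y - t| < r -> normc (polar x y - polar s t) < e.
Proof.
move=> e0; have [r r0 Hr] := polar_expansion (@ltr01 R).
have p0 : 0 < 4 * expR s by rewrite mulr_gt0 // expR_gt0.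
exists (Num.min r (e / (4 * expR s))); first by rewrite lt_min r0 divr_gt0.
move=> x y; rewrite !lt_min => /andP[xr xe] /andP[yr ye].
have -> : polar x y - polar s t = polar s t *
   ((polar (x - s) (y - t) - 1 - ((x - s)%:C + 'i * (y - t)%:C)) +
     ((x - s)%:C + 'i * (y - t)%:C)).
  have -> : polar x y = polar s t * polar (x - s) (y - t).
    by rewrite -polarD; congr polar; ring.
  by ring.
rewrite Normc.normcM normc_polar; move: xe ye; rewrite !ltr_pdivlMr // => xe ye.
have := le_normcD (polar (x - s) (y - t) - 1 - ((x - s)%:C + 'i * (y - t)%:C))
   ((x - s)%:C + 'i * (y - t)%:C).
have := Hr _ _ xr yr; rewrite mul1r.
have : normc ((x - s)%:C + 'i * (y - t)%:C) <= `|x - s| + `|y - t|.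
  by apply: le_trans (normc_le_ReIm _) _; simpc.
move=> n1 n2 n3; have S0 := expR_gt0 s.
apply: le_lt_trans (ler_wpM2l (ltW S0) (le_trans n3 (lerD n2 n1))) _.
rewrite (_ : expR s * _ =
  (`|x - s| * (4 * expR s) + `|y - t| * (4 * expR s)) / 2); last by field.
by clear -xe ye e0; lra.
Qed.

Lemma holo_polar f s t : holo_at f (polar s t) ->
  cdiff_at (fun x y => f (polar x y)) s t.
Proof.
move=> [D HD]; exists (D * polar s t) => e e0.
have S0 := expR_gt0 s.
have e1 : 0 < e / (4 * expR s) by rewrite divr_gt0 // mulr_gt0.
have D0 : 0 < 2 * (normc D + 1) * expR s.
  by rewrite !mulr_gt0 // ltr_wpDl ?normc_ge0.
have [r r0 Hr] := HD _ e1.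
have [a a0 Ha] := polar_cont s t r0.
have [b b0 Hb] := polar_expansion (@ltr01 R).
have [c c0 Hc] := polar_expansion (divr_gt0 e0 D0).
exists (Num.min a (Num.min b c)) => [|x y]; first by rewrite !lt_min a0 b0 c0.
rewrite !lt_min => /andP[xa /andP[xb xc]] /andP[ya /andP[yb yc]].
set p := polar s t; set w := (x - s)%:C + 'i * (y - t)%:C.
have pE : polar x y = p * polar (x - s) (y - t).
  by rewrite -polarD; congr polar; ring.
set q := polar (x - s) (y - t) in pE.
have -> : f (polar x y) - f p - D * p * w =
   (f (polar x y) - f p - D * (polar x y - p)) + D * p * (q - 1 - w).
  by rewrite pE; ring.
apply: le_trans (le_normcD _ _) _.
have {}Hr := Hr _ (Ha _ _ xa ya).
have {}Hb := Hb _ _ xb yb; rewrite -/q -/w mul1r in Hb.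
have {}Hc := Hc _ _ xc yc; rewrite -/q -/w in Hc.
have np : normc p = expR s by rewrite normc_polar.
have nw : normc w <= `|x - s| + `|y - t|.
  by apply: le_trans (normc_le_ReIm _) _; rewrite /w; simpc.
have nq : normc (polar x y - p) <= expR s * (2 * (`|x - s| + `|y - t|)).
  have -> : polar x y - p = p * ((q - 1 - w) + w) by rewrite pE; ring.
  rewrite Normc.normcM np ler_pM2l //; apply: le_trans (le_normcD _ _) _.
  by rewrite mulrDl mul1r lerD.
have h1 : normc (f (polar x y) - f p - D * (polar x y - p)) <=
    e / 2 * (`|x - s| + `|y - t|).
  apply: le_trans Hr _; apply: le_trans (ler_wpM2l (ltW e1) nq) _.
  by rewrite le_eqVlt; apply/orP; left; apply/eqP; field; rewrite gt_eqF.
have h2 : normc (D * p * (q - 1 - w)) <= e / 2 * (`|x - s| + `|y - t|).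
  rewrite !Normc.normcM np.
  apply: le_trans (ler_wpM2l _ Hc) _; first by rewrite mulr_ge0 ?normc_ge0 // ltW.
  have D1 : normc D / (normc D + 1) <= 1.
    by rewrite ler_pdivrMr ?ltr_wpDl ?normc_ge0 // mul1r lerDl.
  rewrite mulrA ler_wpM2r ?addr_ge0 //.
  have -> : normc D * expR s * (e / (2 * (normc D + 1) * expR s)) =
      e / 2 * (normc D / (normc D + 1)).
    by field; rewrite !gt_eqF // ltr_wpDl ?normc_ge0.
  by rewrite ler_piMr // divr_ge0 // ltW.
by rewrite [e]splitr mulrDl; exact: lerD.
Qed.

End Polar.

Section Antiderivative.
Variable R : realType.

(** The fundamental theorem of calculus for the real and imaginary parts. The margin [h] makes the
    derivatives at [a] and [b] two-sided. *)
Lemma antiderivative_exists (f : R -> R[i]) (a b h : R) : 0 < h -> a <= b ->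
  (forall x, a - h <= x <= b + h -> forall e : R, 0 < e ->
     exists2 r : R, 0 < r & forall y, `|y - x| < r -> normc (f y - f x) <= e) ->
  exists F, forall x, a <= x <= b -> has_der F x (f x).
Proof.
move=> h0 ab fc.
have real_case (g : R -> R) :
    (forall x y, `|g y - g x| <= normc (f y - f x)) ->
    exists G, forall x, a <= x <= b -> is_derive x (1 : R) G (g x).
  move=> gf.
  have gc x : a - h <= x <= b + h -> {for x, continuous g}.
    move=> xab; apply/cvgrPdist_le => e e0.
    have [r r0 Hr] := fc x xab e e0.
    apply/nbhs_ballP; exists r => //= y; rewrite /ball /= distrC => xy.
    by rewrite distrC; apply: le_trans (gf _ _) (Hr _ xy).
  have gi : (@lebesgue_measure R).-integrable `[a - h, b + h] (EFin \o g).
    apply: continuous_compact_integrable; first exact: segment_compact.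
    by apply: continuous_in_subspaceT => x /[!inE] /=; rewrite in_itv; exact: gc.
  exists (fun x => \int[(@lebesgue_measure R)]_(t in `[a - h, x]) g t)%R => x /andP[ax xb].
  have [||| d1 d2] := @continuous_FTC1_closed R g (a - h) x (b + h) _ gi.
  - by lra.
  - by lra.
  - by apply: gc; apply/andP; split; lra.
  by apply: DeriveDef; [exact: d1|rewrite -derive1E; exact: d2].
have [|Gr Hr] := @real_case (fun x => complex.Re (f x)).
  by move=> x y; rewrite -raddfB; exact: Re_le_normc.
have [|Gi Hi] := @real_case (fun x => complex.Im (f x)).
  by move=> x y; rewrite -raddfB; exact: Im_le_normc.
exists (fun t => Gr t +i* Gi t) => x xab.
have := has_der_real (Hr x xab) (Hi x xab).
by case: (f x).
Qed.

End Antiderivative.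

(** * Means over circles *)

Section CircleMean.
Variable R : realType.
Local Notation C := R[i].

(* The mean over the circle of radius [expR s] is read off an antiderivative,
   so that no complex integral is needed. *)
Definition has_mean (s : R) (f : C -> C) (m : C) := exists2 F : R -> C,
  forall t : R, - (2 * pi) <= t <= 2 * pi -> has_der F t (f (polar s t)) &
  F pi - F (- pi) = (2 * pi)%:C * m.

Lemma pi0 : 0 < (pi : R). Proof. exact: pi_gt0. Qed.

(** The increment of [F] over a window of length 2 pi has derivative zero in the position of the
    window, by periodicity. The range [- 2 pi, 2 pi] in [has_mean] is what windows centred in
    [- pi, pi] require. *)
Lemma has_mean_window s f m t : has_mean s f m -> `|t| <= pi ->
  exists2 F : R -> C,
    forall x : R, - (2 * pi) <= x <= 2 * pi -> has_der F x (f (polar s x)) &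
    F (t + pi) - F (t - pi) = (2 * pi)%:C * m.
Proof.
move=> [F HF Fm] tpi; exists F => //; rewrite -Fm.
have p0 := pi0; move: tpi; rewrite ler_norml => /andP[t1 t2].
have shift x a : `|a| <= pi -> `|x| <= pi ->
    has_der (fun y => F (y + a)) x (f (polar s (x + a))).
  rewrite !ler_norml => /andP[a1 a2] /andP[x1 x2] e e0.
  have [|r r0 Hr] := HF (x + a) _ e e0; first by apply/andP; split; lra.
  exists r => // h hr; have := Hr h hr.
  by rewrite (_ : x + a + h = x + h + a); last ring.
pose G x := F (x + pi) - F (x + - pi).
have -> : F pi - F (- pi) = G 0 by rewrite /G !add0r.
rewrite -/(G t).
have G0 x : - pi <= x <= pi -> has_der G x 0.
  move=> xpi; rewrite -(subrr (f (polar s (x + pi)))) {2}polarD2pi.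
  have xp : `|x| <= pi by rewrite ler_norml.
  by apply: has_derB; apply: shift => //; rewrite ?normrN ger0_norm ?pi_ge0.
have [t0|t0] := leP 0 t.
  by apply/esym/has_der0_const => // x /andP[? ?]; apply: G0; apply/andP; split; lra.
by apply: has_der0_const => [|x /andP[? ?]]; [exact: ltW|apply: G0; apply/andP; split; lra].
Qed.

Lemma has_meanD s f g m n : has_mean s f m -> has_mean s g n ->
  has_mean s (fun w => f w + g w) (m + n).
Proof.
move=> [F HF Fm] [G HG Gn]; exists (fun t => F t + G t).
  by move=> t tpi; apply: has_derD; [exact: HF|exact: HG].
by rewrite mulrDr -Fm -Gn; ring.
Qed.

Lemma has_meanZ s f m c : has_mean s f m -> has_mean s (fun w => c * f w) (c * m).
Proof.
move=> [F HF Fm]; exists (fun t => c * F t).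
  by move=> t tpi; apply: has_derZ; exact: HF.
by rewrite mulrCA -Fm; ring.
Qed.

Lemma has_mean_cst s c : has_mean s (fun=> c) c.
Proof.
exists (fun t => 0 + c * t%:C + 0 * (t ^+ 2)%:C).
  move=> t _; have := @has_der_poly _ 0 c 0 t.
  by rewrite mulr0 mul0r addr0.
by rewrite mulr_natl mulr2n rmorphD rmorphN /=; ring.
Qed.

Lemma has_mean_sum s n (f : nat -> C -> C) (m : nat -> C) :
  (forall i, (i < n)%N -> has_mean s (f i) (m i)) ->
  has_mean s (fun w => \sum_(i < n) f i w) (\sum_(i < n) m i).
Proof.
elim: n => [|n IH] H.
  under eq_fun do rewrite big_ord0; rewrite big_ord0; exact: has_mean_cst.
under eq_fun do rewrite big_ord_recr /=; rewrite big_ord_recr /=.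
by apply: has_meanD; [apply: IH => i ?; apply: H; lia|apply: H].
Qed.

Lemma has_mean_conj s f m : has_mean s f m -> has_mean s (fun w => (f w)^*) m^*.
Proof.
move=> [F HF Fm]; exists (fun t => (F t)^*).
  move=> t tpi e e0; have [r r0 Hr] := HF t tpi e e0; exists r => // h hr.
  apply: le_trans (Hr h hr).
  rewrite -[leRHS]normc_conj !rmorphB rmorphM /= oppr0; exact: lexx.
by rewrite -rmorphB Fm rmorphM /= oppr0.
Qed.

Lemma eq_has_mean s f g m : (forall w, normc w = expR s -> f w = g w) ->
  has_mean s f m -> has_mean s g m.
Proof.
move=> fg [F HF Fm]; exists F => // t tpi.
by rewrite -fg ?normc_polar //; exact: HF.
Qed.

Lemma has_mean_bound s f m (B : R) : (forall w, normc w = expR s -> normc (f w) <= B) ->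
  has_mean s f m -> normc m <= B.
Proof.
move=> fB [F HF Fm]; have p0 := pi0.
have := @has_der_bound _ F (fun t => f (polar s t)) (- pi) pi B.
have pi2 : 0 < 2 * pi :> R by rewrite mulr_gt0.
rewrite Fm Normc.normcM normcR (gtr0_norm pi2).
have -> : B * (pi - - pi) = 2 * pi * B by ring.
rewrite ler_pM2l ?mulr_gt0 //; apply; first lra.
  by move=> x /andP[? ?]; apply: HF; apply/andP; split; lra.
by move=> x _; rewrite fB // normc_polar.
Qed.

Lemma has_mean_unique s f m n : has_mean s f m -> has_mean s f n -> m = n.
Proof.
move=> fm fn; apply/eqP; rewrite -subr_eq0; apply/eqP/normc_le0.
have := has_meanD fm (has_meanZ (-1) fn); rewrite mulN1r.
apply: has_mean_bound => w _; rewrite mulN1r subrr Normc.normc0 //.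
Qed.

Lemma has_mean_ex s f : (forall w, normc w = expR s -> cont_at f w) ->
  exists m, has_mean s f m.
Proof.
move=> fc; have p0 := pi0.
have [|x _ e e0|F HF] := @antiderivative_exists _ (fun t => f (polar s t))
   (- (2 * pi)) (2 * pi) 1 ltr01; first lra.
  have [r r0 Hr] := fc (polar s x) (normc_polar _ _) e e0.
  have [d d0 Hd] := polar_cont s x r0.
  by exists d => // y yx; apply/Hr/Hd => //; rewrite subrr normr0.
exists ((F pi - F (- pi)) / (2 * pi)%:C); exists F => //.
rewrite mulrC divfK // -(rmorph0 (real_complex R)).
by apply/eqP => /complexI/eqP; rewrite gt_eqF // mulr_gt0.
Qed.

(* The rectangle [[u, s] x [t0 - pi, t0 + pi]] is mapped to an annulus slit
   along a radius that avoids the exceptional point [polar x0 t0]. *)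
Lemma has_mean_const (u s x0 t0 : R) f m n : u < x0 < s -> s < 0 -> `|t0| <= pi ->
  (forall w, 0 < normc w < 1 -> cont_at f w) ->
  (forall w, 0 < normc w < 1 -> w != polar x0 t0 -> holo_at f w) ->
  has_mean u f m -> has_mean s f n -> m = n.
Proof.
move=> /andP[ux xs] s0 t0pi fc fh fm fn; have p0 := pi0.
have us : u < s by exact: lt_trans ux xs.
have := t0pi; rewrite ler_norml => /andP[t1 t2].
have pol1 (x t : R) : x < 0 -> 0 < normc (polar x t) < 1.
  by move=> x1; rewrite normc_polar expR_gt0 expR_lt1.
(* The primitive in the angle is chosen radius by radius and tied to every mean [k] at that radius,
   so that it yields [m] at [u] and [n] at [s]. *)
have HQ (x : R) : exists F : R -> C, u <= x <= s -> 
    (forall y : R, - (2 * pi) <= y <= 2 * pi -> has_der F y (f (polar x y))) /\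
    (forall k, has_mean x f k -> F (t0 + pi) - F (t0 - pi) = (2 * pi)%:C * k).
  have [/andP[ux' xs']|] := boolP (u <= x <= s); last by exists (fun=> 0).
  have [w wx|k Hk] := @has_mean_ex x f.
    by apply: fc; rewrite wx expR_gt0 expR_lt1; lra.
  have [F HF Fk] := has_mean_window Hk t0pi.
  by exists F => _; split=> // k' /(has_mean_unique Hk) <-.
have [Q {}HQ] := choice HQ.
have HP (t : R) : exists F : R -> C, forall x, u <= x <= s -> has_der F x (f (polar x t)).
  have [||x /andP[x1 x2] e e0|F HF] := @antiderivative_exists _ (fun x => f (polar x t))
      u s (- s / 2); [by lra|by lra| |by exists F].
  have [r r0 Hr] := fc (polar x t) (pol1 x t ltac:(lra)) e e0.
  have [d d0 Hd] := polar_cont x t r0.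
  by exists d => // y yx; apply/Hr/Hd => //; rewrite subrr normr0.
have [P' HP'] := choice HP; pose P x t := P' t x.
have PQ : antiderivatives (fun x t => f (polar x t)) P Q u s (t0 - pi) (t0 + pi).
  move=> x t xus /andP[ta tb]; split; first exact: HP'.
  by apply: (HQ x xus).1; apply/andP; split; lra.
have [r r0 Hr] := fc (polar x0 t0) (pol1 x0 t0 ltac:(lra)) 1 ltr01.
have [d d0 Hd] := polar_cont x0 t0 r0.
have := @goursat_exception _ _ P Q u s (t0 - pi) (t0 + pi) PQ x0 t0
   (1 + normc (f (polar x0 t0))) d.
rewrite /contour => /(_ _ _ d0) H.
(* The two sides at angles [t0 - pi] and [t0 + pi] have the same image and cancel; the contour
   reduces to the difference of the two means. *)
have Pper : P s (t0 + pi) - P u (t0 + pi) = P s (t0 - pi) - P u (t0 - pi).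
  pose g x := P x (t0 + pi) - P x (t0 - pi).
  have : g u = g s.
    apply: has_der0_const; first exact: ltW.
    move=> x xus; rewrite -(subrr (f (polar x (t0 + pi)))) {2}polarD2pi.
    by apply: has_derB; exact: HP'.
  rewrite /g => E; rewrite -[P s (t0 + pi)](subrK (P s (t0 - pi))) -E; ring.
have Qs := (HQ s ltac:(lra)).2 n fn; have Qu := (HQ u ltac:(lra)).2 m fm.
move: H; rewrite Pper subrr add0r Qs Qu -mulrBr => H.
have {}H : 'i * ((2 * pi)%:C * (n - m)) = 0 :> C.
  apply: H; [by rewrite ux|by apply/andP; split; lra| |].
    move=> x y xd yd; rewrite -[f _](subrK (f (polar x0 t0))).
    by apply: le_trans (le_normcD _ _) _; rewrite lerD2r; exact/Hr/Hd.
  move=> x y /andP[x1 x2] /andP[y1 y2] xy0; apply/holo_polar/fh.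
    by apply: pol1; lra.
  apply: contra xy0 => /eqP /polar_inj -> //.
  by rewrite ler_norml; apply/andP; split; lra.
move/eqP: H; rewrite !mulf_eq0 subr_eq0 => /or3P[||/eqP -> //].
  by rewrite -normc_eq0 /= expr0n expr1n add0r sqrtr1 oner_eq0.
by rewrite -normc_eq0 normcR normr_eq0 gt_eqF // mulr_gt0.
Qed.

(** The mean is independent of the radius, and over a small circle it is close to [f 0] by
    continuity. *)
Lemma has_mean_center (s x0 t0 : R) f : x0 < s -> s < 0 -> `|t0| <= pi ->
  (forall w, normc w < 1 -> cont_at f w) ->
  (forall w, 0 < normc w < 1 -> w != polar x0 t0 -> holo_at f w) ->
  has_mean s f (f 0).
Proof.
move=> xs s0 t0pi fc fh.
have ex u : u < 0 -> exists m, has_mean u f m.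
  by move=> u0; apply: has_mean_ex => w wu; apply: fc; rewrite wu expR_lt1.
have [m Hm] := ex s s0; suff -> : f 0 = m by [].
apply/eqP; rewrite -subr_eq0; apply/eqP/normc_le0/ler_addgt0Pl => e e0; rewrite addr0.
have [|r r0 Hr] := fc 0 _ e e0; first by rewrite Normc.normc0.
(* The inner circle must be small enough for continuity at 0 and must lie inside the radius of the
   exceptional point, as [has_mean_const] asks. *)
pose u := Num.min (ln (r / 2)) (x0 - 1).
have r2 : 0 < r / 2 by rewrite divr_gt0.
have ux : u < x0 by rewrite gt_min; apply/orP; right; lra.
have eu : expR u < r.
  apply: (@le_lt_trans _ _ (r / 2)); last lra.
  by rewrite -[leRHS]lnK ?posrE // ler_expR ge_min lexx.
have [n Hn] := ex u ltac:(lra).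
have nm : n = m.
  apply: (has_mean_const _ s0 t0pi _ fh Hn Hm); first by rewrite ux.
  by move=> w /andP[_ w1]; exact: fc.
subst m; rewrite normcB; have := has_meanD Hn (has_mean_cst u (- f 0)).
by apply: has_mean_bound => w wu; apply: Hr; rewrite subr0 wu.
Qed.

End CircleMean.

(** * Power series *)

Section Geometric.
Variable R : realType.

Lemma expr_small (q e : R) : 0 <= q < 1 -> 0 < e ->
  exists N, forall n, (N <= n)%N -> q ^+ n <= e.
Proof.
move=> /andP[q0 q1] e0; have : `|q| < 1 by rewrite ger0_norm.
move/cvg_expr/cvgrPdist_le => /(_ e e0)[N _ HN]; exists N => n Nn.
by have := HN n Nn; rewrite sub0r normrN ger0_norm // exprn_ge0.
Qed.

Lemma bernoulli_le (d : R) n : 0 <= d <= 1 -> 1 - n%:R * d <= (1 - d) ^+ n.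
Proof.
move=> /andP[d0 d1]; elim: n => [|n IH]; first by rewrite mul0r subr0 expr0.
rewrite exprS; apply: le_trans (ler_wpM2l _ IH); last by rewrite subr_ge0.
rewrite -natr1; have : 0 <= n%:R * d * d by rewrite !mulr_ge0.
lra.
Qed.

(** The limit x -> 1, with an explicit x = 1 - d and Bernoulli's inequality in place of
    continuity. *)
Lemma le_of_expr (A M : R) n : 0 <= A ->
  (forall x, 0 < x < 1 -> A * x ^+ n <= M) -> A <= M.
Proof.
move=> A0 H; apply/ler_addgt0Pr => e e0.
pose d := Num.min (2^-1) (e / (A * n%:R + 1)).
have An0 : 0 < A * n%:R + 1 by rewrite ltr_wpDl // mulr_ge0.
have d0 : 0 < d by rewrite lt_min invr_gt0 ltr0n divr_gt0.
have d1 : d <= 2^-1 by rewrite ge_min lexx.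
have de : d * (A * n%:R + 1) <= e by rewrite -ler_pdivlMr // ge_min lexx orbT.
have := H (1 - d) ltac:(lra).
have := @bernoulli_le d n ltac:(lra) => /(ler_wpM2l A0) h1 h2.
move: (le_trans h1 h2); rewrite mulrBr mulr1 => h3.
have : A * (n%:R * d) = d * (A * n%:R) by ring.
lra.
Qed.

Lemma sum_geometric_le (x : R) m n : 0 <= x < 1 ->
  \sum_(m <= i < n) x ^+ i <= x ^+ m / (1 - x).
Proof.
move=> /andP[x0 x1]; have [mn|nm] := leqP m n; last first.
  by rewrite big_geq 1?ltnW // divr_ge0 ?exprn_ge0 // subr_ge0 ltW.
rewrite -{1}[m]add0n -(subnK mn) big_addn.
under eq_bigr do rewrite exprD.
rewrite addnK -mulr_suml mulrC ler_wpM2l ?exprn_ge0 // big_mkord.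
rewrite -[leRHS]div1r ler_pdivlMr ?subr_gt0 // -opprB mulrN mulrC -subrX1 opprB.
by rewrite gerBl exprn_ge0.
Qed.

End Geometric.

Section PowerSeries.
Variable R : realType.
Local Notation C := R[i].

Implicit Types (f h : C -> C) (c z w : C).

(** The remainder bound is the geometric one that follows from coefficients bounded by [M]. A single
    constant thus controls coefficients and convergence, uniformly over families of functions. *)
Definition power_series (M : R) (a : nat -> C) (g : C -> C) :=
  (forall n, normc (a n) <= M) /\
  forall z L, normc z < 1 ->
    normc (g z - \sum_(i < L) a i * z ^+ i) <= M * normc z ^+ L / (1 - normc z).

Lemma holo_near f h z (r : R) : 0 < r ->
  (forall w, normc (w - z) < r -> f w = h w) -> holo_at h z -> holo_at f z.
Proof.
move=> r0 fh [D HD]; exists D => e e0; have [s s0 Hs] := HD e e0.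
exists (Num.min r s) => [|w]; first by rewrite lt_min r0.
rewrite lt_min => /andP[wr ws]; rewrite !fh // ?subrr ?Normc.normc0 //.
exact: Hs.
Qed.

Lemma holo_cst c z : holo_at (fun=> c) z.
Proof.
exists 0 => e e0; exists 1 => // w _.
by rewrite subrr mul0r subr0 Normc.normc0 mulr_ge0 ?normc_ge0 // ltW.
Qed.

Lemma holo_id z : holo_at (fun w => w) z.
Proof.
exists 1 => e e0; exists 1 => // w _.
by rewrite mul1r subrr Normc.normc0 mulr_ge0 ?normc_ge0 // ltW.
Qed.

Lemma holo_subc f c z : holo_at f z -> holo_at (fun w => f w - c) z.
Proof.
move=> [D HD]; exists D => e e0; have [r r0 Hr] := HD e e0; exists r => // w wr.
by rewrite (_ : f w - c - (f z - c) = f w - f z) ?Hr //; ring.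
Qed.

Lemma holoM f h z : holo_at f z -> holo_at h z -> holo_at (fun w => f w * h w) z.
Proof.
move=> [D HD] [K HK]; have hc := holo_cont (ex_intro _ K HK).
exists (D * h z + f z * K) => e e0.
pose B := normc (h z) + 1 + normc (f z) + normc D.
have B0 : 0 < B.
  by rewrite /B; have := normc_ge0 (h z); have := normc_ge0 (f z); have := normc_ge0 D; lra.
have eB : 0 < e / B by rewrite divr_gt0.
have [r1 r10 Hr1] := HD _ eB; have [r2 r20 Hr2] := HK _ eB.
have [r3 r30 Hr3] := hc _ ltr01; have [r4 r40 Hr4] := hc _ eB.
exists (Num.min (Num.min r1 r2) (Num.min r3 r4)) => [|w].
  by rewrite !lt_min r10 r20 r30 r40.
rewrite !lt_min => /andP[/andP[w1 w2] /andP[w3 w4]].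
have -> : f w * h w - f z * h z - (D * h z + f z * K) * (w - z) =
   (f w - f z - D * (w - z)) * h w + f z * (h w - h z - K * (w - z)) +
   D * (w - z) * (h w - h z) by ring.
apply: le_trans (le_normcD _ _) _; apply: le_trans (lerD (le_normcD _ _) (lexx _)) _.
rewrite !Normc.normcM.
have hw : normc (h w) <= normc (h z) + 1.
  rewrite -[h w](subrK (h z)); apply: le_trans (le_normcD _ _) _.
  by rewrite addrC lerD2l Hr3.
have d0 := normc_ge0 (w - z).
have ed0 : 0 <= e / B * normc (w - z) by rewrite mulr_ge0 // ltW.
have -> : e * normc (w - z) = (e / B * normc (w - z)) * (normc (h z) + 1) +
  normc (f z) * (e / B * normc (w - z)) + normc D * normc (w - z) * (e / B).
  by rewrite /B; field; rewrite -/B gt_eqF.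
apply: lerD; first apply: lerD.
- by apply: ler_pM; rewrite ?normc_ge0 // Hr1.
- by rewrite ler_wpM2l ?normc_ge0 // Hr2.
- by rewrite ler_wpM2l ?mulr_ge0 ?normc_ge0 // Hr4.
Qed.

Lemma holoX n z : holo_at (fun w => w ^+ n) z.
Proof.
elim: n => [|n IH]; first by under eq_fun do rewrite expr0; exact: holo_cst.
by under eq_fun do rewrite exprS; apply: holoM => //; exact: holo_id.
Qed.

Lemma holo_inv c z : z != c -> holo_at (fun w => (w - c)^-1) z.
Proof.
move=> zc; have n0 : 0 < normc (z - c).
  by rewrite lt_neqAle normc_ge0 eq_sym normc_eq0 subr_eq0 zc.
exists (- (z - c) ^- 2) => e e0; set n := normc (z - c) in n0.
exists (Num.min (n / 2) (e * n ^+ 3 / 2)) => [|w].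
  by rewrite lt_min !divr_gt0 // mulr_gt0 // exprn_gt0.
rewrite lt_min => /andP[w1 w2].
have wn : n / 2 <= normc (w - c).
  have := lerB_normc (z - c) (z - w); rewrite -/n normcB in w1 *.
  by rewrite (_ : z - c - (z - w) = w - c); [lra|ring].
have wn0 : 0 < normc (w - c) by apply: lt_le_trans wn; rewrite divr_gt0.
have wc0 : w - c != 0 by rewrite -normc_eq0 gt_eqF.
have zc0 : z - c != 0 by rewrite subr_eq0.
have -> : (w - c)^-1 - (z - c)^-1 - - (z - c) ^- 2 * (w - z) =
   (w - z) * (w - z) / ((w - c) * (z - c) ^+ 2) by field; rewrite zc0 wc0.
rewrite !Normc.normcM Normc.normcV Normc.normcM normcX -/n -mulrA mulrC.
rewrite ler_wpM2r ?normc_ge0 // ler_pdivrMr ?mulr_gt0 ?exprn_gt0 //.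
apply: (le_trans (ltW w2)); rewrite -mulrA ler_pM2l //.
by rewrite exprS mulrAC ler_pM2r ?exprn_gt0.
Qed.

Lemma holoXV n z : z != 0 -> holo_at (fun w => w^-1 ^+ n) z.
Proof.
move=> z0; have inv : holo_at (fun w => w^-1) z.
  by have := holo_inv z0; under eq_fun do rewrite subr0.
elim: n => [|n IH]; first by under eq_fun do rewrite expr0; exact: holo_cst.
by under eq_fun do rewrite exprS; apply: holoM.
Qed.

Lemma power_series_tail (M : R) a (z : C) m n : (forall i, normc (a i) <= M) ->
  normc z < 1 ->
  normc (\sum_(m <= i < n) a i * z ^+ i) <= M * normc z ^+ m / (1 - normc z).
Proof.
move=> aM z1; have M0 : 0 <= M by apply: le_trans (aM 0%N); rewrite normc_ge0.
apply: le_trans (ler_normc_sum _ _ _) _.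
apply: (@le_trans _ _ (M * \sum_(m <= i < n) normc z ^+ i)); last first.
  by rewrite -mulrA ler_wpM2l // sum_geometric_le // normc_ge0.
rewrite mulr_sumr; apply: ler_sum => i _.
by rewrite Normc.normcM normcX ler_wpM2r // exprn_ge0 // normc_ge0.
Qed.

Variables (g : C -> C) (M : R).
Hypothesis dg : forall z, normc z < 1 -> holo_at g z.
Hypothesis gM : forall z, normc z < 1 -> normc (g z) <= M.

Lemma mean_coefficients : exists a : nat -> C,
  forall s i, s < 0 -> has_mean s (fun w => g w * w^-1 ^+ i) (a i).
Proof.
have holo i w : 0 < normc w < 1 -> holo_at (fun w => g w * w^-1 ^+ i) w.
  move=> /andP[w0 w1]; apply: holoM; first exact: dg.
  by apply: holoXV; rewrite -normc_eq0 gt_eqF.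
have ex s i : s < 0 -> exists m, has_mean s (fun w => g w * w^-1 ^+ i) m.
  move=> s0; apply: has_mean_ex => w ws; apply/holo_cont/holo.
  by rewrite ws expR_gt0 expR_lt1.
have ltN10 : -1 < 0 :> R by lra.
have [a Ha] := choice (fun i => ex (-1) i ltN10).
exists a => s i s0; have [m Hm] := ex s i s0; suff <- : m = a i by [].
have pi00 : `|0 : R| <= pi by rewrite normr0 pi_ge0.
have cont w : 0 < normc w < 1 -> cont_at (fun w => g w * w^-1 ^+ i) w.
  by move=> ?; apply/holo_cont/holo.
have [s1|s1|s1] := ltgtP s (-1); last by apply: has_mean_unique Hm _; rewrite s1.
  (* The function is holomorphic on the whole annulus, so an arbitrary point between the two radii
     plays the exceptional one. *)
  apply: (@has_mean_const _ s (-1) ((s - 1) / 2) 0 _ _ _ _ _ _ _ _ Hm (Ha i)) => //.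
    by apply/andP; split; lra.
  by move=> w w01 _; exact: holo.
apply/esym/(@has_mean_const _ (-1) s ((s - 1) / 2) 0 _ _ _ _ _ _ _ _ (Ha i) Hm) => //.
  by apply/andP; split; lra.
by move=> w w01 _; exact: holo.
Qed.

Let M_ge0 : 0 <= M.
Proof. by apply: le_trans (gM (z := 0) _); rewrite ?normc_ge0 ?Normc.normc0. Qed.

(** On the circle, w^-1 is the conjugate of w divided by exp (2 s), which reduces negative powers to
    positive ones, whose mean is the value at 0. *)
Let mean_XV s i : s < 0 -> has_mean s (fun w => w^-1 ^+ i) ((i == 0%N)%:R).
Proof.
move=> s0; have [->|i0] := eqVneq i 0%N.
  by under eq_fun do rewrite expr0; exact: has_mean_cst.
have holo w : holo_at (fun w : C => w ^+ i) w by exact: holoX.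
have H : has_mean s (fun w : C => w ^+ i) 0.
  have := @has_mean_center _ s (s - 1) 0 (fun w : C => w ^+ i).
  rewrite expr0n (negbTE i0); apply; [lra|by []| | |by move=> *; exact: holo].
    by rewrite normr0 pi_ge0.
  by move=> w _; exact/holo_cont/holo.
have := has_meanZ (((expR s ^+ 2)%:C)^-1 ^+ i) (has_mean_conj H).
rewrite conjc0 mulr0; apply: eq_has_mean => w ws.
have w0 : w != 0 by rewrite -normc_eq0 ws gt_eqF // expR_gt0.
have -> : (w ^+ i)^* = w^* ^+ i by rewrite rmorphXn.
rewrite -exprMn; congr (_ ^+ _).
by rewrite -ws -mulc_conj invfM divfK // -normc_eq0 normc_conj normc_eq0.
Qed.

(** Cauchy's formula in the form: w (g w - g z) / (w - z) has mean 0, its value at 0. Expanding w /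
    (w - z) as a finite geometric sum in z / w produces the partial sum, with a remainder carrying
    the factor (z / w) ^ n.+1. *)
Lemma cauchy_expansion (a : nat -> C) (s : R) (z : C) n :
  (forall s i, s < 0 -> has_mean s (fun w => g w * w^-1 ^+ i) (a i)) ->
  s < 0 -> 0 < normc z < expR s ->
  normc (g z - \sum_(i < n.+1) a i * z ^+ i) <=
    (normc z / expR s) ^+ n.+1 * (expR s * (2 * M) / (expR s - normc z)).
Proof.
move=> Ha s0 /andP[z0 zs]; have s1 : expR s < 1 by rewrite expR_lt1.
have z0' : z != 0 by rewrite -normc_eq0 gt_eqF.
have z1 : normc z < 1 by exact: lt_trans s1.
have [t [tpi zE]] := polar_ex z0'.
have [D HD] := dg z1.
(* The value at [z] is the limit there; this makes [k] continuous on the disc and holomorphic away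
   from [z]. *)
pose k w := if w == z then z * D else w * (g w - g z) / (w - z).
have kh w : normc w < 1 -> w != z -> holo_at k w.
  move=> w1 wz; have wz0 : 0 < normc (w - z).
    by rewrite lt_neqAle normc_ge0 eq_sym normc_eq0 subr_eq0 wz.
  apply: (@holo_near _ (fun w => w * (g w - g z) / (w - z)) _ _ wz0).
    move=> v vw; rewrite /k; case: eqP => // vz.
    by rewrite vz normcB ltxx in vw.
  apply: holoM; last exact: holo_inv.
  by apply: holoM; [exact: holo_id|exact/holo_subc/dg].
have kc w : normc w < 1 -> cont_at k w.
  move=> w1; have [wz|wz] := eqVneq w z; last by exact/holo_cont/kh.
  move=> e e0; have e2 : 0 < e / 2 by rewrite divr_gt0.
  have [r r0 Hr] := HD _ (divr_gt0 e2 (ltr0n _ 2)).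
  have D0 : 0 < normc D + 1 by rewrite ltr_wpDl ?normc_ge0.
  exists (Num.min (Num.min r 1) (e / 2 / (normc D + 1))).
    by rewrite !lt_min r0 ltr01 divr_gt0.
  move=> v; rewrite wz !lt_min => /andP[/andP[vr v1] ve]; rewrite /k eqxx.
  case: eqP => [_|/eqP vz]; first by rewrite subrr Normc.normc0 ltW.
  have vz0 : v - z != 0 by rewrite subr_eq0.
  have -> : v * (g v - g z) / (v - z) - z * D =
     D * (v - z) + v * ((g v - g z - D * (v - z)) / (v - z)) by field.
  apply: le_trans (le_normcD _ _) _; rewrite [e]splitr lerD //.
    rewrite Normc.normcM; move/ltW: ve; rewrite ler_pdivlMr //.
    have := normc_ge0 (v - z); nra.
  rewrite !Normc.normcM Normc.normcV.
  have n0 : 0 < normc (v - z) by rewrite lt_neqAle normc_ge0 eq_sym normc_eq0 vz0.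
  have : normc (g v - g z - D * (v - z)) / normc (v - z) <= e / 2 / 2.
    by rewrite ler_pdivrMr // Hr.
  have : normc v <= 2.
    rewrite -[v](subrK z); apply: le_trans (le_normcD _ _) _; lra.
  have : 0 <= normc (g v - g z - D * (v - z)) / normc (v - z).
    by rewrite divr_ge0 // normc_ge0.
  have := normc_ge0 v; set x := normc v; set y := _ / _; nra.
have Hk : has_mean s k 0.
  have := @has_mean_center _ s (ln (normc z)) t k.
  have -> : k 0 = 0 by rewrite /k eq_sym (negbTE z0') !mul0r.
  apply=> //; first by rewrite -[ltRHS]expRK ltr_ln ?posrE ?expR_gt0.
  by rewrite -zE => w /andP[_ w1]; exact: kh.
have Hg := has_mean_sum (n := n.+1) (fun i _ => has_meanZ (z ^+ i) (Ha s i s0)).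
have H1 := has_mean_sum (n := n.+1) (fun i _ => has_meanZ (z ^+ i) (mean_XV i s0)).
have := has_meanD Hk (has_meanD (has_meanZ (g z) H1) (has_meanZ (-1) Hg)).
have -> : 0 + (g z * (\sum_(i < n.+1) z ^+ i * (i == 0%N :> nat)%:R) +
     -1 * (\sum_(i < n.+1) z ^+ i * a i)) = g z - \sum_(i < n.+1) a i * z ^+ i.
  rewrite add0r big_ord_recl /= mulr1 expr0 big1 ?addr0 ?mulr1; last first.
    by move=> i _; rewrite mulr0.
  by rewrite mulN1r; congr (_ - _); apply: eq_bigr => i _; rewrite mulrC.
apply: has_mean_bound => w ws.
have w0 : w != 0 by rewrite -normc_eq0 ws gt_eqF // expR_gt0.
have wz : w != z by apply: contraTneq zs => <-; rewrite ws ltxx.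
have wz0 : w - z != 0 by rewrite subr_eq0.
have -> : k w + (g z * (\sum_(i < n.+1) z ^+ i * w^-1 ^+ i) +
   -1 * (\sum_(i < n.+1) z ^+ i * (g w * w^-1 ^+ i))) =
   (z / w) ^+ n.+1 * (w * (g w - g z) / (w - z)).
  have -> : \sum_(i < n.+1) z ^+ i * (g w * w^-1 ^+ i) =
      g w * \sum_(i < n.+1) (z / w) ^+ i.
    by rewrite mulr_sumr; apply: eq_bigr => i _; rewrite exprMn mulrCA.
  have -> : \sum_(i < n.+1) z ^+ i * w^-1 ^+ i = \sum_(i < n.+1) (z / w) ^+ i.
    by apply: eq_bigr => i _; rewrite exprMn.
  rewrite /k (negbTE wz); have := subrX1 (z / w) n.+1.
  set S := \sum_(i < n.+1) _; set q := _ ^+ n.+1 => qS.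
  have -> : q = (z / w - 1) * S + 1 by rewrite -qS subrK.
  by field; rewrite wz0 w0.
rewrite !Normc.normcM normcX Normc.normcM !Normc.normcV ws.
rewrite ler_wpM2l ?exprn_ge0 ?divr_ge0 ?normc_ge0 ?expR_ge0 //.
have d0 : 0 < expR s - normc z by rewrite subr_gt0.
apply: ler_pM; rewrite ?mulr_ge0 ?invr_ge0 ?normc_ge0 ?expR_ge0 //.
  rewrite ler_wpM2l ?expR_ge0 //; apply: le_trans (ler_normcB _ _) _.
  by rewrite mulr_natl mulr2n lerD // gM // ws.
rewrite lef_pV2 ?posrE //; first by rewrite -ws lerB_normc.
by apply: lt_le_trans d0 _; rewrite -ws lerB_normc.
Qed.

Theorem holo_power_series : exists a, power_series M a g.
Proof.
have [a Ha] := mean_coefficients.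
exists a; have aM n : normc (a n) <= M.
  apply: (@le_of_expr _ _ _ n); first exact: normc_ge0.
  move=> x /andP[x0 x1]; have s0 : ln x < 0 by rewrite ln_lt0 // x0.
  rewrite -ler_pdivlMr ?exprn_gt0 //.
  apply: has_mean_bound (Ha _ n s0) => w; rewrite lnK ?posrE // => wx.
  rewrite Normc.normcM normcX Normc.normcV wx exprVn ler_wpM2r ?invr_ge0 ?exprn_ge0 ?(ltW x0) //.
  by rewrite gM // wx.
split=> // z L z1.
have [z0|z0] := eqVneq z 0.
  have a0 : a 0%N = g 0.
    have ltN10 : -1 < 0 :> R by lra.
    have H : has_mean (-1) g (g 0).
      apply: (@has_mean_center _ (-1) (-2) 0) => //; first lra.
      - by rewrite normr0 pi_ge0.
      - by move=> w w1; exact/holo_cont/dg.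
      - by move=> w /andP[_ w1] _; exact: dg.
    have := Ha _ 0%N ltN10; under eq_fun do rewrite expr0 mulr1.
    by move=> H'; exact: has_mean_unique H' H.
  rewrite z0 Normc.normc0 subr0 divr1; case: L => [|L].
    by rewrite big_ord0 subr0 expr0 mulr1 gM // Normc.normc0.
  rewrite big_ord_recl expr0 mulr1 a0 big1 ?addr0; last first.
    by move=> i _; rewrite expr0n mulr0.
  by rewrite subrr Normc.normc0 expr0n mulr0.
have nz0 : 0 < normc z by rewrite lt_neqAle eq_sym normc_eq0 z0 normc_ge0.
(* Any radius strictly between |z| and 1 would do: the ratio |z| / p is below 1, so the remainder
   tends to 0. *)
pose p := (1 + normc z) / 2.
have p0 : 0 < p by rewrite /p; lra.
have s0 : ln p < 0 by rewrite ln_lt0 // p0 /p; lra.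
have zp : 0 < normc z < expR (ln p) by rewrite nz0 lnK ?posrE // /p; lra.
apply/ler_addgt0Pr => e e0.
pose B := expR (ln p) * (2 * M) / (expR (ln p) - normc z).
have B1 : 0 < B + 1.
  by rewrite ltr_wpDl // divr_ge0 ?mulr_ge0 ?expR_ge0 // subr_ge0; case/andP: zp => _ /ltW.
have q01 : 0 <= normc z / expR (ln p) < 1.
  case/andP: zp => _ zp; rewrite divr_ge0 ?normc_ge0 ?expR_ge0 //=.
  by rewrite ltr_pdivrMr ?expR_gt0 // mul1r.
have [N HN] := expr_small q01 (divr_gt0 e0 B1).
pose n := maxn N L.
have := cauchy_expansion n Ha s0 zp; rewrite -/B => H.
have -> : g z - \sum_(i < L) a i * z ^+ i =
   (\sum_(L <= i < n.+1) a i * z ^+ i) + (g z - \sum_(i < n.+1) a i * z ^+ i).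
  rewrite -!(big_mkord xpredT (fun i => a i * z ^+ i)).
  by rewrite (@big_cat_nat _ _ _ L 0 n.+1) //=; [ring|exact: leqW (leq_maxr N L)].
apply: le_trans (le_normcD _ _) _; apply: lerD; first exact: power_series_tail.
apply: le_trans H _; have qe := HN n.+1 (leqW (leq_maxl N L)).
have q0 : 0 <= (normc z / expR (ln p)) ^+ n.+1 by rewrite exprn_ge0 //; case/andP: q01.
apply: le_trans (ler_wpM2l q0 (_ : B <= B + 1)) _; first by rewrite lerDl.
by rewrite -ler_pdivlMr.
Qed.

End PowerSeries.

Section PowerSeriesLimits.
Variable R : realType.
Local Notation C := R[i].

Lemma power_series_of_cvg (M : R) (a : nat -> C) (g : C -> C) :
  (forall n, normc (a n) <= M) ->
  (forall z e N, normc z < 1 -> 0 < e -> exists2 n, (N <= n)%N &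
     normc (g z - \sum_(i < n) a i * z ^+ i) <= e) ->
  power_series M a g.
Proof.
move=> aM H; split=> // z L z1; apply/ler_addgt0Pr => e e0.
have [n Ln Hn] := H z e L z1 e0.
have -> : g z - \sum_(i < L) a i * z ^+ i =
   (\sum_(L <= i < n) a i * z ^+ i) + (g z - \sum_(i < n) a i * z ^+ i).
  rewrite -!(big_mkord xpredT (fun i => a i * z ^+ i)).
  by rewrite (@big_cat_nat _ _ _ L 0 n) //=; ring.
by apply: le_trans (le_normcD _ _) _; apply: lerD => //; exact: power_series_tail.
Qed.

Lemma power_series_ge0 M a (g : C -> C) : power_series M a g -> 0 <= M.
Proof. by move=> [aM _]; apply: le_trans (aM 0%N); rewrite normc_ge0. Qed.

Lemma power_series0 M a (g : C -> C) : power_series M a g -> a 0%N = g 0.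
Proof.
move=> [_ /(_ 0 1%N)]; rewrite big_ord1 expr0 mulr1 Normc.normc0 ltr01 => /(_ isT).
rewrite expr1 mulr0 mul0r => /normc_le0/eqP; rewrite subr_eq0.
by move=> /eqP.
Qed.

Lemma power_series_tail_small M (z e : R) : 0 <= M -> 0 <= z < 1 -> 0 < e ->
  exists N, forall n, (N <= n)%N -> M * z ^+ n / (1 - z) <= e.
Proof.
move=> M0 z01 e0; have /andP[z0 z1] := z01.
have M1 : 0 < M + 1 by rewrite ltr_wpDl.
have z2 : 0 < 1 - z by rewrite subr_gt0.
have [N HN] := expr_small z01 (divr_gt0 (mulr_gt0 e0 z2) M1).
exists N => n Nn; rewrite ler_pdivrMr //.
have := HN n Nn; rewrite ler_pdivlMr // mulrC; apply: le_trans.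
by rewrite ler_wpM2r ?exprn_ge0 // lerDl.
Qed.

(** The Cauchy integral of the n-th coefficient over the circle of radius [r], discretized at [N]
    equally spaced points. *)
Definition circle_average N (w : C) (r : R) n (g : C -> C) : C :=
  N%:R^-1 * \sum_(i < N) g (r%:C * w ^+ i) * (r%:C * w ^+ i)^-1 ^+ n.

Lemma natC_neq0 N : (0 < N)%N -> N%:R != 0 :> C.
Proof. by move=> N0; rewrite pnatr_eq0 -lt0n. Qed.

Lemma circle_average_bound N w r n (g : C -> C) B : (0 < N)%N ->
  N.-primitive_root w -> 0 < r ->
  (forall z, normc z = r -> normc (g z) <= B) ->
  normc (circle_average N w r n g) <= B / r ^+ n.
Proof.
move=> N0 pw r0 gB; rewrite Normc.normcM Normc.normcV normc_nat.
rewrite mulrC ler_pdivrMr ?ltr0n //.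
have -> : B / r ^+ n * N%:R = \sum_(i < N) B / r ^+ n.
  by rewrite sumr_const card_ord mulr_natr.
apply: le_trans (ler_normc_sum _ _ _) _; apply: ler_sum => i _.
have nr : normc (r%:C * w ^+ i) = r.
  by rewrite Normc.normcM normcX (normc_prim_root N0 pw) expr1n mulr1 normcR gtr0_norm.
rewrite Normc.normcM normcX Normc.normcV nr exprVn ler_wpM2r ?invr_ge0 ?exprn_ge0 ?(ltW r0) //.
exact: gB.
Qed.

Lemma circle_average_poly N w r n (a : nat -> C) : (n < N)%N ->
  N.-primitive_root w -> 0 < r ->
  circle_average N w r n (fun z => \sum_(m < N) a m * z ^+ m) = a n.
Proof.
move=> nN pw r0; have N0 : (0 < N)%N by exact: leq_ltn_trans nN.
have w1 : w ^+ N = 1 by exact: prim_expr_order.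
have r0' : r%:C != 0 :> C by rewrite -normc_eq0 normcR normr_eq0 gt_eqF.
have w0 : w != 0.
  by apply: contraTneq isT => w0; move/eqP: w1; rewrite w0 expr0n gtn_eqF // eq_sym oner_eq0.
rewrite /circle_average.
under eq_bigr do rewrite mulr_suml.
rewrite exchange_big /=.
have E (m : 'I_N) : \sum_(i < N) a m * (r%:C * w ^+ i) ^+ m * (r%:C * w ^+ i)^-1 ^+ n =
    if m == n :> nat then N%:R * a m else 0.
  (* The exponent [N - n] stands for - n, since w ^ N = 1. *)
  have Ei (i : 'I_N) : a m * (r%:C * w ^+ i) ^+ m * (r%:C * w ^+ i)^-1 ^+ n =
      a m * r%:C ^+ m * r%:C^-1 ^+ n * (w ^+ i) ^+ (m + (N - n)).
    have -> : (w ^+ i) ^+ (m + (N - n)) = (w ^+ i) ^+ m * (w ^+ i)^-1 ^+ n.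
      rewrite exprD; congr (_ * _); rewrite exprVn -exprM -exprM.
      apply: (mulIf (_ : w ^+ (i * n) != 0)); first by rewrite expf_neq0.
      by rewrite -exprD -mulnDr subnK 1?ltnW // mulnC exprM w1 expr1n mulVf // expf_neq0.
    by rewrite invfM !exprMn; ring.
  under eq_bigr do rewrite Ei.
  rewrite -mulr_sumr (sum_prim_root _ pw).
  have -> : (N %| m + (N - n))%N = (m == n :> nat).
    have mN := ltn_ord m; apply/idP/eqP => [/dvdnP[k]|->].
      case: k => [|[|k]]; first by move=> h; exfalso; lia.
        by rewrite mul1n; lia.
      by rewrite !mulSn => h; exfalso; lia.
    by rewrite subnKC ?dvdnn // ltnW.
  case: eqP => [->|_]; last by rewrite mulr0.
  by rewrite exprVn mulfK ?expf_neq0 // mulrC.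
under eq_bigr do rewrite E.
rewrite -big_mkcond (bigD1 (Ordinal nN)) //= big1 ?addr0; last first.
  by move=> i /andP[/eqP h]; rewrite -val_eqE /= h eqxx.
by rewrite mulKf // natC_neq0.
Qed.

Lemma circle_average_sub N w r n (g h : C -> C) :
  circle_average N w r n g - circle_average N w r n h =
  circle_average N w r n (fun z => g z - h z).
Proof.
rewrite /circle_average -mulrBr -sumrB; congr (_ * _).
by apply: eq_bigr => i _; rewrite mulrBl.
Qed.

Lemma circle_average_coef N w r n M a (g : C -> C) : power_series M a g ->
  (n < N)%N -> N.-primitive_root w -> 0 < r < 1 ->
  normc (circle_average N w r n g - a n) <= M * r ^+ N / (1 - r) / r ^+ n.
Proof.
move=> [aM Hg] nN pw /andP[r0 r1]; rewrite -{1}(circle_average_poly a nN pw r0).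
rewrite circle_average_sub; apply: circle_average_bound => //; first exact: leq_ltn_trans nN.
by move=> z zr; have := Hg z N; rewrite zr; apply.
Qed.

(** The constant [M] enters only through the discretization error, which vanishes as the number of
    points grows. Hence any bound [B] on the function replaces [M]. *)
Lemma cauchy_estimate (M B : R) a (g : C -> C) : power_series M a g ->
  (forall z, normc z < 1 -> normc (g z) <= B) -> forall n, normc (a n) <= B.
Proof.
move=> Hg gB n; apply: (@le_of_expr _ _ _ n); first exact: normc_ge0.
move=> r r01; have /andP[r0 r1] := r01; apply/ler_addgt0Pr => e e0.
have r01' : 0 <= r < 1 by lra.
have [N HN] := power_series_tail_small (power_series_ge0 Hg) r01' e0.
pose K := maxn N n.+1.
have [w pw] := prim_rootC_exists R (leq_trans (ltn0Sn n) (leq_maxr N n.+1)).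
rewrite -ler_pdivlMr ?exprn_gt0 //.
have -> : a n = circle_average K w r n g - (circle_average K w r n g - a n) by ring.
apply: le_trans (ler_normcB _ _) _; rewrite mulrDl; apply: lerD.
  apply: circle_average_bound => //; first by rewrite /K; lia.
  by move=> z zr; apply: gB; rewrite zr.
apply: le_trans (circle_average_coef Hg _ pw r01) _; first by rewrite /K; lia.
by rewrite ler_pM2r ?invr_gt0 ?exprn_gt0 // HN // leq_maxl.
Qed.

Lemma power_series_bound (M B : R) a (g : C -> C) : power_series M a g ->
  (forall z, normc z < 1 -> normc (g z) <= B) -> power_series B a g.
Proof.
move=> Hg gB; apply: power_series_of_cvg; first exact: cauchy_estimate Hg gB.
move=> z e N z1 e0.
have z01 : 0 <= normc z < 1 by rewrite normc_ge0.
have [K HK] := power_series_tail_small (power_series_ge0 Hg) z01 e0.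
exists (maxn N K); first exact: leq_maxl.
by apply: le_trans (Hg.2 z _ z1) _; apply: HK; exact: leq_maxr.
Qed.

Lemma power_seriesB M K a b (g h : C -> C) : power_series M a g -> power_series K b h ->
  power_series (M + K) (fun n => a n - b n) (fun z => g z - h z).
Proof.
move=> [aM Hg] [bK Hh]; split=> [n|z L z1].
  by apply: le_trans (ler_normcB _ _) _; rewrite lerD.
under eq_bigr do rewrite mulrBl.
rewrite sumrB (_ : g z - h z - _ = (g z - \sum_(i < L) a i * z ^+ i) -
   (h z - \sum_(i < L) b i * z ^+ i)); last by ring.
by apply: le_trans (ler_normcB _ _) _; rewrite !mulrDl lerD ?Hg ?Hh.
Qed.

(** The intervals [u_k - e_k, u_k + e_k] meet pairwise, hence have a common point. *)
Lemma real_limit (u e : nat -> R) : (forall k l, `|u k - u l| <= e k + e l) ->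
  exists x, forall k, `|u k - x| <= e k.
Proof.
move=> H; exists (sup (range (fun k => u k - e k))) => k.
have ub l : u l - e l <= u k + e k.
  by have := H l k; rewrite ler_norml => /andP[_]; lra.
have h1 : u k - e k <= sup (range (fun k => u k - e k)).
  apply: ub_le_sup; last by exists k.
  by exists (u k + e k) => _ [l _ <-].
have h2 : sup (range (fun k => u k - e k)) <= u k + e k.
  by apply: ge_sup; [exists (u 0%N - e 0%N), 0%N|move=> _ [l _ <-]].
by rewrite ler_norml; apply/andP; split; lra.
Qed.

Lemma complex_limit (u : nat -> C) (e : nat -> R) :
  (forall k l, normc (u k - u l) <= e k + e l) ->
  exists x, forall k, normc (u k - x) <= 2 * e k.
Proof.
move=> H.
have [x Hx] : exists x, forall k, `|complex.Re (u k) - x| <= e k.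
  apply: real_limit => k l; apply: le_trans (H k l).
  by rewrite -raddfB; exact: Re_le_normc.
have [y Hy] : exists x, forall k, `|complex.Im (u k) - x| <= e k.
  apply: real_limit => k l; apply: le_trans (H k l).
  by rewrite -raddfB; exact: Im_le_normc.
exists (x +i* y) => k; apply: le_trans (normc_le_ReIm _) _.
by rewrite !raddfB /= mulr_natl mulr2n lerD.
Qed.

(** Weierstrass's theorem with a common bound: Cauchy's estimate for differences makes each sequence
    of coefficients a Cauchy sequence. *)
Lemma power_series_limit (K : R) (g : C -> C) :
  (forall e : R, 0 < e -> exists a h, power_series K a h /\
     forall z, normc z < 1 -> normc (h z - g z) <= e) ->
  exists a, power_series K a g.
Proof.
move=> H; pose e k : R := k.+1%:R^-1.
have e0 k : 0 < e k by rewrite invr_gt0 ltr0n.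
have elim0 (x A B : R) : (forall k, x <= A + B * e k) -> 0 <= B -> x <= A.
  move=> xk B0; apply/ler_addgt0Pr => d d0.
  have B1 : 0 < B + 1 by rewrite ltr_wpDl.
  have [k _ Hk] := near_infty_natSinv_lt (PosNum (divr_gt0 d0 B1)).
  have := Hk k (leqnn k) => /= /ltW; rewrite ler_pdivlMr // => hk.
  apply: le_trans (xk k) _; rewrite lerD2l; apply: le_trans hk.
  by rewrite mulrC ler_pM2l // lerDl.
have [a Ha] := choice (fun k => H (e k) (e0 k)).
have {Ha} [h Hh] := choice Ha.
have ac m k l : normc (a k m - a l m) <= e k + e l.
  apply: (cauchy_estimate (power_seriesB (Hh k).1 (Hh l).1)) => z z1.
  rewrite (_ : h k z - h l z = (h k z - g z) - (h l z - g z)); last by ring.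
  apply: le_trans (ler_normcB _ _) _.
  by apply: lerD; [exact: (Hh k).2|exact: (Hh l).2].
have [b Hb] := choice (fun m => complex_limit (ac m)).
exists b; split=> [m|z L z1].
  apply: (elim0 _ _ 2) => // k; rewrite -[b m](subKr (a k m)).
  apply: le_trans (ler_normcB _ _) _; apply: lerD; last exact: Hb.
  by have [[]] := Hh k.
apply: (elim0 _ _ (1 + 2 * L%:R)) => [k|]; last by rewrite addr_ge0 // mulr_ge0.
have -> : g z - \sum_(i < L) b i * z ^+ i =
  (h k z - \sum_(i < L) a k i * z ^+ i) - (h k z - g z) +
  \sum_(i < L) (a k i - b i) * z ^+ i.
  have -> : \sum_(i < L) (a k i - b i) * z ^+ i =
      \sum_(i < L) a k i * z ^+ i - \sum_(i < L) b i * z ^+ i.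
    by rewrite -sumrB; apply: eq_bigr => i _; rewrite mulrBl.
  by ring.
have [[_ /(_ z L z1) h1] /(_ z z1) h2] := Hh k.
apply: le_trans (le_normcD _ _) _.
rewrite mulrDl mul1r addrA; apply: lerD.
  by apply: le_trans (ler_normcB _ _) _; exact: lerD.
apply: le_trans (ler_normc_sum _ _ _) _.
rewrite (_ : 2 * L%:R * e k = \sum_(i < L) 2 * e k); last first.
  by rewrite sumr_const card_ord -mulr_natr; ring.
apply: ler_sum => i _; rewrite Normc.normcM normcX.
apply: le_trans (ler_piMr (normc_ge0 _) _) (Hb i k).
by rewrite exprn_ile1 ?normc_ge0 // ltW.
Qed.

Lemma power_seriesZsum n (c : 'I_n -> C) (a : 'I_n -> nat -> C) (h : 'I_n -> C -> C) M :
  (forall i, power_series M (a i) (h i)) ->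
  power_series (M * \sum_i normc (c i)) (fun m => \sum_i c i * a i m)
    (fun z => \sum_i c i * h i z).
Proof.
move=> H; split=> [m|z L z1].
  apply: le_trans (ler_normc_sum _ _ _) _; rewrite mulr_sumr; apply: ler_sum => i _.
  by rewrite Normc.normcM mulrC ler_wpM2r ?normc_ge0 //; case: (H i).
have -> : \sum_i c i * h i z - \sum_(j < L) (\sum_i c i * a i j) * z ^+ j =
   \sum_i c i * (h i z - \sum_(j < L) a i j * z ^+ j).
  under [X in _ - X]eq_bigr do rewrite mulr_suml.
  rewrite exchange_big -sumrB /=; apply: eq_bigr => i _.
  by rewrite mulrBr mulr_sumr; congr (_ - _); apply: eq_bigr => j _; rewrite mulrA.
have -> : M * (\sum_i normc (c i)) * normc z ^+ L / (1 - normc z) =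
    \sum_i normc (c i) * (M * normc z ^+ L / (1 - normc z)).
  by rewrite -mulr_suml; ring.
apply: le_trans (ler_normc_sum _ _ _) _; apply: ler_sum => i _.
by rewrite Normc.normcM ler_wpM2l ?normc_ge0 //; exact: (H i).2.
Qed.

End PowerSeriesLimits.

(** * Monomial coefficients *)

Section FfunCons.
Variables (T : finType) (k : nat).

Definition fcons (x : T) (g : {ffun 'I_k -> T}) : {ffun 'I_k.+1 -> T} :=
  [ffun i => if unlift ord0 i is Some j then g j else x].

Lemma fcons0 x g : fcons x g ord0 = x.
Proof. by rewrite ffunE unlift_none. Qed.

Lemma fconsS x g j : fcons x g (lift ord0 j) = g j.
Proof. by rewrite ffunE liftK. Qed.

Lemma big_ffun_recl (A : Type) (idx : A) (op : Monoid.com_law idx)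
    (F : {ffun 'I_k.+1 -> T} -> A) :
  \big[op/idx]_f F f = \big[op/idx]_x \big[op/idx]_g F (fcons x g).
Proof.
rewrite pair_big /=; apply: (@reindex _ _ _ _ _ (fun p : T * {ffun 'I_k -> T} => fcons p.1 p.2)).
exists (fun f : {ffun 'I_k.+1 -> T} => (f ord0, [ffun j => f (lift ord0 j)])) => [[x g]|f] _ /=.
  by rewrite fcons0; congr (_, _); apply/ffunP => j; rewrite ffunE fconsS.
apply/ffunP => i; rewrite ffunE; case: unliftP => [j ->|-> //].
by rewrite ffunE.
Qed.

Lemma big_ffun0 (A : Type) (idx : A) (op : Monoid.com_law idx)
    (F : {ffun 'I_0 -> T} -> A) (f0 : {ffun 'I_0 -> T}) :
  \big[op/idx]_f F f = F f0.
Proof.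
rewrite (bigD1 f0) //= big1 ?Monoid.mulm1 // => f /eqP[].
by apply/ffunP => -[].
Qed.

End FfunCons.

Section SeveralVariables.
Variable R : realType.
Local Notation C := R[i].
Implicit Types (z : nat -> C) (F : (nat -> C) -> C).

Definition scons (x : C) z : nat -> C := fun n => if n is m.+1 then z m else x.
Definition update z j (x : C) : nat -> C := fun i => if i == j then x else z i.
Definition polydisc (x : R) z := forall j, normc (z j) <= x.

(** Boundedness and analyticity in each variable on the open unit ball, which is exhausted by the
    polydiscs of radius x < 1. *)
Definition sep_analytic (M : R) F := forall z x, 0 <= x < 1 -> polydisc x z ->
  normc (F z) <= M /\
  forall j, exists a, power_series M a (fun w => F (update z j w)).

Definition head_coefs (M : R) F z : nat -> C :=
  xget (fun=> 0) [set a | power_series M a (fun w => F (scons w z))].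

Definition head_coef M F n z := head_coefs M F z n.

Lemma scons_polydisc x w z : normc w <= x -> polydisc x z -> polydisc x (scons w z).
Proof. by move=> wx zx [|j] /=. Qed.

Lemma sep_analytic_ge0 M F : sep_analytic M F -> 0 <= M.
Proof.
move=> /(_ (fun=> 0) 0)[|j|FM _]; rewrite ?lexx ?ltr01 ?Normc.normc0 //.
by apply: le_trans FM; rewrite normc_ge0.
Qed.

Lemma head_coefsP M F z x : sep_analytic M F -> 0 <= x < 1 -> polydisc x z ->
  power_series M (head_coefs M F z) (fun w => F (scons w z)).
Proof.
move=> FM x01 zx; have x0 : 0 <= x by case/andP: x01.
have [|_ /(_ 0%N)[a Ha]] := FM (scons 0 z) x x01.
  by apply: scons_polydisc => //; rewrite Normc.normc0.
apply: (@xgetPex _ (fun=> 0) [set a | power_series M a (fun w => F (scons w z))]).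
exists a; rewrite (_ : (fun w => F (scons w z)) = (fun w => F (update (scons 0 z) 0%N w))) //.
by apply/funext => w; congr F; apply/funext => -[|j].
Qed.

Lemma update_polydisc x y w z j : x <= y -> normc w <= y -> polydisc x z ->
  polydisc y (update z j w).
Proof. by move=> xy wy zx i; rewrite /update; case: eqP => // _; exact: le_trans (zx i) xy. Qed.

Lemma max_lt1 (x y : R) : 0 <= x < 1 -> y < 1 -> 0 <= Num.max x y < 1.
Proof. by move=> /andP[x0 x1] y1; rewrite le_max x0 gt_max x1. Qed.

(** The n-th coefficient in the first variable is a uniform limit of circle averages, that is, of
    finite combinations of [F] at fixed first coordinates; each of these is a power series in the
    variable [j]. *)
Lemma sep_analytic_head_coef M F n : sep_analytic M F -> sep_analytic M (head_coef M F n).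
Proof.
move=> FM z x x01 zx; have M0 := sep_analytic_ge0 FM.
split=> [|j]; first exact: (head_coefsP FM x01 zx).1.
have updx w : normc w < 1 -> exists2 y, 0 <= y < 1 & polydisc y (update z j w).
  move=> w1; exists (Num.max x (normc w)); first exact: max_lt1.
  by apply: update_polydisc zx; rewrite le_max lexx ?orbT.
have bound w : normc w < 1 -> normc (head_coef M F n (update z j w)) <= M.
  by move=> /updx[y y01 zy]; exact: (head_coefsP FM y01 zy).1.
pose r : R := 2^-1; have r01 : 0 < r < 1 by rewrite /r; lra.
have r0 : 0 < r by case/andP: r01.
have [a Ha] : exists a, power_series (M / r ^+ n) a (fun w => head_coef M F n (update z j w)).
  apply: power_series_limit => e e0.
  have rn0 : 0 < r ^+ n by rewrite exprn_gt0.
  have r01' : 0 <= r < 1 by rewrite /r; lra.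
  have [N HN] := power_series_tail_small M0 r01' (mulr_gt0 e0 rn0).
  pose K := maxn N n.+1; have nK : (n < K)%N by exact: leq_maxr.
  have K0 : (0 < K)%N by exact: leq_ltn_trans nK.
  have [w pw] := prim_rootC_exists R K0.
  have nw (i : 'I_K) : normc (r%:C * w ^+ i) = r.
    by rewrite Normc.normcM normcX (normc_prim_root K0 pw) expr1n mulr1 normcR gtr0_norm.
  have ex (i : 'I_K) : exists b, power_series M b
      (fun u => F (scons (r%:C * w ^+ i) (update z j u))).
    have [||_ /(_ j.+1)[b Hb]] := FM (scons (r%:C * w ^+ i) z) (Num.max x r).
    - by apply: max_lt1 => //; rewrite /r; lra.
    - apply: scons_polydisc; first by rewrite nw le_max lexx orbT.
      by move=> l; rewrite le_max zx.
    exists b; congr (power_series M b _): Hb.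
    by apply/funext => u; congr F; apply/funext => -[|l].
  have [b Hb] := choice ex.
  have := power_seriesZsum (fun i : 'I_K => K%:R^-1 * (r%:C * w ^+ i)^-1 ^+ n) Hb.
  set S := \sum_i normc _; have -> : S = (r ^+ n)^-1.
    rewrite /S; under eq_bigr do rewrite Normc.normcM normcX !Normc.normcV normc_nat nw exprVn.
    by rewrite sumr_const card_ord -[LHS]mulr_natl mulrA divff ?mul1r // pnatr_eq0 -lt0n.
  set b' := fun m => _; set h := fun u => _ => Hh.
  exists b', h; split=> // u u1; have [y y01 zy] := updx u u1.
  have Hu := head_coefsP FM y01 zy.
  have -> : h u = circle_average K w r n (fun v => F (scons v (update z j u))).
    by rewrite /h /circle_average mulr_sumr; apply: eq_bigr => i _; rewrite -mulrA [_^-1 ^+ n * _]mulrC.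
  apply: le_trans (circle_average_coef Hu nK pw r01) _.
  by rewrite ler_pdivrMr // HN // leq_maxl.
(* The limit argument only gives the constant M / r ^ n. Cauchy's estimate restores [M], without
   which the iteration would lose a factor at each variable. *)
by exists a; apply: power_series_bound Ha bound.
Qed.

Fixpoint iter_coef M F (s : seq nat) : (nat -> C) -> C :=
  if s is n :: s' then iter_coef M (head_coef M F n) s' else F.

Definition coef_seq M F s := iter_coef M F s (fun=> 0).

Lemma iter_coef_rcons M F s n :
  iter_coef M F (rcons s n) = head_coef M (iter_coef M F s) n.
Proof. by elim: s F => [//|m s IH] F /=; rewrite IH. Qed.

Lemma sep_analytic_iter M F s : sep_analytic M F -> sep_analytic M (iter_coef M F s).
Proof. by elim: s F => [//|n s IH] F FM /=; apply/IH/sep_analytic_head_coef. Qed.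

(** The coefficient of degree 0 is the value at 0. Trailing zeros therefore do not matter, and
    coefficients do not depend on the number of variables considered. *)
Lemma coef_seq_rcons0 M F s : sep_analytic M F -> coef_seq M F (rcons s 0%N) = coef_seq M F s.
Proof.
move=> /(sep_analytic_iter s) FM; rewrite /coef_seq iter_coef_rcons /head_coef.
have z0 : polydisc 0 (fun=> 0) by move=> j; rewrite Normc.normc0.
have x01 : 0 <= (0 : R) < 1 by rewrite lexx ltr01.
rewrite (power_series0 (head_coefsP FM x01 z0)); congr (iter_coef _ _ _ _).
by apply/funext => -[|j].
Qed.

Lemma coef_seq_bound M F s : sep_analytic M F -> normc (coef_seq M F s) <= M.
Proof.
move=> /(sep_analytic_iter s) FM; have [|j|//] := FM (fun=> 0) 0.
  by rewrite lexx ltr01.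
by rewrite Normc.normc0.
Qed.

Definition seq_of k N (a : {ffun 'I_k -> 'I_N}) : seq nat :=
  [seq (a j : nat) | j <- enum 'I_k].

Lemma seq_of_fcons k N x (g : {ffun 'I_k -> 'I_N}) :
  seq_of (fcons x g) = (x : nat) :: seq_of g.
Proof.
rewrite /seq_of enum_ordSl /= fcons0; congr (_ :: _).
by rewrite -map_comp; apply: eq_map => j /=; rewrite fconsS.
Qed.

Lemma size_seq_of k N (a : {ffun 'I_k -> 'I_N}) : size (seq_of a) = k.
Proof. by rewrite size_map size_enum_ord. Qed.

Definition box_sum N k (c : seq nat -> C) z : C :=
  \sum_(a : {ffun 'I_k -> 'I_N}) c (seq_of a) * \prod_(j < k) z j ^+ a j.

Lemma box_sum0 N c z : box_sum N 0 c z = c [::].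
Proof.
rewrite /box_sum (big_ffun0 _ _ (ffun0 (card_ord 0))).
by rewrite big_ord0 mulr1 /seq_of; case: (enum _) (size_enum_ord 0).
Qed.

Lemma box_sumS N k c z : box_sum N k.+1 c z =
  \sum_(n < N) box_sum N k (fun s => c (val n :: s)) (fun j => z j.+1) * z 0%N ^+ n.
Proof.
rewrite /box_sum big_ffun_recl; apply: eq_bigr => n _; rewrite mulr_suml.
apply: eq_bigr => g _; rewrite seq_of_fcons big_ord_recl fcons0 -!mulrA; congr (_ * _).
by rewrite mulrC; congr (_ * _); apply: eq_bigr => j _; rewrite fconsS.
Qed.

(** The constant [K] is independent of [F] because the induction applies the bound to all
    coefficient functions [head_coef M F n] at once. *)
Lemma box_expansion k x M : 0 <= x < 1 -> exists K : R, 0 <= K /\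
  forall F N z, sep_analytic M F -> polydisc x z ->
    (forall j, (k <= j)%N -> z j = 0) ->
    normc (F z - box_sum N k (coef_seq M F) z) <= K * x ^+ N.
Proof.
move=> x01; have /andP[x0 x1] := x01; have y0 : 0 < 1 - x by rewrite subr_gt0.
elim: k => [|k [K [K0 IH]]].
  exists 0; split=> // F N z FM zx z0; rewrite box_sum0 /coef_seq /=.
  have -> : z = fun=> 0 by apply/funext => j; apply: z0.
  by rewrite subrr Normc.normc0 mul0r.
exists ((`|M| + K) / (1 - x)); split; first by apply: divr_ge0; [rewrite addr_ge0|exact: ltW].
move=> F N z FM zx z0; have M0 := sep_analytic_ge0 FM; rewrite ger0_norm //.
pose z' j := z j.+1; have zx' : polydisc x z' by move=> j; exact: zx.
have -> : z = scons (z 0%N) z' by apply/funext => -[|j].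
have Hz := head_coefsP FM x01 zx'.
have z1 : normc (z 0%N) < 1 by exact: le_lt_trans x1.
rewrite box_sumS /=.
rewrite (_ : F _ - _ = (F (scons (z 0%N) z') - \sum_(n < N) head_coefs M F z' n * z 0%N ^+ n)
  + \sum_(n < N) (head_coef M F n z' - box_sum N k (coef_seq M (head_coef M F n)) z') * z 0%N ^+ n);
  last first.
  have -> : \sum_(n < N) (head_coef M F n z' - box_sum N k (coef_seq M (head_coef M F n)) z') * z 0%N ^+ n =
     \sum_(n < N) head_coefs M F z' n * z 0%N ^+ n -
     \sum_(n < N) box_sum N k (coef_seq M (head_coef M F n)) z' * z 0%N ^+ n.
    by rewrite -sumrB; apply: eq_bigr => n _; rewrite mulrBl.
  by rewrite addrA subrK.
rewrite !mulrDl; apply: le_trans (le_normcD _ _) _; apply: lerD.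
  apply: le_trans (Hz.2 _ N z1) _; rewrite -[leRHS]mulrA -mulrA ler_wpM2l // mulrC.
  apply: ler_pM; rewrite ?invr_ge0 ?exprn_ge0 ?normc_ge0 ?subr_ge0 ?(ltW z1) //.
    by rewrite lef_pV2 ?posrE ?subr_gt0 // lerD2l lerN2; exact: (zx 0%N).
  by apply: lerXn2r; rewrite ?nnegrE ?normc_ge0 //; exact: (zx 0%N).
apply: le_trans (ler_normc_sum _ _ _) _.
apply: (@le_trans _ _ (\sum_(0 <= n < N) K * x ^+ N * x ^+ n)).
  rewrite big_mkord; apply: ler_sum => n _; rewrite Normc.normcM normcX.
  apply: ler_pM; rewrite ?exprn_ge0 ?normc_ge0 //; last by apply: lerXn2r; rewrite ?nnegrE ?normc_ge0 //; exact: (zx 0%N).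
  by apply: IH => [| |j kj]; [exact: sep_analytic_head_coef|by []|exact: z0].
rewrite -mulr_sumr [leRHS]mulrAC ler_wpM2l ?mulr_ge0 ?exprn_ge0 //.
by apply: le_trans (sum_geometric_le _ _ x01) _; rewrite expr0 div1r.
Qed.

End SeveralVariables.

(** * Absolutely summable families *)

Section AbsSum.
Variable R : realType.
Local Notation C := R[i].
Variable I : choiceType.
Implicit Types (D : set I) (u v : I -> C) (A B : {fset I}).

Lemma sum_fset_sub A B (V : nmodType) (f : I -> V) : (A `<=` B)%fset ->
  \sum_(i <- B) f i = \sum_(i <- A) f i + \sum_(i <- (B `\` A)%fset) f i.
Proof.
move=> /fsubsetP AB; rewrite (big_fsetID _ (mem A)) /=; congr (_ + _).
  congr bigop; congr enum_fset; apply/fsetP => i; rewrite !inE /=.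
  by case: (boolP (i \in A)) => [/AB ->|]; rewrite ?andbF.
by congr bigop; congr enum_fset; apply/fsetP => i; rewrite !inE /= andbC.
Qed.

Lemma ler_sum_fset A B (f : I -> R) : (forall i, 0 <= f i) -> (A `<=` B)%fset ->
  \sum_(i <- A) f i <= \sum_(i <- B) f i.
Proof. by move=> f0 /sum_fset_sub ->; rewrite lerDl sumr_ge0. Qed.

Definition bounded_sums v := exists K : R, forall A, \sum_(i <- A) normc (v i) <= K.

(* An elementary form of [has_abs_sum setT v s]: for an absolutely summable
   family it is enough that [s] is a cluster value of the finite sums. *)
Definition abs_sum v (s : C) := bounded_sums v /\
  forall (e : R) A, 0 < e -> exists2 B, (A `<=` B)%fset &
    normc (\sum_(i <- B) v i - s) <= e.

(** [A] nearly attains the supremum of the finite sums, so a set disjoint from it can add only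
    little. *)
Lemma bounded_sums_tail v (e : R) : bounded_sums v -> 0 < e ->
  exists A, forall B, [disjoint A & B]%fset -> \sum_(i <- B) normc (v i) <= e.
Proof.
move=> [K HK] e0; pose S := [set \sum_(i <- A) normc (v i) | A in [set: {fset I}]].
have supS : has_sup S.
  by split; [exists (\sum_(i <- fset0) normc (v i)), fset0|exists K => _ [A _ <-]].
have [_ [A _ <-] HA] := sup_adherent e0 supS.
exists A => B AB; have := HA; rewrite ltrBlDr => h.
have : \sum_(i <- (A `|` B)%fset) normc (v i) <= sup S.
  by apply: ub_le_sup; [case: supS|exists (A `|` B)%fset].
rewrite (sum_fset_sub _ (fsubsetUl A B)).
have -> : ((A `|` B) `\` A = B)%fset.
  apply/fsetP => i; rewrite !inE; case: (boolP (i \in A)) => //= iA.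
  by apply/esym/negbTE; move/fdisjointP : AB; exact.
lra.
Qed.

Lemma abs_sum_eventually v s (e : R) : abs_sum v s -> 0 < e ->
  exists A, forall B, (A `<=` B)%fset -> normc (\sum_(i <- B) v i - s) <= e.
Proof.
move=> [bv Hv] e0; have e2 : 0 < e / 2 by rewrite divr_gt0.
have [A HA] := bounded_sums_tail bv e2; exists A => B AB.
have [B' BB' HB'] := Hv _ B e2.
have -> : \sum_(i <- B) v i - s =
    (\sum_(i <- B') v i - s) - \sum_(i <- (B' `\` B)%fset) v i.
  by rewrite (sum_fset_sub _ BB'); ring.
apply: le_trans (ler_normcB _ _) _; rewrite [e]splitr; apply: lerD => //.
apply: le_trans (ler_normc_sum _ _ _) (HA _ _).
apply/fdisjointP => i iA; rewrite inE negb_and negbK.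
by rewrite (fsubsetP AB).
Qed.

Lemma abs_sumP v s : abs_sum v s <-> has_abs_sum setT v s.
Proof.
have FF := @summability.totally_filter I.
have patchT : patch (fun=> 0) setT v = v by rewrite patch_setT.
have partE A : summability.partial_sum v A = \sum_(i <- A) v i.
  by rewrite /summability.partial_sum -(big_seq_fsetE _ _ xpredT v).
split=> [Hv|[fin cvg]].
  have [[K HK] _] := Hv; split.
    apply: (@le_lt_trans _ _ K%:E); last exact: ltry.
    apply: ge_ereal_sup => _ [X [finX _] <-].
    by rewrite fsbig_finite //= sumEFin lee_fin.
  rewrite patchT; apply/cvgrPdist_le => e e0.
  have [r rE] : exists r : R, e = r%:C.
    by exists (complex.Re e); rewrite RRe_real ?gtr0_real.
  rewrite rE ltcR in e0; have [A HA] := abs_sum_eventually Hv e0.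
  exists A => // B /= AB; rewrite partE normr_normc rE lecR normcB.
  exact: HA.
split.
  have s0 : (0 <= \esum_(i in setT) (normc (v i))%:E)%E.
    by apply: esum_ge0 => i _; rewrite lee_fin normc_ge0.
  exists (fine (\esum_(i in setT) (normc (v i))%:E)) => A.
  rewrite -lee_fin fineK ?ge0_fin_numE // -sumEFin; apply: esum_ge.
  by exists [set` A]; [split|rewrite fsbig_finite //= set_fsetK].
move=> e A e0; have e0' : 0 < e%:C :> C by rewrite ltcR.
move: cvg; rewrite patchT => /cvgrPdist_le/(_ _ e0')[B _ HB].
exists (A `|` B)%fset; first exact: fsubsetUl.
have := HB (A `|` B)%fset (fsubsetUr _ _).
by rewrite /= partE normr_normc lecR normcB.
Qed.

Lemma abs_sum_patchP D v s : abs_sum (patch (fun=> 0) D v) s <-> has_abs_sum D v s.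
Proof.
apply: (iff_trans (abs_sumP _ _)); rewrite /has_abs_sum patch_setT.
have -> : (\esum_(i in D) (normc (v i))%:E =
   \esum_(i in setT) (normc (patch (fun=> 0) D v i))%:E)%E.
  rewrite esum_mkcond; apply: eq_esum => i _; rewrite /patch.
  by case: ifP => // _; rewrite Normc.normc0.
by [].
Qed.

Lemma eq_abs_sum u v s : u =1 v -> abs_sum u s -> abs_sum v s.
Proof. by move=> /funext ->. Qed.

Lemma abs_sumZ v s c : abs_sum v s -> abs_sum (fun i => c * v i) (c * s).
Proof.
move=> [[K HK] Hv]; split.
  exists (normc c * K) => A.
  under eq_bigr do rewrite Normc.normcM; rewrite -mulr_sumr.
  by rewrite ler_wpM2l // normc_ge0.
move=> e A e0; have c0 : 0 < normc c + 1 by rewrite ltr_wpDl ?normc_ge0.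
have [B AB HB] := Hv _ A (divr_gt0 e0 c0); exists B => //.
rewrite -mulr_sumr -mulrBr Normc.normcM.
apply: le_trans (ler_wpM2l (normc_ge0 c) HB) _.
by rewrite mulrCA ler_piMr ?(ltW e0) // ler_pdivrMr // mul1r lerDl.
Qed.

Lemma abs_sumD u v s t : abs_sum u s -> abs_sum v t ->
  abs_sum (fun i => u i + v i) (s + t).
Proof.
move=> Hu Hv; have [[K HK] _] := Hu; have [[L HL] _] := Hv; split.
  exists (K + L) => A; apply: le_trans (lerD (HK A) (HL A)).
  by rewrite -big_split; apply: ler_sum => i _; exact: le_normcD.
move=> e A e0; have e2 : 0 < e / 2 by rewrite divr_gt0.
have [A1 H1] := abs_sum_eventually Hu e2; have [A2 H2] := abs_sum_eventually Hv e2.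
exists (A `|` (A1 `|` A2))%fset; first exact: fsubsetUl.
rewrite big_split /= [e]splitr.
set S := \sum_(i <- _) u i; set T := \sum_(i <- _) v i.
rewrite (_ : S + T - (s + t) = (S - s) + (T - t)); last by ring.
apply: le_trans (le_normcD _ _) _; apply: lerD; [apply: H1|apply: H2].
  by apply: fsubset_trans (fsubsetUl _ _) (fsubsetUr _ _).
by apply: fsubset_trans (fsubsetUr _ _) (fsubsetUr _ _).
Qed.

Lemma abs_sum_fset (A : {fset I}) v : (forall i, i \notin A -> v i = 0) ->
  abs_sum v (\sum_(i <- A) v i).
Proof.
move=> v0; have E B : (A `<=` B)%fset -> \sum_(i <- A) v i = \sum_(i <- B) v i.
  by move=> AB; apply: big_fset_incl => // i _ /v0.
split=> [|e B e0].
  exists (\sum_(i <- A) normc (v i)) => B.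
  apply: le_trans (ler_sum_fset (fun i => normc_ge0 (v i)) (fsubsetUl B A)) _.
  rewrite le_eqVlt; apply/orP; left; apply/eqP/esym/big_fset_incl; first exact: fsubsetUr.
  by move=> i _ /v0 ->; rewrite Normc.normc0.
exists (B `|` A)%fset; first exact: fsubsetUl.
by rewrite (E _ (fsubsetUr B A)) subrr Normc.normc0 ltW.
Qed.

Lemma abs_sum_big (J : Type) (r : seq J) (v : J -> I -> C) (s : J -> C) :
  (forall j, abs_sum (v j) (s j)) ->
  abs_sum (fun i => \sum_(j <- r) v j i) (\sum_(j <- r) s j).
Proof.
move=> H; elim: r => [|j r IH].
  have := @abs_sum_fset fset0 (fun=> 0) (fun _ _ => erefl).
  by rewrite big_seq_fset0 big_nil; apply: eq_abs_sum => i; rewrite big_nil.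
rewrite big_cons; apply: eq_abs_sum (abs_sumD (H j) IH) => i.
by rewrite big_cons.
Qed.

End AbsSum.

Section MultiIndex.

Definition mi (s : seq nat) : multi_index :=
  [fsfun j in [fset i | i in iota 0 (size s)]%fset => nth 0%N s j].

Lemma miE s j : mi s j = nth 0%N s j.
Proof.
rewrite fsfunE !inE mem_iota add0n leq0n /=.
by case: ltnP => // h; rewrite nth_default.
Qed.

Lemma nth_seq_of k N (a : {ffun 'I_k -> 'I_N}) (j : 'I_k) : nth 0%N (seq_of a) j = a j.
Proof. by rewrite /seq_of (nth_map j) ?size_enum_ord // nth_ord_enum. Qed.

Lemma mi_seq_of_inj k N : injective (fun a : {ffun 'I_k -> 'I_N} => mi (seq_of a)).
Proof.
move=> a b /fsfunP ab; apply/ffunP => j; apply/val_inj.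
by have := ab j; rewrite !miE !nth_seq_of.
Qed.

Definition box k N : {fset multi_index} :=
  [fset mi (seq_of a) | a in [set: {ffun 'I_k -> 'I_N}]%SET]%fset.

Lemma big_box (A : Type) (idx : A) (op : Monoid.com_law idx) k N (F : multi_index -> A) :
  \big[op/idx]_(i <- box k N) F i = \big[op/idx]_(a : {ffun 'I_k -> 'I_N}) F (mi (seq_of a)).
Proof.
rewrite big_imfset /=; last by move=> a b _ _; exact: mi_seq_of_inj.
by rewrite [LHS]big_enum /=; apply: eq_bigl => a; rewrite inE.
Qed.

Lemma boxP k N (al : multi_index) :
  reflect (first_indices k al /\ forall j, (j < k)%N -> (al j < N)%N) (al \in box k N).
Proof.
apply: (iffP idP) => [/imfsetP[/= a _ ->]|[alk alN]].
  split=> [j kj|j jk]; first by rewrite miE nth_default // size_seq_of.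
  by rewrite miE -[j]/(val (Ordinal jk)) nth_seq_of.
apply/imfsetP; exists [ffun j : 'I_k => Ordinal (alN j (ltn_ord j))] => //=.
  by rewrite inE.
apply/fsfunP => j; rewrite miE; have [jk|kj] := ltnP j k.
  by rewrite -[j]/(val (Ordinal jk)) nth_seq_of ffunE.
by rewrite nth_default ?size_seq_of // alk.
Qed.

(** One number that exceeds both the indices in the support and the exponents, so that it can serve
    as either side of a box. *)
Definition mi_size (al : multi_index) : nat :=
  (\max_(j <- finsupp al) maxn j.+1 (al j)).+1.

Lemma mi_sizeP (al : multi_index) j : (al j < mi_size al)%N /\
  ((mi_size al <= j)%N -> al j = 0%N).
Proof.
have [js|js] := boolP (j \in finsupp al); last first.
  by rewrite fsfun_dflt.
have : (maxn j.+1 (al j) < mi_size al)%N.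
  by rewrite ltnS (big_fsetD1 j) //= leq_maxl.
by rewrite gtn_max => /andP[h1 h2]; split=> //; lia.
Qed.

Lemma mi_size_first al k : (mi_size al <= k)%N -> first_indices k al.
Proof. by move=> h j kj; apply: (mi_sizeP al j).2; exact: leq_trans kj. Qed.

Lemma mi_size_box al k N : first_indices k al -> (mi_size al <= N)%N -> al \in box k N.
Proof.
move=> alk aN; apply/boxP; split=> // j _.
exact: leq_trans (mi_sizeP al j).1 aN.
Qed.

Definition mis_size (A : {fset multi_index}) := (\max_(al <- A) mi_size al)%N.

Lemma mis_sizeP A al : al \in A -> (mi_size al <= mis_size A)%N.
Proof. by move=> alA; rewrite /mis_size (big_fsetD1 al) //= leq_maxl. Qed.

Lemma monomialE (R : realType) (z : linfty R) al k : first_indices k al ->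
  monomial z al = \prod_(j < k) z j ^+ al j.
Proof.
move=> alk; rewrite -(big_mkord xpredT (fun j => z j ^+ al j)) /index_iota subn0.
rewrite (bigID (mem (finsupp al))) /= [X in _ * X]big1 ?mulr1; last first.
  by move=> j /fsfun_dflt ->; rewrite expr0.
rewrite -big_filter; apply: perm_big; apply: uniq_perm.
- exact: fset_uniq.
- by rewrite filter_uniq // iota_uniq.
move=> j; rewrite mem_filter mem_iota add0n /=; case: (boolP (j \in _)) => //= js.
apply/esym; rewrite ltnNge; apply: contraTN js => kj.
by rewrite mem_finsupp alk // eqxx.
Qed.

End MultiIndex.

(** * Existence of the monomial coefficients *)

Section HinftyCoefficients.
Variable R : realType.
Local Notation C := R[i].

(** Unbounded sequences are sent to 0; the arguments below evaluate [mkl] on polydiscs only. *)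
Definition mkl (z : nat -> C) : linfty R := insubd (0 : linfty R) z.

Lemma mklE z x : polydisc x z -> mkl z = z :> (nat -> C).
Proof.
move=> zx; rewrite [LHS]val_insubd ifT // inE; apply/bounded_seqP.
by exists x%:C => n; rewrite normr_normc lecR zx.
Qed.

Lemma linfty_polydisc (z : linfty R) : exists x, polydisc x z.
Proof. by exists (sup (range (fun n => normc (z n)))) => j; exact: linfty_norm_ub. Qed.

Lemma mklK (z : linfty R) : mkl z = z.
Proof. by have [x zx] := linfty_polydisc z; apply/val_inj/(mklE zx). Qed.

Lemma linfty_norm_le (z : linfty R) x : 0 <= x -> polydisc x z -> `|z| <= x%:C.
Proof.
move=> x0 zx; rewrite /Num.norm /= /linfty_norm lecR.
apply: ge_sup; first by case: (linfty_has_sup z).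
by move=> _ [n _ <-].
Qed.

Lemma DinftyP (z : linfty R) : Dinfty z <-> exists2 x : R, 0 <= x < 1 & polydisc x z.
Proof.
rewrite /Dinfty -ball_normE /ball_ /= sub0r normrN.
split=> [z1|[x /andP[x0 x1] zx]].
  exists (sup (range (fun n => normc (z n)))); last by move=> j; exact: linfty_norm_ub.
  move: z1; rewrite /Num.norm /= /linfty_norm -(rmorph1 (real_complex R)) ltcR => ->.
  by rewrite andbT; apply: le_trans (linfty_norm_ub z 0%N); exact: normc_ge0.
apply: le_lt_trans (linfty_norm_le x0 zx) _.
by rewrite -(rmorph1 (real_complex R)) ltcR.
Qed.

Lemma derivable_line (f : linfty R -> C) (p v : linfty R) (e : R) : derivable f p v ->
  0 < e -> exists2 r : R, 0 < r & forall h, normc h < r ->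
    normc (f (h *: v + p) - f p - h * 'D_v f p) <= e * normc h.
Proof.
move=> df e0.
have /derivable_nbhs/eqaddoP := df.
move=> /(_ e%:C); rewrite ltcR => /(_ e0)/nbhs_ballP[d /= d0 Hd].
have [dR dE] : exists r, d = r%:C by exists (complex.Re d); rewrite RRe_real ?gtr0_real.
subst d; rewrite ltcR in d0; exists dR => // h hd.
have := Hd h; rewrite /ball /= sub0r normrN normr_normc ltcR => /(_ hd).
by rewrite !fctE /= !normr_normc -rmorphM lecR opprD addrA.
Qed.

Lemma differentiable_holo (f : linfty R -> C) (p v : linfty R) (w : C) :
  differentiable f (w *: v + p) -> holo_at (fun w => f (w *: v + p)) w.
Proof.
move=> /diff_derivable => /(_ v) df; exists ('D_v f (w *: v + p)) => e e0.
have [r r0 Hr] := derivable_line df e0; exists r => // u ur.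
have := Hr (u - w) ur; rewrite addrA -scalerDl subrK [(u - w) * _]mulrC.
exact.
Qed.

Lemma Hinfty_sep_analytic (f : linfty R -> C) M : Hinfty f ->
  (forall z, Dinfty z -> normc (f z) <= M) -> sep_analytic M (fun z => f (mkl z)).
Proof.
move=> [df _] fM z x x01 zx.
have inD y u : 0 <= y < 1 -> polydisc y u -> Dinfty (mkl u).
  by move=> y01 uy; apply/DinftyP; exists y => // j; rewrite (mklE uy).
split=> [|j]; first exact/fM/(inD x).
have updx w : normc w < 1 -> exists2 y, 0 <= y < 1 & polydisc y (update z j w).
  move=> w1; exists (Num.max x (normc w)); first exact: max_lt1.
  by apply: update_polydisc zx; rewrite le_max lexx ?orbT.
apply: holo_power_series => w w1; last first.
  by have [y y01 uy] := updx w w1; exact/fM/(inD y).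
pose v := mkl (update (fun=> 0) j 1).
have vE : v = update (fun=> 0) j 1 :> (nat -> C).
  apply: (@mklE _ 1) => i; rewrite /update; case: eqP => _.
    by rewrite Normc.normc1.
  by rewrite Normc.normc0.
have z01 : normc (0 : C) < 1 by rewrite Normc.normc0.
have [y0 _ uy0] := updx 0 z01.
have E u : normc u < 1 -> mkl (update z j u) = u *: v + mkl (update z j 0).
  move=> u1; have [y _ uy] := updx u u1; apply/val_inj/funext => i.
  rewrite [LHS](congr1 (fun g => g i) (mklE uy)).
  have -> : val (u *: v + mkl (update z j 0)) i = u * v i + mkl (update z j 0) i by [].
  rewrite vE (mklE uy0) /update; case: eqP => _; first by rewrite mulr1 addr0.
  by rewrite mulr0 add0r.
have w1' : 0 < 1 - normc w by rewrite subr_gt0.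
apply: (@holo_near _ _ (fun u => f (u *: v + mkl (update z j 0))) _ _ w1').
  move=> u uw; rewrite E //; rewrite -[u](subrK w).
  apply: le_lt_trans (le_normcD _ _) _; lra.
apply: differentiable_holo; rewrite -E //; apply: df.
by have [y y01 uy] := updx w w1; exact: inD y01 uy.
Qed.

Definition mi_coef M (F : (nat -> C) -> C) (al : multi_index) : C :=
  coef_seq M F [seq al j | j <- iota 0 (mi_size al)].

(** Both lists of exponents are padded with zeros to a common length, which changes nothing by
    [coef_seq_rcons0]. *)
Lemma mi_coefE M F k N (a : {ffun 'I_k -> 'I_N}) : sep_analytic M F ->
  mi_coef M F (mi (seq_of a)) = coef_seq M F (seq_of a).
Proof.
move=> FM; set al := mi _; set s := seq_of a.
have stable m : (mi_size al <= m)%N ->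
    coef_seq M F [seq al j | j <- iota 0 m] = mi_coef M F al.
  move/subnKC <-; elim: (m - _)%N => [|n IH]; first by rewrite addn0.
  rewrite addnS -addn1 iotaD map_cat [map _ (iota _ 1)]/= add0n cats1.
  by rewrite (mi_sizeP al (mi_size al + n)).2 ?leq_addr // coef_seq_rcons0.
have stable' m : (k <= m)%N -> coef_seq M F [seq al j | j <- iota 0 m] = coef_seq M F s.
  move/subnKC <-; elim: (m - _)%N => [|n IH].
    rewrite addn0; congr (coef_seq _ _ _); apply: (@eq_from_nth _ 0%N).
      by rewrite size_map size_iota size_seq_of.
    move=> j; rewrite size_map size_iota => jk.
    by rewrite (nth_map 0%N) ?size_iota // nth_iota // miE.
  rewrite addnS -addn1 iotaD map_cat [map _ (iota _ 1)]/= add0n cats1.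
  by rewrite {2}/al miE nth_default ?size_seq_of ?leq_addr // coef_seq_rcons0.
by rewrite -(stable _ (leq_maxl _ k)) stable' // leq_maxr.
Qed.

Lemma sum_box_norm k N (z : linfty R) x : 0 <= x < 1 -> polydisc x z ->
  \sum_(al <- box k N) normc (monomial z al) <= (1 - x)^-1 ^+ k.
Proof.
move=> x01 zx; have /andP[x0 x1] := x01; rewrite big_box.
have E (a : {ffun 'I_k -> 'I_N}) : normc (monomial z (mi (seq_of a))) =
    \prod_(j < k) normc (z j) ^+ a j.
  rewrite (@monomialE _ _ _ k) => [|j kj]; last by rewrite miE nth_default // size_seq_of.
  by rewrite normc_prod; apply: eq_bigr => j _; rewrite normcX miE nth_seq_of.
under eq_bigr do rewrite E.
rewrite -(bigA_distr_bigA (fun (j : 'I_k) (m : 'I_N) => normc (z j) ^+ m)) /=.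
apply: (@le_trans _ _ (\prod_(j < k) (1 - x)^-1)); last by rewrite prodr_const card_ord.
apply: ler_prod => j _; rewrite sumr_ge0 /=; last by move=> m _; rewrite exprn_ge0 ?normc_ge0.
apply: (@le_trans _ _ (\sum_(0 <= m < N) x ^+ m)).
  rewrite big_mkord; apply: ler_sum => m _.
  by apply: lerXn2r; rewrite ?nnegrE ?normc_ge0 //; exact: zx.
by apply: le_trans (sum_geometric_le _ _ x01) _; rewrite expr0 div1r.
Qed.

(** The last clause, approximation by box truncations at a geometric rate uniform on polydiscs, is
    what later reduces estimates on [f] to estimates on polynomials. *)
Theorem monomial_expansion (f : linfty R -> C) M : Hinfty f ->
  (forall z, Dinfty z -> normc (f z) <= M) ->
  exists c : multi_index -> C,
  [/\ forall al, normc (c al) <= M, is_monomial_coefs f c &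
   forall k x, 0 <= x < 1 -> exists K : R, 0 <= K /\ forall N (z : linfty R),
     polydisc x z -> first_coords k z ->
     normc (f z - \sum_(al <- box k N) c al * monomial z al) <= K * x ^+ N].
Proof.
move=> Hf fM; have FM := Hinfty_sep_analytic Hf fM.
pose c := mi_coef M (fun z => f (mkl z)).
have cM al : normc (c al) <= M by exact: coef_seq_bound.
have M0 : 0 <= M by exact: sep_analytic_ge0 FM.
have boxE k x : 0 <= x < 1 -> exists K : R, 0 <= K /\ forall N (z : linfty R),
     polydisc x z -> first_coords k z ->
     normc (f z - \sum_(al <- box k N) c al * monomial z al) <= K * x ^+ N.
  move=> x01; have [K [K0 HK]] := box_expansion k M x01; exists K; split=> // N z zx zk.
  have := HK _ N z FM zx zk; rewrite mklK; congr (normc (_ - _) <= _).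
  rewrite big_box; apply: eq_bigr => a _; rewrite /c mi_coefE //; congr (_ * _).
  rewrite (@monomialE _ _ _ k) => [|j kj]; last by rewrite miE nth_default // size_seq_of.
  by apply: eq_bigr => j _; rewrite miE nth_seq_of.
exists c; split=> // k z /DinftyP[x x01 zx] zk.
apply/abs_sum_patchP; set v := patch _ _ _.
have vbox N A : (mis_size A <= N)%N -> forall al, al \in A -> al \notin box k N -> v al = 0.
  move=> AN al alA albox; rewrite /v /patch; case: ifP => //; rewrite inE => alk.
  by case/negP: albox; apply: mi_size_box => //; apply: leq_trans (mis_sizeP alA) AN.
have vE N : \sum_(al <- box k N) v al = \sum_(al <- box k N) c al * monomial z al.
  apply: eq_big_seq => al /boxP[alk _]; rewrite /v /patch ifT //.
  by rewrite inE.
split.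
  exists (M * (1 - x)^-1 ^+ k) => A; pose N := mis_size A.
  apply: (@le_trans _ _ (\sum_(al <- (A `|` box k N)%fset) normc (v al))).
    by apply: ler_sum_fset (fsubsetUl _ _) => al; exact: normc_ge0.
  rewrite (_ : \sum_(al <- _) _ = \sum_(al <- box k N) normc (v al)); last first.
    apply/esym/big_fset_incl; first exact: fsubsetUr.
    move=> al; rewrite inE => /orP[alA|-> //] albox.
    by rewrite (vbox N A) ?Normc.normc0.
  apply: (@le_trans _ _ (\sum_(al <- box k N) M * normc (monomial z al))).
    apply: ler_sum => al _; rewrite /v /patch; case: ifP => _.
      by rewrite Normc.normcM ler_wpM2r ?normc_ge0.
    by rewrite Normc.normc0 mulr_ge0 ?normc_ge0.
  by rewrite -mulr_sumr ler_wpM2l // (sum_box_norm _ _ x01).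
move=> e A e0; have [K [K0 HK]] := boxE k x x01.
have K1 : 0 < K + 1 by rewrite ltr_wpDl.
have [N HN] := expr_small x01 (divr_gt0 e0 K1).
pose N' := maxn N (mis_size A); exists (A `|` box k N')%fset; first exact: fsubsetUl.
rewrite (_ : \sum_(al <- _) _ = \sum_(al <- box k N') v al); last first.
  apply/esym/big_fset_incl; first exact: fsubsetUr.
  move=> al; rewrite inE => /orP[alA|-> //] albox.
  by rewrite (vbox N' A) // leq_maxr.
rewrite vE normcB; apply: le_trans (HK N' z zx zk) _.
have := HN N' (leq_maxl _ _); rewrite ler_pdivlMr // mulrC; apply: le_trans.
by rewrite ler_wpM2r ?lerDl // exprn_ge0; case/andP: x01.
Qed.

End HinftyCoefficients.

(** * Uniqueness of the monomial coefficients *)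

Section Uniqueness.
Variable R : realType.
Local Notation C := R[i].

Definition const_vec k (u : 'I_k -> C) : linfty R :=
  mkl (fun j => if insub j is Some i then u i else 0).

Lemma const_vecE k (u : 'I_k -> C) (x : R) : 0 <= x -> (forall i, normc (u i) <= x) ->
  [/\ polydisc x (const_vec u), first_coords k (const_vec u) &
      forall i : 'I_k, const_vec u i = u i].
Proof.
move=> x0 ux; pose g j := if insub j is Some i then u i else 0 : C.
have gx : polydisc x g.
  by move=> j; rewrite /g; case: insubP => [i _ _|_] //; rewrite Normc.normc0.
have E : const_vec u = g :> (nat -> C) by exact: mklE gx.
split; first by rewrite E.
  by move=> j kj; rewrite E /g insubN // -leqNgt.
by move=> i; rewrite E /g valK.
Qed.

Lemma monomial_const_vec k (u : 'I_k -> C) (x : R) al : 0 <= x ->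
  (forall i, normc (u i) <= x) -> first_indices k al ->
  monomial (const_vec u) al = \prod_(j < k) u j ^+ al j.
Proof.
move=> x0 ux alk; have [_ _ E] := const_vecE x0 ux.
by rewrite (monomialE _ alk); apply: eq_bigr => j _; rewrite E.
Qed.

(* Averaging over the grid of [N]-th roots of unity on the torus of radius 1/2
   isolates the coefficients congruent to a given one modulo [N]. *)
Lemma zero_expansion (d : multi_index -> C) k :
  (forall z, Dinfty z -> first_coords k z ->
     abs_sum (patch (fun=> 0) (first_indices k) (fun al => d al * monomial z al)) 0) ->
  forall al, first_indices k al -> d al = 0.
Proof.
move=> H al0 al0k; pose r : R := 2^-1.
have r0 : 0 < r by rewrite /r; lra.
pose v al := patch (fun=> 0) (first_indices k) (fun al => d al * \prod_(j < k) r%:C ^+ al j) al.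
have normr_ : normc (r%:C : C) = r by rewrite normcR gtr0_norm.
have inD (u : 'I_k -> C) : (forall i, normc (u i) = r) -> Dinfty (const_vec u) /\ first_coords k (const_vec u).
  move=> ur; have [|zx zk _] := const_vecE (ltW r0) (_ : forall i, normc (u i) <= r).
    by move=> i; rewrite ur.
  split=> //; apply/DinftyP; exists r => //; rewrite /r; lra.
have bv : bounded_sums v.
  have [Hd Hk] := inD (fun=> r%:C) (fun _ => normr_).
  have [bs _] := H _ Hd Hk; congr (bounded_sums _): bs.
  apply/funext => al; rewrite /v /patch; case: ifP => //; rewrite inE => alk.
  by rewrite (@monomial_const_vec k _ r) ?(ltW r0) // => i; rewrite normr_.
have grid N : (mi_size al0 < N)%N ->
    abs_sum (fun al : multi_index => if [forall j : 'I_k, (N %| al j + (N - al0 j))%N] then v al else 0) 0.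
  move=> al0N; have N0 : (0 < N)%N by exact: leq_ltn_trans al0N.
  have [w pw] := prim_rootC_exists R N0.
  have nw (i : 'I_N) : normc (r%:C * w ^+ i) = r.
    by rewrite Normc.normcM normcX (normc_prim_root N0 pw) expr1n mulr1.
  pose u (a : {ffun 'I_k -> 'I_N}) (j : 'I_k) := r%:C * w ^+ a j.
  (* Multiplication by [t a] shifts all exponents by - [al0] modulo [N], so that the average over
     the grid retains the indices congruent to [al0]. *)
  pose t (a : {ffun 'I_k -> 'I_N}) := \prod_(j < k) (w ^+ a j) ^+ (N - al0 j).
  have Ha (a : {ffun 'I_k -> 'I_N}) : abs_sum (fun al => t a *
      patch (fun=> 0) (first_indices k) (fun al => d al * monomial (const_vec (u a)) al) al) 0.
    have [Hd Hk] := inD (u a) (fun i => nw _).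
    by rewrite -[X in abs_sum _ X](mulr0 (t a)); apply/abs_sumZ/H.
  have := abs_sumZ (N%:R ^- k) (abs_sum_big (enum {ffun 'I_k -> 'I_N}) Ha).
  rewrite big1 // mulr0; apply: eq_abs_sum => al; rewrite big_enum /=.
  have [alk|alk] := pselect (first_indices k al); last first.
    have alk' : (al \in first_indices k) = false by apply/negP => /set_mem.
    rewrite /v /patch alk' if_same big1 ?mulr0 // => a _.
    by rewrite mulr0.
  have alk' : (al \in first_indices k) = true by exact: mem_set.
   rewrite /v /patch alk'.
  have E a : t a * (d al * monomial (const_vec (u a)) al) =
      d al * (\prod_(j < k) r%:C ^+ al j) * \prod_(j < k) (w ^+ a j) ^+ (al j + (N - al0 j)).
    rewrite (@monomial_const_vec k _ r) ?(ltW r0) // => [|i]; last by rewrite nw.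
    have -> : \prod_(j < k) u a j ^+ al j =
        (\prod_(j < k) r%:C ^+ al j) * \prod_(j < k) (w ^+ a j) ^+ al j.
      by rewrite -big_split; apply: eq_bigr => j _ /=; rewrite -exprMn.
    have -> : \prod_(j < k) (w ^+ a j) ^+ (al j + (N - al0 j)) =
        (\prod_(j < k) (w ^+ a j) ^+ al j) * t a.
      by rewrite -big_split; apply: eq_bigr => j _ /=; rewrite -exprD.
    by ring.
  under eq_bigr do rewrite E.
  rewrite -mulr_sumr.
  rewrite -(bigA_distr_bigA (fun (j : 'I_k) (i : 'I_N) => (w ^+ i) ^+ (al j + (N - al0 j)))) /=.
  under [X in _ * (_ * X) = _]eq_bigr do rewrite (sum_prim_root _ pw).
  case: ifP => [/forallP h|/forallP h].
    rewrite [X in _ * (_ * X)](eq_bigr (fun=> N%:R)) => [|j _]; last by rewrite h.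
    rewrite prodr_const card_ord mulrCA -exprVn -exprMn mulVf ?expr1n ?mulr1 //.
    exact: natC_neq0.
  have /existsP[j hj] : [exists j : 'I_k, ~~ (N %| al j + (N - al0 j))%N].
    by rewrite -negb_forall; apply/negP => /forallP.
  by rewrite [X in _ * (_ * X)](bigD1 j) //= (negbTE hj) mul0r !mulr0.
suff : v al0 = 0.
  rewrite /v /patch ifT ?inE // => /eqP; rewrite mulf_eq0 => /orP[/eqP //|].
  rewrite prodf_seq_eq0 => /hasP[j _ /=].
  by rewrite expf_eq0 -normc_eq0 normr_ gt_eqF // andbF.
apply: normc_le0; apply/ler_addgt0Pr => e e0; rewrite add0r.
have e2 : 0 < e / 2 by rewrite divr_gt0.
have [A HA] := bounded_sums_tail bv e2.
(* As [N] exceeds all exponents occurring in [al0] and [A], no other index of [A] is congruent to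
   [al0]; the remaining ones lie off [A] and contribute at most e / 2. *)
pose N := (mis_size (al0 |` A)%fset).+1.
have al0N : (mi_size al0 < N)%N by rewrite ltnS mis_sizeP // !inE eqxx.
have [_ Hc] := grid N al0N; have [B AB HB] := Hc _ (al0 |` A)%fset e2.
pose vN (al : multi_index) := if [forall j : 'I_k, (N %| al j + (N - al0 j))%N] then v al else 0.
have {HB} : normc (\sum_(i <- B) vN i) <= e / 2 by move: HB; rewrite subr0.
rewrite (sum_fset_sub _ AB).
set T := \sum_(i <- (_ `\` _)%fset) _.
have -> : \sum_(i <- (al0 |` A)%fset) vN i = v al0.
  rewrite (big_fsetD1 al0) /=; last by rewrite !inE eqxx.
  rewrite big_seq big1 ?addr0; last first.
    move=> al; rewrite in_fsetD1 in_fset1U => /andP[al_ /orP[/eqP alE|alA]]; first by rewrite alE eqxx in al_.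
    rewrite /vN /v /patch; case: ifP => [/forallP h|//]; case: ifP => //; rewrite inE => alk.
    case/eqP: al_; apply/fsfunP => j; have [jk|kj] := ltnP j k; last by rewrite alk ?al0k.
    have := h (Ordinal jk) => /= hj.
    have := (mi_sizeP al j).1; have := (mi_sizeP al0 j).1.
    have : (mi_size al < N)%N by rewrite ltnS mis_sizeP // !inE alA orbT.
    move: al0N hj; move: (mi_size al) (mi_size al0) (al j) (al0 j) => m m0 x y.
    move=> m0N /dvdnP[[|[|q]]] E mN ym xm; [lia|lia|].
    by exfalso; rewrite !mulSn in E; lia.
  rewrite /vN ifT //; apply/forallP => j; rewrite subnKC ?dvdnn //.
  by have := (mi_sizeP al0 j).1; lia.
move=> h; rewrite -[v al0](addrK T) [e]splitr; apply: le_trans (ler_normcB _ _) _.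
apply: lerD => //; apply: le_trans (ler_normc_sum _ _ _) _.
apply: (@le_trans _ _ (\sum_(i <- (B `\` (al0 |` A))%fset) normc (v i))).
  apply: ler_sum => al _; rewrite /vN; case: ifP => // _.
  by rewrite Normc.normc0 normc_ge0.
by apply: HA; apply/fdisjointP => i iA; rewrite !inE iA orbT.
Qed.

Lemma monomial_coefs_unique (f : linfty R -> C) c c' :
  is_monomial_coefs f c -> is_monomial_coefs f c' -> c = c'.
Proof.
move=> Hc Hc'; apply/funext => al; apply/eqP; rewrite -subr_eq0; apply/eqP.
apply: (@zero_expansion (fun al => c al - c' al) (mi_size al)); last exact: mi_size_first.
move=> z zD zk; have /abs_sum_patchP h := Hc _ z zD zk; have /abs_sum_patchP h' := Hc' _ z zD zk.
have := abs_sumD h (abs_sumZ (-1) h'); rewrite mulN1r subrr.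
apply: eq_abs_sum => be; rewrite /patch; case: ifP => _; last by rewrite mulr0 addr0.
by rewrite mulrBl mulN1r.
Qed.

Lemma monomial_coefE (f : linfty R -> C) c : is_monomial_coefs f c -> monomial_coef f = c.
Proof.
move=> Hc; apply: (@monomial_coefs_unique f) => //.
exact: (@xgetPex _ (fun=> 0) (is_monomial_coefs f)) (ex_intro _ c Hc).
Qed.

End Uniqueness.

(** * Weighted quadratic means of polynomials on the torus *)

Section FiniteSums.
Variable R : realType.

Lemma cauchy_schwarz (I : Type) (r : seq I) (P : pred I) (u v : I -> R) :
  (\sum_(i <- r | P i) u i * v i) ^+ 2 <=
  (\sum_(i <- r | P i) u i ^+ 2) * \sum_(i <- r | P i) v i ^+ 2.
Proof.
set A := \sum_(i <- r | P i) u i ^+ 2; set B := \sum_(i <- r | P i) u i * v i.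
set D := \sum_(i <- r | P i) v i ^+ 2.
have E x y : \sum_(i <- r | P i) (x * u i - y * v i) ^+ 2 =
    x ^+ 2 * A - 2 * x * y * B + y ^+ 2 * D.
  rewrite !mulr_sumr -sumrB -big_split /=; apply: eq_bigr => i _; ring.
have pos x y : 0 <= x ^+ 2 * A - 2 * x * y * B + y ^+ 2 * D.
  by rewrite -E sumr_ge0 // => i _; rewrite sqr_ge0.
have A0 : 0 <= A by apply: sumr_ge0 => i _; rewrite sqr_ge0.
have D0 : 0 <= D by apply: sumr_ge0 => i _; rewrite sqr_ge0.
have [D1|D1] := ltP 0 D.
  have := pos D B; rewrite (_ : _ + _ = D * (A * D - B ^+ 2)); last by ring.
  by rewrite pmulr_rge0 // subr_ge0.
have {}D0 : D = 0 by apply/le_anti; rewrite D0 D1.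
have [->|B0] := eqVneq B 0; first by rewrite expr2 mul0r D0 mulr0.
(* When D = 0 the quadratic form is affine in its second argument; this argument makes it equal to
   -1. *)
have := pos B ((A * B ^+ 2 + 1) / (2 * B ^+ 2)); rewrite D0 mulr0 addr0.
rewrite (_ : _ - _ = -1); last by field.
lra.
Qed.

Lemma sum_mul_le_sqrt (I : Type) (r : seq I) (P : pred I) (u v : I -> R) :
  \sum_(i <- r | P i) u i * v i <=
  Num.sqrt (\sum_(i <- r | P i) u i ^+ 2) * Num.sqrt (\sum_(i <- r | P i) v i ^+ 2).
Proof.
rewrite -sqrtrM ?sumr_ge0 // => [|i _]; last by rewrite sqr_ge0.
apply: le_trans (ler_norm _) _; rewrite -sqrtr_sqr ler_wsqrtr //.
exact: cauchy_schwarz.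
Qed.

(** By duality: the square of the left side is a sum over [j] of inner products of the total with
    its j-th term, each bounded by Cauchy-Schwarz; then one factor is divided out. *)
Lemma minkowski_sum (I J : finType) (k : I -> R) (x : I -> J -> R) :
  (forall i, 0 <= k i) ->
  Num.sqrt (\sum_i k i * (\sum_j x i j) ^+ 2) <=
  \sum_j Num.sqrt (\sum_i k i * x i j ^+ 2).
Proof.
move=> k0; set T := \sum_i k i * (\sum_j x i j) ^+ 2.
have T0 : 0 <= T by apply: sumr_ge0 => i _; rewrite mulr_ge0 ?sqr_ge0.
have S0 : 0 <= \sum_j Num.sqrt (\sum_i k i * x i j ^+ 2).
  by apply: sumr_ge0 => j _; exact: sqrtr_ge0.
have [->|T1] := eqVneq T 0; first by rewrite sqrtr0.
have {}T1 : 0 < Num.sqrt T by rewrite sqrtr_gt0 lt_neqAle eq_sym T1.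
rewrite -(ler_pM2l T1) -expr2 sqr_sqrtr //.
have E : T = \sum_j \sum_i (Num.sqrt (k i) * \sum_l x i l) * (Num.sqrt (k i) * x i j).
  rewrite exchange_big /=; apply: eq_bigr => i _.
  by rewrite -mulr_sumr -mulr_sumr mulrACA -expr2 sqr_sqrtr // -expr2.
rewrite {1}E mulr_sumr; apply: ler_sum => j _.
apply: le_trans (sum_mul_le_sqrt _ _ _ _) _; rewrite le_eqVlt; apply/orP; left; apply/eqP.
by rewrite /T; congr (Num.sqrt _ * Num.sqrt _); apply: eq_bigr => i _; rewrite exprMn sqr_sqrtr.
Qed.

End FiniteSums.

Section Hypercontractivity.
Variable R : realType.
Local Notation C := R[i].

Definition poly_at d (a : 'I_d -> C) (x : C) : C := \sum_(m < d) a m * x ^+ m.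

Section TestFunction.
Variables (N d K n : nat) (w : C).
Hypotheses (pw : N.-primitive_root w) (N0 : (0 < N)%N).
Hypotheses (n0 : (0 < n)%N) (nd : (n < d.+1)%N) (dN : (d.+1 * K.+3 <= N)%N).

(* The partial sums of the conjugate phase [(1 + tau^* x^-n) / (1 + tau x^n)],
   whose Fourier coefficients of order < 0 are supported at [-n]. *)
Definition test_fun (tau x : C) : C :=
  (1 + tau^* * x ^+ (N - n)) * \sum_(l < K.+2) (- tau * x ^+ n) ^+ l.

(** On the circle x ^ (N - n) is the conjugate of x ^ n, so the first factor has the modulus of 1 +
    tau x ^ n. Its product with the geometric sum telescopes. *)
Lemma normc_test_fun tau i :
  normc (test_fun tau (w ^+ i)) <= 1 + normc tau ^+ K.+2.
Proof.
rewrite /test_fun; set x := w ^+ i.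
have nx : normc x = 1 by rewrite normcX (normc_prim_root N0 pw) expr1n.
have xc : x * x^* = 1 by rewrite mulc_conj nx expr1n.
have nN : (n <= N)%N by lia.
have xN : x ^+ N = 1 by rewrite -exprM mulnC exprM (prim_expr_order pw) expr1n.
have -> : x ^+ (N - n) = (x ^+ n)^*.
  rewrite rmorphXn -[LHS]mulr1 -(expr1n _ n) -xc exprMn mulrA -exprD subnK //.
  by rewrite xN mul1r.
have -> : 1 + tau^* * (x ^+ n)^* = (1 + tau * x ^+ n)^* by rewrite rmorphD rmorphM rmorph1.
rewrite Normc.normcM normc_conj -Normc.normcM.
have -> : (1 + tau * x ^+ n) * \sum_(l < K.+2) (- tau * x ^+ n) ^+ l =
    1 - (- tau * x ^+ n) ^+ K.+2.
  by rewrite -[in RHS]opprB (subrX1 (- tau * x ^+ n)); ring.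
apply: le_trans (ler_normcB _ _) _.
by rewrite Normc.normc1 normcX Normc.normcM normcN normcX nx expr1n mulr1.
Qed.

Variable a : 'I_d.+1 -> C.

(** The test function has coefficient 1 - |tau| ^ 2 in degree 0 and conj tau in degree - n; its
    positive frequencies meet no coefficient of the polynomial. The size of [N] excludes any
    wrap-around modulo [N]. *)
Lemma sum_test_fun tau :
  \sum_(i < N) poly_at a (w ^+ i) * test_fun tau (w ^+ i) =
  N%:R * (a ord0 * (1 - (normc tau ^+ 2)%:C) + a (Ordinal nd) * tau^*).
Proof.
pose S q : C := \sum_(i < N) (w ^+ i) ^+ q.
have -> : \sum_(i < N) poly_at a (w ^+ i) * test_fun tau (w ^+ i) =
    \sum_(m < d.+1) \sum_(l < K.+2) a m * (- tau) ^+ l *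
      (S (m + n * l)%N + tau^* * S (m + n * l + (N - n))%N).
  rewrite /poly_at /test_fun.
  under eq_bigr do rewrite mulr_suml.
  rewrite exchange_big; apply: eq_bigr => m _ /=.
  under eq_bigr do rewrite !mulr_sumr.
  rewrite exchange_big; apply: eq_bigr => l _ /=.
  rewrite mulrDr mulrCA !mulr_sumr -big_split /=; apply: eq_bigr => i _.
  by rewrite !exprD !exprM exprMn; ring.
have SE q : S q = if (N %| q)%N then N%:R else 0 by exact: sum_prim_root.
have lt (m : 'I_d.+1) (l : 'I_K.+2) : (m + n * l + d < N)%N.
  apply: leq_trans dN; have md := ltn_ord m; have lK := ltn_ord l.
  have : (n * l <= d * K.+1)%N by rewrite leq_mul // -ltnS.
  by rewrite mulSn mulnS !mulnS; lia.
have S1 (m : 'I_d.+1) (l : 'I_K.+2) :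
    S (m + n * l)%N = if (m == 0%N :> nat) && (l == 0%N :> nat) then N%:R else 0.
  rewrite SE; have := lt m l; have [h _|h hN] := posnP (m + n * l)%N.
    rewrite h dvdn0 ifT //; move/eqP: h; rewrite addn_eq0 muln_eq0 => /andP[-> /orP[/eqP h|//]].
    by move: n0; rewrite h.
  rewrite gtnNdvd //; last by lia.
  by rewrite ifF //; apply/negP => /andP[/eqP m0 /eqP l0]; rewrite m0 l0 muln0 in h.
have S2 (m : 'I_d.+1) (l : 'I_K.+2) :
    S (m + n * l + (N - n))%N = if (m + n * l == n)%N then N%:R else 0.
  rewrite SE; have h := lt m l; congr (if _ then _ else _).
  apply/idP/eqP => [/dvdnP[[|[|q]]] E|->]; [lia|lia| |by rewrite subnKC ?dvdnn //; lia].
  by exfalso; rewrite !mulSn in E; lia.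
have E1 : \sum_(m < d.+1) \sum_(l < K.+2) a m * (- tau) ^+ l * S (m + n * l)%N = a ord0 * N%:R.
  under eq_bigr => m _ do (under eq_bigr => l _ do rewrite S1).
  rewrite (bigD1 ord0) //= (bigD1 ord0) //= expr0 mulr1 !big1 ?addr0 //.
    move=> m m0; rewrite big1 // => l _.
    by rewrite -[(m == 0%N :> nat)]/(m == ord0) (negbTE m0) mulr0.
  move=> l l0.
  by rewrite -[(l == 0%N :> nat)]/(l == ord0) (negbTE l0) ?andbF mulr0.
have E2 : \sum_(m < d.+1) \sum_(l < K.+2) a m * (- tau) ^+ l * S (m + n * l + (N - n))%N =
    (a (Ordinal nd) - a ord0 * tau) * N%:R.
  under eq_bigr => m _ do (under eq_bigr => l _ do rewrite S2).
  rewrite exchange_big big_ord_recl [X in _ + X = _]big_ord_recl /= addrA [X in _ + X = _]big1 ?addr0; last first.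
    move=> l _; rewrite big1 // => m _; rewrite /bump /= ifF ?mulr0 //.
    by apply/negP => /eqP; nia.
  rewrite (bigD1 (Ordinal nd)) //= ifT; last by apply/eqP; nia.
  rewrite [X in _ + X + _ = _]big1 ?addr0; last first.
    move=> m mn; rewrite ifF ?mulr0 //; apply: contraNF mn => /eqP h.
    by rewrite -val_eqE /=; apply/eqP; nia.
  rewrite (bigD1 ord0) //= /bump /= ifT; last by apply/eqP; nia.
  rewrite [X in _ + (_ + X) = _]big1 ?addr0; last first.
    move=> m m0; rewrite ifF ?mulr0 //; apply: contraNF m0 => /eqP h.
    by rewrite -val_eqE /=; apply/eqP; nia.
  by rewrite expr0 expr1; ring.
rewrite (_ : \sum_(m < d.+1) _ = a ord0 * N%:R + tau^* * ((a (Ordinal nd) - a ord0 * tau) * N%:R)).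
  by rewrite -mulc_conj; ring.
rewrite -E1 -E2 mulr_sumr -big_split; apply: eq_bigr => m _ /=.
rewrite mulr_sumr -big_split; apply: eq_bigr => l _ /=; ring.
Qed.

End TestFunction.

Definition grid_mean N (w : C) (g : C -> C) : R := N%:R^-1 * \sum_(i < N) normc (g (w ^+ i)).

(** With x = |a_0| and y = |a_n|, the test functions give x (1 - t ^ 2) + y t <= B for t up to 3/4.
    The best choice t = y / (2 x) yields x + y ^ 2 / (4 x), whose square is at least x ^ 2 + y ^ 2 /
    2; if it exceeds 3/4, then t = 3/4 is enough. *)
Lemma two_coefficients N d K n (w : C) (a : 'I_d.+1 -> C) (nd : (n < d.+1)%N) :
  N.-primitive_root w -> (0 < n)%N -> (d.+1 * K.+3 <= N)%N ->
  normc (a ord0) ^+ 2 + normc (a (Ordinal nd)) ^+ 2 / 2 <=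
    ((1 + (3 / 4) ^+ K.+2) * grid_mean N w (poly_at a)) ^+ 2.
Proof.
move=> pw n0 dN; have N0 : (0 < N)%N by lia.
set A := grid_mean _ _ _; set x := normc (a ord0); set y := normc (a _).
have A0 : 0 <= A by rewrite mulr_ge0 ?invr_ge0 // sumr_ge0 // => i _; exact: normc_ge0.
pose B := (1 + (3 / 4) ^+ K.+2) * A; rewrite -/B.
have H t : 0 <= t <= 3 / 4 -> x * (1 - t ^+ 2) + y * t <= B.
  move=> /andP[t0 t1].
  have [u u1 uE] := normc_phase (a ord0); have [v v1 vE] := normc_phase (a (Ordinal nd)).
  (* The phase of [tau] aligns the contributions of the two coefficients. *)
  pose tau := t%:C * (conjc v * u).
  have nt : normc tau = t by rewrite !Normc.normcM normc_conj u1 v1 !mulr1 normcR ger0_norm.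
  have uu : u * conjc u = 1 by rewrite mulc_conj u1 expr1n.
  have E : u * (a ord0 * (1 - (normc tau ^+ 2)%:C) + a (Ordinal nd) * conjc tau) =
      (x * (1 - t ^+ 2) + y * t)%:C.
    have -> : conjc tau = t%:C * (v * conjc u).
      by rewrite /tau !rmorphM /= conjcK oppr0.
    rewrite mulrDr mulrA uE nt (_ : u * (_ * (_ * _)) = (v * a (Ordinal nd)) * t%:C * (u * conjc u)).
      by rewrite vE uu mulr1 -(rmorph1 (real_complex R)) -rmorphB -!rmorphM -rmorphD.
    by ring.
  have : normc (\sum_(i < N) poly_at a (w ^+ i) * test_fun N K n tau (w ^+ i)) <=
      (N%:R * A) * (1 + t ^+ K.+2).
    apply: le_trans (ler_normc_sum _ _ _) _.
    rewrite mulrA divff ?pnatr_eq0 -?lt0n // mul1r mulr_suml; apply: ler_sum => i _.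
    rewrite Normc.normcM ler_wpM2l ?normc_ge0 // -nt.
    by apply: (@normc_test_fun N d K n w).
  rewrite (sum_test_fun pw N0 n0 nd dN) Normc.normcM normc_nat -mulrA ler_pM2l ?ltr0n //.
  have -> : normc (a ord0 * (1 - (normc tau ^+ 2)%:C) + a (Ordinal nd) * conjc tau) =
      `|x * (1 - t ^+ 2) + y * t| by rewrite -normcR -E (Normc.normcM u) u1 mul1r.
  move=> h.
  apply: le_trans (ler_norm _) _; apply: le_trans h _; rewrite mulrC ler_wpM2r //.
  by rewrite lerD2l lerXn2r // nnegrE; lra.
have x0 : 0 <= x by exact: normc_ge0.
have y0 : 0 <= y by exact: normc_ge0.
have [yx|xy] := leP (2 * y) (3 * x).
  have [x1|x1] := eqVneq x 0.
    have -> : y = 0 by rewrite x1 in yx; lra.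
    by rewrite x1 !expr0n /= mul0r addr0 sqr_ge0.
  have {}x1 : 0 < x by rewrite lt_neqAle eq_sym x1.
  have ht : 0 <= y / (2 * x) <= 3 / 4.
    rewrite divr_ge0 ?mulr_ge0 //= ler_pdivrMr ?mulr_gt0 //; lra.
  have := H _ ht; rewrite (_ : _ + _ = x + y ^+ 2 / (4 * x)); last by field; rewrite gt_eqF.
  move=> h; apply: le_trans (_ : (x + y ^+ 2 / (4 * x)) ^+ 2 <= _); last first.
    apply: lerXn2r => //; rewrite nnegrE; last first.
      by rewrite mulr_ge0 // addr_ge0 // exprn_ge0.
    by apply: addr_ge0 => //; rewrite divr_ge0 ?sqr_ge0 // mulr_ge0.
  rewrite (_ : (_ + _) ^+ 2 = x ^+ 2 + y ^+ 2 / 2 + (y ^+ 2 / (4 * x)) ^+ 2).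
    by rewrite lerDl sqr_ge0.
  by field; rewrite gt_eqF.
have := H (3 / 4) ltac:(lra); have := sqr_ge0 (x : R); nra.
Qed.

Definition weights (k : nat -> R) := [/\ forall n, 0 <= k n, k 0%N = 1 &
  forall d, \sum_(n < d) k n.+1 <= 1 / 2].

(** The inequalities of [two_coefficients] are averaged over [n] with weights 2 k_n, whose sum is at
    most 1 by [weights]; the missing mass is put on |a_0| <= B. *)
Lemma one_variable N d K (w : C) (a : 'I_d.+1 -> C) k : weights k ->
  N.-primitive_root w -> (d.+1 * K.+3 <= N)%N ->
  Num.sqrt (\sum_(m < d.+1) k m * normc (a m) ^+ 2) <=
    (1 + (3 / 4) ^+ K.+2) * grid_mean N w (poly_at a).
Proof.
move=> [k0 k1 ks] pw dN; set B := _ * _.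
have B0 : 0 <= B.
  rewrite mulr_ge0 ?addr_ge0 ?exprn_ge0 //.
  by rewrite mulr_ge0 ?invr_ge0 // sumr_ge0 // => i _; exact: normc_ge0.
rewrite -[leRHS]ger0_norm // -sqrtr_sqr ler_wsqrtr //.
rewrite big_ord_recl k1 mul1r.
set x := normc (a ord0); set s := \sum_(i < d) k i.+1.
have H (i : 'I_d) : x ^+ 2 + normc (a (lift ord0 i)) ^+ 2 / 2 <= B ^+ 2.
  have nd : (i.+1 < d.+1)%N by rewrite ltnS.
  have := @two_coefficients N d K i.+1 w a nd pw (ltn0Sn i) dN.
  by rewrite (_ : Ordinal nd = lift ord0 i) //; apply/val_inj.
(* For a constant polynomial there is no second coefficient to pair with; |a_0| is then the mean
   itself. *)
have [d0|d0] := posnP d.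
  subst d; rewrite big_ord0 addr0; apply: lerXn2r; rewrite ?nnegrE ?normc_ge0 //.
  have -> : B = (1 + (3 / 4) ^+ K.+2) * x.
    rewrite /B /grid_mean /poly_at; congr (_ * _).
    under eq_bigr do rewrite big_ord1 expr0 mulr1.
    by rewrite sumr_const card_ord -[X in _ * X]mulr_natl mulrA mulVf ?mul1r // pnatr_eq0 -lt0n; lia.
  by rewrite ler_peMl ?normc_ge0 // lerDl exprn_ge0.
have xB : x ^+ 2 <= B ^+ 2.
  by apply: le_trans (H (Ordinal d0)); rewrite lerDl divr_ge0 // sqr_ge0.
have s1 : 2 * s <= 1 by have := ks d; rewrite -/s; lra.
have : \sum_(i < d) 2 * k i.+1 * (x ^+ 2 + normc (a (lift ord0 i)) ^+ 2 / 2) <=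
    \sum_(i < d) 2 * k i.+1 * B ^+ 2.
  by apply: ler_sum => i _; rewrite ler_wpM2l // mulr_ge0.
rewrite -mulr_suml -mulr_sumr -/s.
rewrite (_ : \sum_(i < d) _ = 2 * s * x ^+ 2 + \sum_(i < d) k i.+1 * normc (a (lift ord0 i)) ^+ 2); last first.
  by rewrite /s mulr_sumr mulr_suml -big_split /=; apply: eq_bigr => i _; field.
have : 0 <= (1 - 2 * s) * (B ^+ 2 - x ^+ 2) by rewrite mulr_ge0 // subr_ge0.
rewrite -[X in _ -> _ -> _ + X <= _]/(\sum_(i < d) k i.+1 * normc (a (lift ord0 i)) ^+ 2).
set S := \sum_(i < d) _; rewrite mulrBr !mulrBl; lra.
Qed.

Definition weight n d (k : nat -> R) (a : {ffun 'I_n -> 'I_d}) : R := \prod_(j < n) k (a j).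

Definition mpoly_at n d (b : {ffun 'I_n -> 'I_d} -> C) (x : 'I_n -> C) : C :=
  \sum_a b a * \prod_(j < n) x j ^+ a j.

Definition torus_mean N n (w : C) (g : ('I_n -> C) -> C) : R :=
  N%:R^-1 ^+ n * \sum_(i : {ffun 'I_n -> 'I_N}) normc (g (fun j => w ^+ i j)).

(* By induction on the number of variables, Minkowski's inequality exchanging the
   quadratic mean over one variable with the mean over the others. *)
Lemma hypercontractivity N n d K (w : C) (b : {ffun 'I_n -> 'I_d.+1} -> C) k : weights k ->
  N.-primitive_root w -> (d.+1 * K.+3 <= N)%N ->
  Num.sqrt (\sum_a weight k a * normc (b a) ^+ 2) <=
    (1 + (3 / 4) ^+ K.+2) ^+ n * torus_mean N w (mpoly_at b).
Proof.
move=> kw pw dN; have [k0 _ _] := kw; set D := 1 + _.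
have D0 : 0 <= D by rewrite addr_ge0 // exprn_ge0.
have N0 : (0 < N)%N by lia.
elim: n b => [|n IH] b.
  rewrite (big_ffun0 _ _ (ffun0 (card_ord 0))) /weight big_ord0 mul1r sqrtr_sqr.
  rewrite ger0_norm ?normc_ge0 // /torus_mean (big_ffun0 _ _ (ffun0 (card_ord 0))) !expr0 !mul1r.
  by rewrite /mpoly_at (big_ffun0 _ _ (ffun0 (card_ord 0))) big_ord0 mulr1.
pose P (m : 'I_d.+1) := mpoly_at (fun g => b (fcons m g)).
have T0 m : 0 <= torus_mean N w (P m).
  by rewrite mulr_ge0 ?exprn_ge0 ?invr_ge0 // sumr_ge0 // => i _; exact: normc_ge0.
rewrite big_ffun_recl.
apply: (@le_trans _ _ (Num.sqrt (\sum_(m < d.+1) k m * (D ^+ n * torus_mean N w (P m)) ^+ 2))).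
  rewrite ler_wsqrtr //; apply: ler_sum => m _.
  rewrite (_ : \sum_g _ = k m * \sum_g weight k g * normc (b (fcons m g)) ^+ 2); last first.
    rewrite mulr_sumr; apply: eq_bigr => g _; rewrite /weight big_ord_recl fcons0 mulrA.
    by congr (_ * _ * _); apply: eq_bigr => j _; rewrite fconsS.
  rewrite ler_wpM2l //; set X := \sum_g _.
  have X0 : 0 <= X.
    by apply: sumr_ge0 => g _; rewrite mulr_ge0 ?sqr_ge0 // prodr_ge0.
  rewrite -[X]sqr_sqrtr //; apply: lerXn2r; rewrite ?nnegrE ?sqrtr_ge0 //.
    by rewrite mulr_ge0 // exprn_ge0.
  exact: (IH (fun g => b (fcons m g))).
pose c : R := D ^+ n * N%:R^-1 ^+ n.
have c0 : 0 <= c by rewrite mulr_ge0 ?exprn_ge0 ?invr_ge0.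
pose G := {ffun 'I_n -> 'I_N}.
have -> : \sum_(m < d.+1) k m * (D ^+ n * torus_mean N w (P m)) ^+ 2 =
    \sum_(m < d.+1) k m * (\sum_(g : G) c * normc (P m (fun j => w ^+ g j))) ^+ 2.
  by apply: eq_bigr => m _; congr (_ * _ ^+ 2); rewrite /torus_mean mulrA -/c mulr_sumr.
apply: le_trans (minkowski_sum _ _) _; first by move=> m; exact: k0.
have step (g : G) : Num.sqrt (\sum_(m < d.+1) k m * (c * normc (P m (fun j => w ^+ g j))) ^+ 2) <=
    c * (D * grid_mean N w (poly_at (fun m => P m (fun j => w ^+ g j)))).
  apply: (@le_trans _ _ (c * Num.sqrt (\sum_(m < d.+1) k m * normc (P m (fun j => w ^+ g j)) ^+ 2))).
    rewrite -{2}[c]ger0_norm // -sqrtr_sqr -sqrtrM ?sqr_ge0 // ler_wsqrtr //.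
    by rewrite mulr_sumr; apply: ler_sum => m _; rewrite exprMn mulrCA lexx.
  by rewrite ler_wpM2l //; apply: one_variable.
apply: le_trans (ler_sum _ (fun g _ => step g)) _.
rewrite le_eqVlt; apply/orP; left; apply/eqP.
rewrite -!mulr_sumr /torus_mean big_ffun_recl exchange_big /=.
rewrite /c !exprSr.
have -> : \sum_(g : G) \sum_(i < N) normc (poly_at (fun m => P m (fun j => w ^+ g j)) (w ^+ i)) =
   \sum_(g : G) \sum_(i < N) normc (mpoly_at b (fun j => w ^+ fcons i g j)).
  apply: eq_bigr => g _; apply: eq_bigr => i _; congr normc.
  rewrite /mpoly_at big_ffun_recl; apply: eq_bigr => m _.
  rewrite /P /mpoly_at mulr_suml; apply: eq_bigr => h _.
  rewrite big_ord_recl !fcons0 -mulrA; congr (_ * _); rewrite mulrC; congr (_ * _).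
  by apply: eq_bigr => j _; rewrite !fconsS.
ring.
Qed.

End Hypercontractivity.

(** * Sums of moduli of coefficients *)

Section CoefficientSums.
Variable R : realType.
Local Notation C := R[i].

Lemma poly_coef_bound (p : {poly C}) (M : R) m :
  (forall x, normc x = 1 -> normc p.[x] <= M) -> normc p`_m <= M.
Proof.
move=> pM; pose N := maxn (size p) m.+1.
have mN : (m < N)%N by exact: leq_maxr.
have [w pw] := prim_rootC_exists R (leq_trans (ltn0Sn m) mN).
have E x : p.[x] = \sum_(i < N) p`_i * x ^+ i by apply: horner_coef_wide; exact: leq_maxl.
have := @circle_average_bound _ N w 1 m (fun x => \sum_(i < N) p`_i * x ^+ i) M
  (leq_trans (ltn0Sn m) mN) pw ltr01.
rewrite (circle_average_poly (fun i => p`_i) mN pw ltr01) expr1n divr1; apply.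
by move=> x x1; rewrite -E pM.
Qed.

(** The first-order part of a polynomial with constant term 1. Under products the linear
    coefficients add, which differentiates a monomial along a line without expanding it. *)
Definition unipotent (p : {poly C}) c := p`_0 = 1 /\ p`_1 = c.

Lemma unipotentM p q c d : unipotent p c -> unipotent q d -> unipotent (p * q) (c + d).
Proof.
move=> [p0 p1] [q0 q1]; split; rewrite coefM !big_ord_recl big_ord0 /= ?subn0 ?subnn.
  by rewrite p0 q0 mulr1 addr0.
by rewrite /bump /= p0 q1 p1 q0; ring.
Qed.

Lemma unipotent_prod n (mu : 'I_n -> C) (a : 'I_n -> nat) :
  unipotent (\prod_j (1 + (mu j)%:P * 'X) ^+ a j) (\sum_j (a j)%:R * mu j).
Proof.
have one : unipotent 1 0 by split; rewrite coef1.
have lin u : unipotent (1 + u%:P * 'X) u.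
  by split; rewrite coefD coef1 coefCM coefX ?mulr0 ?mulr1 ?addr0 ?add0r.
apply: (big_ind2 unipotent) => // [p c q d|j _]; first exact: unipotentM.
elim: (a j) => [|m IH]; first by rewrite expr0 mul0r.
have -> : m.+1%:R * mu j = mu j + m%:R * mu j by rewrite -natr1; ring.
by rewrite exprS; exact: unipotentM.
Qed.

(** The coefficients of x_k times the k-th partial derivative of f (r x). The factor x_k is
    invisible in modulus on the torus and keeps the exponents unchanged. *)
Definition radial_coef n d (b : {ffun 'I_n -> 'I_d} -> C) (r : R) (k : 'I_n)
    (a : {ffun 'I_n -> 'I_d}) : C :=
  (a k)%:R * b a * r%:C ^+ (\sum_j a j)%N.

(* The derivative of [f] at [r x], as a linear form on the sup-normed space, has
   norm at most [M / (1 - r)] by Cauchy's estimate on a complex line; its norm is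
   the l1-norm of the gradient. *)
Lemma sum_radial_derivatives n d (b : {ffun 'I_n -> 'I_d} -> C) (M r : R) (x : 'I_n -> C) :
  (forall y : 'I_n -> C, (forall j, normc (y j) <= 1) -> normc (mpoly_at b y) <= M) ->
  0 < r < 1 -> (forall j, normc (x j) = 1) ->
  \sum_k normc (mpoly_at (radial_coef b r k) x) <= M * (r / (1 - r)).
Proof.
move=> fM /andP[r0 r1] x1; pose g k := mpoly_at (radial_coef b r k) x.
have [u Hu] := choice (fun k => (fun '(ex_intro2 u h1 h2) =>
   ex_intro (fun u => normc u = 1 /\ u * g k = (normc (g k))%:C) u (conj h1 h2)) (normc_phase (g k))).
(* Since r (1 + rho) = 1, the points r x_j (1 + mu_j t) stay in the closed polydisc for |t| = 1. *)
pose rho := (1 - r) / r; have r1' : 0 < 1 - r by rewrite subr_gt0.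
have rho0 : 0 < rho by rewrite divr_gt0.
pose mu j := rho%:C * u j.
pose p : {poly C} := \sum_(a : {ffun 'I_n -> 'I_d})
  (b a * \prod_j (r%:C * x j) ^+ a j)%:P * \prod_j (1 + (mu j)%:P * 'X) ^+ a j.
have p1 : p`_1 = (rho * \sum_k normc (g k))%:C.
  rewrite /p coef_sum (eq_bigr (fun a : {ffun 'I_n -> 'I_d} =>
     \sum_k mu k * (radial_coef b r k a * \prod_j x j ^+ a j))); last first.
    move=> a _; rewrite coefCM (unipotent_prod mu (fun j => a j)).2.
    have -> : \prod_j (r%:C * x j) ^+ a j = r%:C ^+ (\sum_j a j)%N * \prod_j x j ^+ a j.
      by under eq_bigr do rewrite exprMn; rewrite big_split /= prodrXr.
    rewrite mulr_sumr; apply: eq_bigr => k _; rewrite /radial_coef; ring.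
  rewrite exchange_big mulr_sumr rmorph_sum; apply: eq_bigr => k _ /=.
  by rewrite -mulr_sumr -/(mpoly_at _ _) -/(g k) /mu -mulrA (Hu k).2 -rmorphM.
have pM : forall t, normc t = 1 -> normc p.[t] <= M.
  move=> t t1.
  have -> : p.[t] = mpoly_at b (fun j => r%:C * x j * (1 + mu j * t)).
    rewrite /p horner_sum; apply: eq_bigr => a _.
    rewrite hornerM hornerC horner_prod -mulrA -big_split; congr (_ * _).
    apply: eq_bigr => j _ /=.
    by rewrite horner_exp [RHS]exprMn !hornerE.
  apply: fM => j; rewrite !Normc.normcM normcR gtr0_norm // x1 mulr1.
  apply: (@le_trans _ _ (r * (1 + rho))); last by rewrite /rho mulrDr mulrCA divff ?gt_eqF //; lra.
  rewrite ler_pM2l //; apply: le_trans (le_normcD _ _) _.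
  by rewrite Normc.normc1 !Normc.normcM t1 (Hu j).1 !mulr1 normcR gtr0_norm.
have := poly_coef_bound 1 pM; rewrite p1 normcR ger0_norm; last first.
  by rewrite mulr_ge0 ?(ltW rho0) // sumr_ge0 // => k _; exact: normc_ge0.
by rewrite mulrC -ler_pdivlMr // /rho invf_div.
Qed.

Definition top_support n d (rk : 'I_n -> nat) (k : 'I_n) (a : {ffun 'I_n -> 'I_d}) : bool :=
  (0 < a k)%N && [forall j, (rk k < rk j)%N ==> (a j == 0%N :> nat)].

Lemma top_support_ex n d (rk : 'I_n -> nat) (a : {ffun 'I_n -> 'I_d}) :
  (exists j, 0 < a j)%N -> exists k, top_support rk k a.
Proof.
move=> [j0 aj0]; case: (@arg_maxnP _ j0 (fun j => (0 < a j)%N) rk aj0) => k ak max.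
exists k; rewrite /top_support ak /=; apply/forallP => j; apply/implyP => kj.
by rewrite eqn0Ngt; apply/negP => /max /=; lia.
Qed.

(** The factor of one variable in the Cauchy-Schwarz term dual to the weighted quadratic mean. *)
Definition exp_weight (k : nat -> R) (y : R) m := y ^+ m / k m.

Lemma ler_sum_top_support n d (rk : 'I_n -> nat) (F : {ffun 'I_n -> 'I_d.+1} -> R) :
  (forall a, 0 <= F a) ->
  \sum_a F a <= F [ffun=> ord0] + \sum_k \sum_(a | top_support rk k a) F a.
Proof.
move=> F0; rewrite (bigD1 [ffun=> ord0]) //= lerD2l.
under [leRHS]eq_bigr do rewrite big_mkcond /=.
rewrite exchange_big /= big_mkcond /=; apply: ler_sum => a _; case: eqP => [_|/eqP a0] /=.
  by apply: sumr_ge0 => k _; case: ifP.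
have [k hk] : exists k, top_support rk k a.
  apply: top_support_ex; apply: contrapT => H; case/eqP: a0; apply/ffunP => j.
  rewrite ffunE; apply/val_inj/eqP => /=; rewrite eqn0Ngt; apply/negP => h.
  by apply: H; exists j.
rewrite (bigD1 k) //= hk lerDl; apply: sumr_ge0 => j _; case: ifP => //.
Qed.

(** Hypercontractivity loses one factor per variable. Longer partial sums in the test function keep
    the total loss below 2, whatever the number of variables. The bound follows from (1 + e) ^ n (1
    - e) ^ n <= 1 and Bernoulli's inequality. *)
Lemma expr_close1 n : exists K, (1 + (3 / 4) ^+ K.+2) ^+ n <= 2 :> R.
Proof.
have q01 : 0 <= (3 / 4 : R) < 1 by lra.
have n1 : 0 < (2 * n.+1%:R : R)^-1 by rewrite invr_gt0 mulr_gt0.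
have [K HK] := expr_small q01 n1; exists K.
set e := (3 / 4) ^+ K.+2; have e0 : 0 <= e by rewrite exprn_ge0.
have en : e <= (2 * n.+1%:R)^-1 by apply: HK; lia.
have ne : n%:R * e <= 2^-1.
  apply: le_trans (_ : n.+1%:R * e <= _); first by rewrite ler_wpM2r // ler_nat.
  by rewrite -ler_pdivlMl ?ltr0n // -invfM mulrC.
have e1 : e <= 1.
  apply: le_trans en _; rewrite invf_le1 ?mulr_gt0 //.
  have : 1 <= n.+1%:R :> R by rewrite ler1n.
  lra.
have : (1 + e) ^+ n * (1 - e) ^+ n <= 1.
  rewrite -exprMn (_ : _ * _ = 1 - e ^+ 2); last by ring.
  by apply: exprn_ile1; [rewrite subr_ge0 exprn_ile1|rewrite gerBl sqr_ge0].
have := @bernoulli_le _ e n ltac:(lra).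
have : 0 <= (1 + e) ^+ n by rewrite exprn_ge0 // addr_ge0.
set x := (1 + e) ^+ n; set y := (1 - e) ^+ n; nra.
Qed.

(* Monomials are grouped by the variable of largest rank in their support; on each
   group, Cauchy-Schwarz against [hypercontractivity] for the corresponding partial
   derivative. *)
Lemma coefficient_sum_bound n d (b : {ffun 'I_n -> 'I_d.+1} -> C) (M r B : R)
    (k : nat -> R) (rk : 'I_n -> nat) (s : 'I_n -> R) :
  (forall y : 'I_n -> C, (forall j, normc (y j) <= 1) -> normc (mpoly_at b y) <= M) ->
  0 < r < 1 -> weights k -> (forall m, 0 < k m) -> (forall j, 0 <= s j) -> 0 <= B ->
  (forall i, \sum_(a : {ffun 'I_n -> 'I_d.+1} | top_support rk i a)
     \prod_j exp_weight k (s j ^+ 2 / r ^+ 2) (a j) <= B ^+ 2) ->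
  \sum_a normc (b a) * \prod_j s j ^+ a j <=
    M + 2 * B * (M * (r / (1 - r))).
Proof.
move=> fM r01 kw k0 s0 B0 HB; have /andP[r0 r1] := r01.
have [K HK] := expr_close1 n; pose N := (d.+1 * K.+3)%N.
have N0 : (0 < N)%N by rewrite muln_gt0.
have [w pw] := prim_rootC_exists R N0.
apply: le_trans (ler_sum_top_support rk _) _.
  by move=> a; rewrite mulr_ge0 ?normc_ge0 // prodr_ge0 // => j _; rewrite exprn_ge0.
apply: lerD.
  rewrite [X in _ * X]big1 ?mulr1; last by move=> j _; rewrite ffunE expr0.
  have := fM (fun=> 0); rewrite (_ : mpoly_at b _ = b [ffun=> ord0]); last first.
    rewrite /mpoly_at (bigD1 [ffun=> ord0]) //= big1 ?mulr1; last by move=> j _; rewrite ffunE expr0.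
    rewrite big1 ?addr0 // => a a0.
    have [j aj] : exists j, a j != 0%N :> nat.
      apply: contrapT => H; case/eqP: a0; apply/ffunP => j; rewrite ffunE.
      by apply/val_inj/eqP/negPn/negP => h; apply: H; exists j.
    by rewrite (bigD1 j) //= expr0n (negbTE aj) mul0r mulr0.
  by apply=> j; rewrite Normc.normc0.
pose T i := torus_mean N w (mpoly_at (radial_coef b r i)).
have T0 i : 0 <= T i.
  by rewrite mulr_ge0 ?exprn_ge0 ?invr_ge0 // sumr_ge0 // => g _; exact: normc_ge0.
have M0 : 0 <= M.
  by apply: le_trans (fM (fun=> 0) _); rewrite ?normc_ge0 // => j; rewrite Normc.normc0.
have sumT : \sum_i T i <= M * (r / (1 - r)).
  rewrite -mulr_sumr exchange_big /=.
  rewrite exprVn mulrC ler_pdivrMr ?exprn_gt0 ?ltr0n //.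
  have -> : M * (r / (1 - r)) * N%:R ^+ n = \sum_(g : {ffun 'I_n -> 'I_N}) M * (r / (1 - r)).
    by rewrite sumr_const card_ffun !card_ord -natrX mulr_natr.
  apply: ler_sum => g _; apply: sum_radial_derivatives => // j.
  by rewrite normcX (normc_prim_root N0 pw) expr1n.
have step i : \sum_(a | top_support rk i a) normc (b a) * \prod_j s j ^+ a j <= 2 * B * T i.
  apply: (@le_trans _ _ (\sum_(a | top_support rk i a)
     (Num.sqrt (weight k a) * normc (radial_coef b r i a)) *
     Num.sqrt (\prod_j exp_weight k (s j ^+ 2 / r ^+ 2) (a j)))).
    apply: ler_sum => a /andP[ai _].
    have wa : 0 < weight k a by exact: prodr_gt0.
    have sa : 0 <= \prod_j s j ^+ a j by apply: prodr_ge0 => j _; rewrite exprn_ge0.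
    have -> : Num.sqrt (\prod_j exp_weight k (s j ^+ 2 / r ^+ 2) (a j)) =
        (\prod_j s j ^+ a j) / r ^+ (\sum_j a j)%N / Num.sqrt (weight k a).
      rewrite /weight /exp_weight big_split /= prodfV sqrtrM; last first.
        by apply: prodr_ge0 => j _; rewrite exprn_ge0 // divr_ge0 ?sqr_ge0.
      rewrite sqrtrV ?(ltW wa) //; congr (_ / _).
      have -> : \prod_j (s j ^+ 2 / r ^+ 2) ^+ a j =
          ((\prod_j s j ^+ a j) / r ^+ (\sum_j a j)%N) ^+ 2.
        rewrite -prodrXr -prodfV -big_split /= -prodrXl; apply: eq_bigr => j _.
        by rewrite expr_div_n [RHS]expr_div_n -!exprM (mulnC 2).
      by rewrite sqrtr_sqr ger0_norm // divr_ge0 // exprn_ge0 // ltW.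
    rewrite /radial_coef !Normc.normcM normcX normcR gtr0_norm // normc_nat.
    (* The differentiation has produced the factor [a i], which is at least 1 on the group of
       [i]. *)
    rewrite [leRHS](_ : _ = (a i)%:R * (normc (b a) * \prod_j s j ^+ a j)).
      by rewrite ler_peMl ?ler1n // mulr_ge0 ?normc_ge0.
    by field; rewrite !gt_eqF ?sqrtr_gt0 ?exprn_gt0.
  apply: le_trans (sum_mul_le_sqrt _ _ _ _) _.
  have -> : 2 * B * T i = (2 * T i) * B by ring.
  apply: ler_pM; rewrite ?sqrtr_ge0 //.
    apply: le_trans (_ : (1 + (3 / 4) ^+ K.+2) ^+ n * T i <= _); last by rewrite ler_wpM2r.
    apply: le_trans _ (hypercontractivity _ kw pw (leqnn N)).
    rewrite ler_wsqrtr // big_mkcond; apply: ler_sum => a _ /=.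
    rewrite exprMn sqr_sqrtr; last by apply: prodr_ge0 => j _; exact: ltW.
    by case: ifP => // _; rewrite mulr_ge0 ?sqr_ge0 // prodr_ge0 // => j _; exact: ltW.
  rewrite -[leRHS]ger0_norm // -sqrtr_sqr ler_wsqrtr //; apply: le_trans (HB i).
  apply: ler_sum => a _; rewrite sqr_sqrtr // prodr_ge0 // => j _.
  by rewrite divr_ge0 ?exprn_ge0 ?divr_ge0 ?sqr_ge0 // ltW.
apply: le_trans (ler_sum _ (fun i _ => step i)) _.
by rewrite -mulr_sumr ler_wpM2l // mulr_ge0.
Qed.

End CoefficientSums.

(** * Decreasing rearrangements *)

Section Weights.
Variable R : realType.

(* The weight of degree 1 is almost the maximal value 1/2 that [weights] allows: it
   determines [weight_slope], hence the constant 1/2 of the sufficient condition. *)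
Definition mixed_weight (eta q : R) (m : nat) : R :=
  if m is m1.+1 then
    if m1 is m2.+1 then eta * (1 - q) * q ^+ m2 / 2 else (1 - eta) / 2
  else 1.

Variables (eta q x1 : R).
Hypotheses (eta01 : 0 < eta < 1) (q1 : q < 1) (x1q : 0 <= x1 < q).

Lemma mixed_weight_gt0 m : 0 < mixed_weight eta q m.
Proof.
have /andP[e0 e1] := eta01; have /andP[x0 xq] := x1q.
have q0 : 0 < q by exact: le_lt_trans xq.
case: m => [|[|m]] //=; first by rewrite divr_gt0 // subr_gt0.
by rewrite divr_gt0 // !mulr_gt0 ?exprn_gt0 // subr_gt0.
Qed.

Lemma mixed_weightsP : weights (mixed_weight eta q).
Proof.
have /andP[e0 e1] := eta01; have /andP[x0 xq] := x1q.
have q01 : 0 <= q < 1 by rewrite q1 andbT; lra.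
split=> // [m|d]; first exact/ltW/mixed_weight_gt0.
case: d => [|d]; first by rewrite big_ord0; lra.
rewrite big_ord_recl /=.
have := @sum_geometric_le _ q 0 d q01; rewrite big_mkord expr0 => h.
rewrite (_ : \sum_(i < d) _ = eta * (1 - q) / 2 * \sum_(i < d) q ^+ i); last first.
  by rewrite mulr_sumr; apply: eq_bigr => i _; ring.
have : eta * (1 - q) / 2 * \sum_(i < d) q ^+ i <= eta * (1 - q) / 2 * (1 / (1 - q)).
  by rewrite ler_wpM2l // divr_ge0 // mulr_ge0 ?subr_ge0 ?(ltW q1) // ltW.
rewrite (_ : eta * (1 - q) / 2 * (1 / (1 - q)) = eta / 2); last first.
  by field; rewrite gt_eqF // subr_gt0.
lra.
Qed.

Definition weight_slope : R := 2 / (1 - eta).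
Definition weight_curvature : R := 2 / (eta * (1 - q)) / (1 - x1 / q).

Lemma weight_curvature_ge0 : 0 <= weight_curvature.
Proof.
have /andP[e0 e1] := eta01; have /andP[x0 xq] := x1q.
have q0 : 0 < q by exact: le_lt_trans xq.
rewrite !divr_ge0 // ?mulr_ge0 ?subr_ge0 ?(ltW e0) ?(ltW q1) //.
by rewrite ler_pdivrMr // mul1r ltW.
Qed.

(** The term of degree 1 is [weight_slope * x]; those of higher degree form a geometric series of
    ratio x / q, bounded uniformly because x <= x1 < q. *)
Lemma sum_exp_weight_le d x : 0 <= x <= x1 ->
  \sum_(m < d.+1 | (0 < m)%N) exp_weight (mixed_weight eta q) x m <=
    weight_slope * x + weight_curvature * x ^+ 2.
Proof.
have /andP[e0 e1] := eta01; have /andP[x0 xq] := x1q; move=> /andP[y0 y1].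
have q0 : 0 < q by exact: le_lt_trans xq.
have C0 := weight_curvature_ge0; have s0 : 0 <= weight_slope.
  by rewrite divr_ge0 // subr_ge0 ltW.
rewrite big_mkcond big_ord_recl /= add0r; case: d => [|d].
  by rewrite big_ord0 addr_ge0 // mulr_ge0 // sqr_ge0.
rewrite big_ord_recl /= /exp_weight /= expr1; apply: lerD.
  by rewrite invf_div mulrC.
pose y := x / q; have y01 : 0 <= y < 1.
  by rewrite divr_ge0 ?(ltW q0) //= ltr_pdivrMr // mul1r; exact: le_lt_trans xq.
have := @sum_geometric_le _ y 0 d y01; rewrite big_mkord expr0 => h.
rewrite (_ : \sum_(i < d) _ = 2 / (eta * (1 - q)) * x ^+ 2 * \sum_(i < d) y ^+ i); last first.
  rewrite mulr_sumr; apply: eq_bigr => i _; rewrite /bump /= !exprS /y expr_div_n.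
  by field; rewrite !gt_eqF ?exprn_gt0 // subr_gt0.
have A0 : 0 <= 2 / (eta * (1 - q)) * x ^+ 2.
  by rewrite mulr_ge0 ?sqr_ge0 // divr_ge0 // mulr_ge0 ?subr_ge0 ?(ltW e0) ?(ltW q1).
apply: le_trans (ler_wpM2l A0 h) _.
rewrite /weight_curvature mulrAC ler_wpM2r ?sqr_ge0 // ler_wpM2l //.
  by rewrite divr_ge0 // mulr_ge0 ?subr_ge0 ?(ltW e0) ?(ltW q1).
have h1 : x1 / q < 1 by rewrite ltr_pdivrMr // mul1r.
have h2 : y <= x1 / q by rewrite ler_wpM2r // invr_ge0 ltW.
by rewrite div1r lef_pV2 ?posrE ?subr_gt0 //; [lra|case/andP: y01].
Qed.

(** The sum is at most a product over the variables. Those ranked above [i] contribute 1, [i] itself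
    lacks the term of degree 0, and each one ranked below contributes at most 1 + u <= exp u. *)
Lemma top_support_sum n d (rk : 'I_n -> nat) (x : 'I_n -> R) i : injective rk ->
  (forall j, 0 <= x j <= x1) ->
  \sum_(a : {ffun 'I_n -> 'I_d.+1} | top_support rk i a)
     \prod_j exp_weight (mixed_weight eta q) (x j) (a j) <=
  (weight_slope * x i + weight_curvature * x i ^+ 2) *
  expR (\sum_(j | (rk j < rk i)%N) (weight_slope * x j + weight_curvature * x j ^+ 2)).
Proof.
move=> rk_inj x01; pose ew := exp_weight (mixed_weight eta q).
have ew0 j m : 0 <= ew (x j) m.
  rewrite divr_ge0 ?exprn_ge0 //; first by case/andP: (x01 j).
  exact/ltW/mixed_weight_gt0.
pose F (j : 'I_n) (m : 'I_d.+1) : R := if j == i then (if (0 < m)%N then ew (x j) m else 0)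
  else if (rk i < rk j)%N then (if m == 0%N :> nat then ew (x j) m else 0) else ew (x j) m.
have F0 j m : 0 <= F j m by rewrite /F; case: ifP => _; case: ifP => //; case: ifP.
apply: (@le_trans _ _ (\sum_(a : {ffun 'I_n -> 'I_d.+1}) \prod_j F j (a j))).
  rewrite big_mkcond; apply: ler_sum => a _ /=; case: ifP => [/andP[ai /forallP ha]|_].
    apply: ler_prod => j _; rewrite ew0 /= /F; case: eqP => [->|_]; first by rewrite ai.
    by case: ifP => // ij; have := ha j; rewrite ij /= => ->.
  by apply: prodr_ge0.
rewrite -(bigA_distr_bigA F) /= (bigD1 i) //=.
have wsum j : \sum_(m < d.+1) ew (x j) m <=
    expR (weight_slope * x j + weight_curvature * x j ^+ 2).
  apply: le_trans (expR_ge1Dx _); rewrite (bigD1 ord0) //=.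
  have -> : ew (x j) 0%N = 1 by rewrite /ew /exp_weight expr0 divr1.
  rewrite lerD2l; apply: le_trans (sum_exp_weight_le d (x01 j)).
  by rewrite le_eqVlt; apply/orP; left; apply/eqP/eq_bigl => m; rewrite lt0n.
have w1 j : (rk i < rk j)%N -> \sum_(m < d.+1) F j m <= 1.
  move=> ij; have ji : j != i by apply: contraTneq ij => ->; rewrite ltnn.
  rewrite (bigD1 ord0) //= big1 ?addr0; last first.
    move=> m m0; rewrite /F (negbTE ji) ij ifF //.
    by apply/negP => /eqP h; case/eqP: m0; apply/val_inj.
  by rewrite /F (negbTE ji) ij /= /ew /exp_weight expr0 divr1.
apply: ler_pM.
- by apply: sumr_ge0.
- by apply: prodr_ge0 => j _; exact: sumr_ge0.
- apply: le_trans (sum_exp_weight_le d (x01 i)); rewrite [leRHS]big_mkcond.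
  by apply: ler_sum => m _; rewrite /F eqxx.
rewrite expR_sum [leLHS](bigID (fun j => (rk j < rk i)%N)) /= -[leRHS]mulr1.
apply: ler_pM.
- by apply: prodr_ge0 => j _; exact: sumr_ge0.
- by apply: prodr_ge0 => j _; exact: sumr_ge0.
- rewrite (eq_bigl (fun j => (rk j < rk i)%N)); last first.
    by move=> j /=; case: eqP => // ->; rewrite ltnn.
  apply: ler_prod => j ji; rewrite sumr_ge0 //=; apply: le_trans (wsum j).
  apply: ler_sum => m _; rewrite /F ifF; last by apply/negP => /eqP h; rewrite h ltnn in ji.
  by rewrite ltnNge (ltnW ji).
apply: prodr_ile1 => j /andP[ji]; rewrite -leqNgt => ij.
rewrite sumr_ge0 //=; apply: w1; rewrite ltn_neqAle ij andbT.
by apply: contra ji => /eqP/rk_inj ->.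
Qed.

End Weights.

(** * The decreasing rearrangement and rankings *)

Section Rearrangement.
Variable R : realType.
Local Notation C := R[i].
Variables (z : linfty R).
Implicit Types J : {fset nat}.

Definition sup_off (J : {fset nat}) : R := sup [set normc (z j) | j in [set j | j \notin J]].

Lemma notin_fset (J : {fset nat}) : exists j, j \notin J.
Proof.
exists (\max_(j <- J) j).+1; apply/negP => h.
have : ((\max_(j <- J) j).+1 <= \max_(j <- J) j)%N.
  by rewrite {2}(big_fsetD1 _ h) /= leq_maxl.
by rewrite ltnn.
Qed.

Lemma sup_off_has_sup J : has_sup [set normc (z j) | j in [set j | j \notin J]].
Proof.
have [j hj] := notin_fset J; split; first by exists (normc (z j)), j.
by have [x zx] := linfty_polydisc z; exists x => _ [i _ <-].
Qed.

Lemma le_sup_off (J : {fset nat}) j : j \notin J -> normc (z j) <= sup_off J.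
Proof. by move=> hj; apply: ub_le_sup; [case: (sup_off_has_sup J)|exists j]. Qed.

Lemma sup_off_le (J : {fset nat}) x : (forall j, j \notin J -> normc (z j) <= x) -> sup_off J <= x.
Proof.
by move=> H; apply: ge_sup; [case: (sup_off_has_sup J)|move=> _ [j hj <-]; exact: H].
Qed.

Lemma sup_off_ge0 J : 0 <= sup_off J.
Proof.
have [j hj] := notin_fset J; apply: le_trans (le_sup_off hj); exact: normc_ge0.
Qed.

Lemma decr_rearr_has_inf n : (0 < n)%N ->
  has_inf [set sup_off J | J in [set J : {fset nat} | (#|` J| < n)%N]].
Proof.
move=> n0; split; first by exists (sup_off fset0), fset0 => //=; rewrite cardfs0.
by exists 0 => _ [J _ <-]; exact: sup_off_ge0.
Qed.

Lemma decr_rearr_le n J : (#|` J| < n)%N -> decr_rearr z n <= sup_off J.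
Proof.
move=> Jn; apply: ge_inf; last by exists J.
by case: (decr_rearr_has_inf (leq_ltn_trans (leq0n _) Jn)).
Qed.

Lemma decr_rearr_ge n y : (0 < n)%N -> (forall J, (#|` J| < n)%N -> y <= sup_off J) ->
  y <= decr_rearr z n.
Proof.
by move=> n0 H; apply: lb_le_inf; [by case: (decr_rearr_has_inf n0)|move=> _ [J Jn <-]; exact: H].
Qed.

Lemma decr_rearr_ge0 n : (0 < n)%N -> 0 <= decr_rearr z n.
Proof. by move=> n0; apply: decr_rearr_ge => // J _; exact: sup_off_ge0. Qed.

Lemma decr_rearr_anti m n : (0 < m)%N -> (m <= n)%N -> decr_rearr z n <= decr_rearr z m.
Proof.
move=> m0 mn; apply: decr_rearr_ge => // J Jm.
by apply: decr_rearr_le; exact: leq_trans mn.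
Qed.

Lemma decr_rearr_bound n x : (0 < n)%N -> polydisc x z -> decr_rearr z n <= x.
Proof.
move=> n0 zx; apply: (@le_trans _ _ (sup_off fset0)).
  by apply: decr_rearr_le; rewrite cardfs0.
by apply: sup_off_le => j _; exact: zx.
Qed.

Lemma decr_rearr_small n x : (0 < n)%N -> decr_rearr z n < x ->
  exists k, forall j, (k <= j)%N -> normc (z j) <= x.
Proof.
move=> n0 zx; have [_ [J Jn <-] /ltW Jx] := inf_lt (decr_rearr_has_inf n0).1 zx.
exists (\max_(j <- J) j).+1 => j hj; apply: le_trans Jx; apply: le_sup_off.
apply/negP => jJ; have : (j <= \max_(j <- J) j)%N by rewrite (big_fsetD1 _ jJ) /= leq_maxl.
by lia.
Qed.

(** [rk j] counts the coordinates that precede [j] in decreasing order, [j] included and ties broken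
    by index. A set with fewer than [rk j] elements misses one of them, which gives the comparison
    with the global rearrangement. *)
Lemma ranking n : exists rk : 'I_n -> nat, [/\ injective rk, forall j, (0 < rk j)%N,
  forall j, (rk j <= n)%N & forall j : 'I_n, normc (z j) <= decr_rearr z (rk j)].
Proof.
pose before (j i : 'I_n) := (normc (z j) < normc (z i)) || ((normc (z i) == normc (z j)) && (i <= j)%N).
pose rk j := #|before j|.
have bb j : before j j by rewrite /before eqxx leqnn orbT.
have trans i j l : before j i -> before i l -> before j l.
  rewrite /before => /orP[h1|/andP[/eqP h1 h2]] /orP[h3|/andP[/eqP h3 h4]].
  - by rewrite (lt_trans h1 h3).
  - by rewrite h3 h1.
  - by rewrite -h1 h3.
  - by rewrite h3 h1 eqxx (leq_trans h4 h2) orbT.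
have total i j : i != j -> before i j && ~~ before j i || before j i && ~~ before i j.
  rewrite /before -val_eqE /= => ij; case: (ltgtP (normc (z i)) (normc (z j))) => //= _.
  by case: ltngtP ij.
have strict i j : before j i -> ~~ before i j -> (rk i < rk j)%N.
  move=> ji nij; apply: proper_card; apply/properP; split.
    by apply/fintype.subsetP => l; rewrite !unfold_in => il; exact: trans ji il.
  by exists j; [exact: bb|exact: nij].
exists rk; split.
- move=> i j E; apply/eqP/negPn/negP => /total.
  by case/orP => /andP[h1 h2]; have := strict _ _ h1 h2; rewrite E ltnn.
- by move=> j; apply/card_gt0P; exists j; exact: bb.
- by move=> j; rewrite -[leqRHS]card_ord max_card.
move=> j; apply: decr_rearr_ge; first by apply/card_gt0P; exists j; exact: bb.
move=> J Jr; have [i ib iJ] : exists2 i : 'I_n, before j i & val i \notin J.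
  apply: contrapT => H; move: Jr; rewrite ltnNge => /negP; apply.
  have sub : ([fset val i | i in finset (before j)] `<=` J)%fset.
    apply/fsubsetP => l /imfsetP[/= i ib ->]; apply/negPn/negP => iJ.
    by apply: H; exists i => //; rewrite inE in ib.
  apply: leq_trans (fsubset_leq_card sub).
  by rewrite card_imfset /=; [rewrite -cardE cardsE|exact: val_inj].
by apply: le_trans (le_sup_off iJ); move: ib => /orP[/ltW //|/andP[/eqP -> _]].
Qed.

End Rearrangement.

Section Growth.
Variable R : realType.

Lemma ler_sum_image (I : finType) (P : pred I) (f : I -> nat) (g : nat -> R) m n :
  injective f -> (forall i, P i -> (m <= f i < n)%N) ->
  (forall i, (m <= i < n)%N -> 0 <= g i) ->
  \sum_(i | P i) g (f i) <= \sum_(m <= i < n) g i.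
Proof.
move=> finj fP g0.
rewrite -big_filter -(big_map f xpredT g).
set s := map f _; have us : uniq s.
  by rewrite map_inj_uniq // filter_uniq // index_enum_uniq.
rewrite [leRHS](bigID (mem s)) /= -[leLHS]addr0; apply: lerD; last first.
  rewrite big_nat_cond; apply: sumr_ge0 => i /andP[h _]; exact: g0.
rewrite -[leRHS]big_filter le_eqVlt; apply/orP; left; apply/eqP/perm_big/uniq_perm => //.
  by rewrite filter_uniq // iota_uniq.
move=> i; rewrite mem_filter /= mem_index_iota andb_idr //.
by move=> /mapP[j]; rewrite mem_filter => /andP[Pj _] ->; exact: fP.
Qed.

Lemma sum_initial_le (C : R) n m : 0 <= C ->
  \sum_(1 <= i < n) (if (i <= m)%N then C else 0) <= C * m%:R.
Proof.
move=> C0; have H k : \sum_(1 <= i < k.+1) (if (i <= m)%N then C else 0) = C * (minn k m)%:R.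
  elim: k => [|k IH]; first by rewrite big_geq // min0n mulr0.
  rewrite big_nat_recr // IH; have [h|h] := leqP k.+1 m.
    by rewrite (minn_idPl (ltnW h)) /= -natr1 mulrDr mulr1.
  by rewrite (minn_idPr (h : (m <= k)%N)) /= addr0.
case: n => [|n]; first by rewrite big_geq // mulr_ge0.
by rewrite H ler_wpM2l // ler_nat geq_minr.
Qed.

Lemma mulr_expRN_le (d t : R) : 0 < d -> 0 <= t -> t * expR (- (d * t)) <= d^-1.
Proof.
move=> d0 t0; rewrite expRN ler_pdivrMr ?expR_gt0 // ler_pdivlMl //.
by apply: le_trans (expR_ge1Dx _); rewrite lerDr.
Qed.

Variables (zs : nat -> R) (X a : R) (N0 : nat).
Hypotheses (X01 : 0 <= X < 1) (a0 : 0 < a).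
Hypothesis zsX : forall n, (0 < n)%N -> 0 <= zs n <= X.
Hypothesis zs_anti : forall m n, (0 < m)%N -> (m <= n)%N -> zs n <= zs m.
Hypothesis zs_sum : forall n, (N0 <= n)%N -> \sum_(1 <= j < n.+1) zs j ^+ 2 <= a * ln n%:R.

Let S n := \sum_(1 <= j < n.+1) zs j ^+ 2.

Lemma mul_le_sum n : n%:R * zs n ^+ 2 <= S n.
Proof.
rewrite mulr_natl -[leLHS](_ : \sum_(1 <= j < n.+1) zs n ^+ 2 = _); last first.
  by rewrite sumr_const_nat subn1.
rewrite /S !big_nat; apply: ler_sum => j /andP[j0 jn].
have /andP[h1 _] := zsX (leq_trans j0 (jn : (j <= n)%N)).
have /andP[h2 _] := zsX j0.
by apply: lerXn2r; rewrite ?nnegrE //; exact: zs_anti.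
Qed.

Lemma ln_sqr_nat m : (0 < m)%N -> ln (m ^ 2)%:R <= 2 * m%:R :> R.
Proof.
move=> m0; have m0' : 0 < m%:R :> R by rewrite ltr0n.
rewrite natrX lnXn // -[leLHS]mulr_natl ler_wpM2l //.
exact/ltW/ln_sublinear.
Qed.

(** Monotonicity gives n zs_n ^ 2 <= a ln n. At squares n = m ^ 2 the crude bound ln (m ^ 2) <= 2 m
    already yields the decay 2 a / m. *)
Lemma zs_small e : 0 < e -> exists n1, forall n, (n1 < n)%N -> zs n ^+ 2 <= e.
Proof.
move=> e0; pose m := maxn N0 (Num.Def.truncn (2 * a / e)).+1.
have m0 : (0 < m)%N by rewrite /m; lia.
have m0' : 0 < m%:R :> R by rewrite ltr0n.
have Nm : (N0 <= m ^ 2)%N by rewrite /m -mulnn; nia.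
exists (m ^ 2)%N => n mn; have m20 : (0 < m ^ 2)%N by rewrite expn_gt0 m0.
have /andP[h1 _] := zsX (leq_ltn_trans (leq0n _) mn); have /andP[h2 _] := zsX m20.
apply: (@le_trans _ _ (zs (m ^ 2) ^+ 2)).
  by apply: lerXn2r; rewrite ?nnegrE //; apply: zs_anti => //; exact: ltnW.
have := le_trans (mul_le_sum (m ^ 2)) (zs_sum Nm).
have := ler_wpM2l (ltW a0) (ln_sqr_nat m0) => h3 h4.
have em : 2 * a <= e * m%:R.
  rewrite [leRHS]mulrC -ler_pdivrMr //; apply: le_trans (_ : (Num.Def.truncn (2 * a / e)).+1%:R <= _).
    have ae0 : 0 <= 2 * a / e by rewrite divr_ge0 ?mulr_ge0 ?(ltW a0) // ltW.
    by case/andP: (truncn_itv ae0) => _ /ltW.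
  by rewrite ler_nat leq_maxr.
have : m%:R * m%:R * zs (m ^ 2) ^+ 2 <= m%:R * (2 * a).
  have -> : m%:R * (2 * a) = a * (2 * m%:R) by ring.
  by have := le_trans h4 h3; rewrite natrX expr2.
rewrite -mulrA ler_pM2l // => h5.
have : m%:R * zs (m ^ 2) ^+ 2 <= m%:R * e by rewrite [leRHS]mulrC; exact: le_trans em.
by rewrite ler_pM2l.
Qed.

(** Put t = ln n. The first factor is O(t exp (- t)) by monotonicity, and the exponential is O(exp
    (th t)) with th < 1, because the quartic terms are negligible against the squares beyond a fixed
    rank. *)
Lemma growth_bound (c C : R) : 0 < c -> a * c < 1 -> 0 <= C ->
  exists B : R, forall n, (0 < n)%N ->
    (c * zs n ^+ 2 + C * (zs n ^+ 2) ^+ 2) *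
    expR (\sum_(1 <= i < n) (c * zs i ^+ 2 + C * (zs i ^+ 2) ^+ 2)) <= B.
Proof.
move=> c0 ac C0; have /andP[X0 X1] := X01.
(* Chosen so that a e C is at most half of the room 1 - a c left by the main term. *)
pose e := (1 - a * c) / (2 * a * (C + 1)).
have aC : 0 < 2 * a * (C + 1) by rewrite !mulr_gt0 // ltr_wpDl.
have e0 : 0 < e by rewrite divr_gt0 // subr_gt0.
have [n1 Hn1] := zs_small e0.
pose th := a * (c + e * C).
have th1 : th < 1.
  have : a * (e * C) <= (1 - a * c) / 2.
    have -> : a * (e * C) = (1 - a * c) / 2 * (C / (C + 1)).
      by rewrite /e; field; rewrite !gt_eqF // ltr_wpDl.
    by rewrite ler_piMr ?divr_ge0 ?subr_ge0 ?(ltW ac) // ler_pdivrMr ?ltr_wpDl // mul1r lerDl.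
  by rewrite /th mulrDr; lra.
have th0 : 0 <= th.
  by rewrite /th mulr_ge0 ?(ltW a0) // addr_ge0 ?(ltW c0) // mulr_ge0 // ltW.
have zs01 n : (0 < n)%N -> 0 <= zs n ^+ 2 <= 1.
  move=> /zsX/andP[h1 h2]; rewrite sqr_ge0 /=; apply: exprn_ile1 => //; lra.
pose F n := c * zs n ^+ 2 + C * (zs n ^+ 2) ^+ 2.
have F0 n : 0 <= F n by rewrite /F addr_ge0 // mulr_ge0 ?sqr_ge0 ?(ltW c0).
have Fle n : (0 < n)%N -> F n <= (c + C) * zs n ^+ 2.
  move=> /zs01/andP[h1 h2]; rewrite /F mulrDl lerD2l ler_wpM2l // expr2.
  by rewrite ler_piMr.
pose B1 := (c + C) * expR ((c + C) * N0%:R).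
pose B2 := (c + C) * a * expR (C * n1%:R) / (1 - th).
have cC0 : 0 <= c + C by rewrite addr_ge0 ?(ltW c0).
have B10 : 0 <= B1 by rewrite /B1 mulr_ge0 ?expR_ge0.
have B20 : 0 <= B2.
  by rewrite /B2 divr_ge0 ?subr_ge0 ?(ltW th1) // mulr_ge0 ?expR_ge0 // mulr_ge0 ?(ltW a0).
exists (B1 + B2) => n n0; rewrite -/(F n).
have [nN|Nn] := ltnP n N0.
  apply: (@le_trans _ _ B1); last by rewrite lerDl.
  apply: ler_pM; rewrite ?expR_ge0 //.
    by apply: le_trans (Fle n n0) _; rewrite ler_piMr //; case/andP: (zs01 n n0).
  rewrite ler_expR; apply: (@le_trans _ _ (\sum_(1 <= i < n) (c + C))).
    rewrite !big_nat; apply: ler_sum => i /andP[i0 _]; apply: le_trans (Fle i i0) _.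
    by rewrite ler_piMr //; case/andP: (zs01 i i0).
  by rewrite sumr_const_nat -[leLHS]mulr_natr ler_wpM2l // ler_nat (leq_trans (leq_subr _ _) (ltnW nN)).
apply: (@le_trans _ _ B2); last by rewrite lerDr.
pose t := ln n%:R : R.
have t0 : 0 <= t by rewrite ln_ge0 // ler1n.
have nE : n%:R = expR t :> R by rewrite lnK // posrE ltr0n.
have Sn : S n <= a * t by exact: zs_sum.
have un : zs n ^+ 2 <= a * (t * expR (- t)).
  have := le_trans (mul_le_sum n) Sn; rewrite nE expRN => h.
  by rewrite mulrA ler_pdivlMr ?expR_gt0 // mulrC.
have sum_le : \sum_(1 <= i < n) F i <= th * t + C * n1%:R.
  apply: (@le_trans _ _ (\sum_(1 <= i < n) (c + e * C) * zs i ^+ 2 +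
      \sum_(1 <= i < n) if (i <= n1)%N then C else 0)).
    rewrite -big_split !big_nat; apply: ler_sum => i /andP[i0 _] /=.
    have /andP[h1 h2] := zs01 i i0; rewrite /F mulrDl -addrA lerD2l.
    case: leqP => [_|/Hn1 h3].
      have : 0 <= e * C * zs i ^+ 2 by rewrite mulr_ge0 // mulr_ge0 // ltW.
      have : C * (zs i ^+ 2) ^+ 2 <= C by rewrite ler_piMr // exprn_ile1.
      lra.
    rewrite addr0 expr2 mulrA ler_wpM2r // mulrC ler_wpM2r //.
  apply: lerD.
    have ecC : 0 <= c + e * C by rewrite addr_ge0 ?(ltW c0) // mulr_ge0 // ltW.
    rewrite -mulr_sumr [th * t](_ : _ = (c + e * C) * (a * t)); last by rewrite /th; ring.
    rewrite ler_wpM2l //.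
    by apply: le_trans Sn; rewrite /S big_nat_recr //= lerDl sqr_ge0.
  exact: sum_initial_le.
apply: (@le_trans _ _ ((c + C) * (a * (t * expR (- t))) * expR (th * t + C * n1%:R))).
  apply: ler_pM; rewrite ?expR_ge0 ?ler_expR //.
  by apply: le_trans (Fle n n0) _; rewrite ler_wpM2l.
have -> : (c + C) * (a * (t * expR (- t))) * expR (th * t + C * n1%:R) =
    (c + C) * a * expR (C * n1%:R) * (t * expR (- ((1 - th) * t))).
  rewrite expRD (_ : - ((1 - th) * t) = - t + th * t); last by ring.
  by rewrite expRD; ring.
rewrite /B2; apply: ler_wpM2l; first by rewrite !mulr_ge0 ?expR_ge0 // ltW.
by apply: mulr_expRN_le; rewrite // subr_gt0.
Qed.

End Growth.

(** * A sufficient condition for monomial convergence *)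

Section LimSup.
Variable R : realType.
Implicit Types u : nat -> R.

Lemma limn_esup_lt u (x : R) : (limn_esup (fun n => (u n)%:E) < x%:E)%E ->
  exists2 a, a < x & exists N, forall n, (N <= n)%N -> u n <= a.
Proof.
move=> /ereal_inf_lt[_ [V [N _ NV] <-] Vx].
have uV n : (N <= n)%N -> ((u n)%:E <= ereal_sup [set (u m)%:E | m in V])%E.
  by move=> Nn; apply: ereal_sup_ubound; exists n => //; exact: NV.
move: Vx uV; case: ereal_sup => [a ax H|//|_ H]; last by have := H N (leqnn N).
by exists a => //; exists N => n /H.
Qed.

Lemma limn_esup_le u (x : R) :
  (forall b : R, x < b -> exists N, forall n, (N <= n)%N -> u n <= b) ->
  (limn_esup (fun n => (u n)%:E) <= x%:E)%E.
Proof.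
move=> H; apply/lee_addgt0Pr => e e0.
have [|N HN] := H (x + e); first by rewrite ltrDl.
apply: (@le_trans _ _ (ereal_sup [set (u n)%:E | n in [set n | (N <= n)%N]])).
  by apply: ereal_inf_lbound; exists [set n | (N <= n)%N] => //; exists N.
by apply: ge_ereal_sup => _ [n Nn <-]; rewrite -EFinD lee_fin; exact: HN.
Qed.

End LimSup.

Section WeightedCoefficients.
Variable R : realType.
Local Notation C := R[i].

(* [a c < 1] in [growth_bound] reads [2 a < (1 - eta) r ^ 2], so that [r] and
   [eta] can be chosen since [2 a < 1]. *)
Lemma top_support_bound (zs : nat -> R) (X a : R) N0 : 0 <= X < 1 -> 0 < a -> 2 * a < 1 ->
  (forall n, (0 < n)%N -> 0 <= zs n <= X) ->
  (forall m n, (0 < m)%N -> (m <= n)%N -> zs n <= zs m) ->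
  (forall n, (N0 <= n)%N -> \sum_(1 <= j < n.+1) zs j ^+ 2 <= a * ln n%:R) ->
  exists r B : R, exists k : nat -> R,
  [/\ 0 < r < 1, 0 <= B, weights k, forall m, 0 < k m &
   forall n d (rk : 'I_n -> nat) (s : 'I_n -> R) i, injective rk ->
     (forall j, (0 < rk j)%N) -> (forall j, 0 <= s j <= zs (rk j)) ->
     \sum_(b : {ffun 'I_n -> 'I_d.+1} | top_support rk i b)
       \prod_j exp_weight k (s j ^+ 2 / r ^+ 2) (b j) <= B ^+ 2].
Proof.
move=> X01 a0 a1 zsX zs_anti zs_sum; have /andP[X0 X1] := X01.
have [g [g1 ag Xg g0]] : exists g, [/\ g < 1, 2 * a <= g, X ^+ 2 <= g & 0 <= g].
  exists (Num.max (2 * a) (X ^+ 2)); rewrite gt_max !le_max !lexx orbT sqr_ge0 !orbT.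
  by rewrite exprn_ilt1 // andbT; split=> //; lra.
(* A single parameter serves as eta = t and r = 1 - t, so that (1 - eta) r ^ 2 = r ^ 3, which
   exceeds 1 - 3 t > g >= 2 a. *)
pose t := (1 - g) / 4; pose r := 1 - t.
have t01 : 0 < t < 1 by apply/andP; rewrite /t; split; lra.
have r01 : 0 < r < 1 by apply/andP; rewrite /r; have /andP[] := t01; split; lra.
have /andP[r0 r1] := r01; have r20 : 0 < r ^+ 2 by rewrite exprn_gt0.
have r3g : g < r ^+ 3.
  have /andP[t0 t1] := t01; apply: (@lt_le_trans _ _ (1 - 3 * t)); first by rewrite /t; lra.
  rewrite /r -subr_ge0 (_ : _ - _ = t ^+ 2 * (3 - t)); last by ring.
  by rewrite mulr_ge0 ?sqr_ge0 //; lra.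
(* [x1] bounds the rescaled squares s_j ^ 2 / r ^ 2; [q] is placed midway between it and 1. *)
pose x1 := X ^+ 2 / r ^+ 2; pose q := (1 + x1) / 2.
have x10 : 0 <= x1 by rewrite /x1 divr_ge0 ?sqr_ge0.
have x11 : x1 < 1.
  rewrite /x1 ltr_pdivrMr // mul1r; apply: le_lt_trans Xg _; apply: lt_le_trans r3g _.
  by rewrite exprS ler_piMl ?(ltW r20) ?(ltW r1).
have q1 : q < 1 by rewrite /q; lra.
have x1q : 0 <= x1 < q by rewrite x10 /q; lra.
pose c := weight_slope t / r ^+ 2; pose D := weight_curvature t q x1 / (r ^+ 2) ^+ 2.
have D0 : 0 <= D by rewrite divr_ge0 ?sqr_ge0 // weight_curvature_ge0.
have c0 : 0 < c by rewrite /c /weight_slope -/r !divr_gt0.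
have ac : a * c < 1.
  rewrite /c /weight_slope -/r.
  have -> : a * (2 / r / r ^+ 2) = 2 * a / r ^+ 3 by field; rewrite gt_eqF.
  by rewrite ltr_pdivrMr ?exprn_gt0 // mul1r; exact: le_lt_trans r3g.
have [B HB] := growth_bound X01 a0 zsX zs_anti zs_sum c0 ac D0.
exists r, (Num.sqrt (Num.max B 0)), (mixed_weight t q); split=> //.
- exact: mixed_weightsP x1q.
- by move=> m; exact: mixed_weight_gt0 x1q m.
move=> n d rk s i rk_inj rk0 sz.
have szX j : 0 <= s j <= X.
  by have /andP[-> h] := sz j; apply: le_trans h _; case/andP: (zsX _ (rk0 j)).
apply: (le_trans (@top_support_sum _ _ _ _ t01 q1 x1q _ d rk (fun j => s j ^+ 2 / r ^+ 2) i rk_inj _)).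
  move=> j; have /andP[h1 h2] := szX j; rewrite divr_ge0 ?sqr_ge0 //=.
  by rewrite ler_pM2r ?invr_gt0 //; apply: lerXn2r; rewrite ?nnegrE.
rewrite sqr_sqrtr; last by rewrite le_max lexx orbT.
rewrite le_max; apply/orP; left; apply: le_trans (HB (rk i) (rk0 i)).
pose F (x : R) := c * x ^+ 2 + D * (x ^+ 2) ^+ 2.
have FE x : weight_slope t * (x ^+ 2 / r ^+ 2) + weight_curvature t q x1 * (x ^+ 2 / r ^+ 2) ^+ 2 = F x.
  by rewrite /F /c /D; field; rewrite gt_eqF.
have F0 x : 0 <= F x by rewrite addr_ge0 // mulr_ge0 ?sqr_ge0 ?(ltW c0).
have Fle j : F (s j) <= F (zs (rk j)).
  have /andP[h1 h2] := sz j; have h3 := le_trans h1 h2.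
  have h4 : s j ^+ 2 <= zs (rk j) ^+ 2 by apply: lerXn2r; rewrite ?nnegrE.
  apply: lerD; first by rewrite ler_wpM2l // ltW.
  by rewrite ler_wpM2l //; apply: lerXn2r; rewrite ?nnegrE ?sqr_ge0.
rewrite FE -/(F (zs (rk i))).
apply: ler_pM; rewrite ?expR_ge0 // ?Fle // ler_expR.
rewrite (eq_bigr _ (fun j _ => FE (s j))).
apply: (@le_trans _ _ (\sum_(j | (rk j < rk i)%N) F (zs (rk j)))).
  by apply: ler_sum => j _; exact: Fle.
apply: (@ler_sum_image _ _ _ rk (fun m => F (zs m))) => // j h.
by rewrite rk0.
Qed.

(** A box truncation of [f] dilated by x < 1 is a polynomial bounded by M + 1 as soon as the
    truncation error is at most 1, so [coefficient_sum_bound] applies with constants independent of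
    [A] and of the number of variables. *)
Lemma bounded_coefs (f : linfty R -> C) c (M r B : R) (k : nat -> R) (z : linfty R) :
  0 <= M -> Hinfty f -> (forall z, Dinfty z -> normc (f z) <= M) ->
  (forall k x, 0 <= x < 1 -> exists K : R, 0 <= K /\ forall N (z : linfty R),
     polydisc x z -> first_coords k z ->
     normc (f z - \sum_(al <- box k N) c al * monomial z al) <= K * x ^+ N) ->
  0 < r < 1 -> 0 <= B -> weights k -> (forall m, 0 < k m) ->
  (forall n d (rk : 'I_n -> nat) (s : 'I_n -> R) i, injective rk ->
     (forall j, (0 < rk j)%N) -> (forall j, 0 <= s j <= decr_rearr z (rk j)) ->
     \sum_(b : {ffun 'I_n -> 'I_d.+1} | top_support rk i b)
       \prod_j exp_weight k (s j ^+ 2 / r ^+ 2) (b j) <= B ^+ 2) ->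
  bounded_sums (fun al => c al * monomial z al).
Proof.
move=> M0 Hf fM Hbox r01 B0 kw k0 HB.
exists (M + 1 + 2 * B * ((M + 1) * (r / (1 - r)))) => A.
pose n := mis_size A; have [rk [rk_inj rk0 _ rkz]] := ranking z n.
(* The indices in [A] have at most [n] nonzero exponents, all smaller than [n]: the dilation costs
   at most a factor x ^ (n n), removed by x -> 1. *)
apply: (@le_of_expr _ _ _ (n * n)); first by apply: sumr_ge0 => al _; exact: normc_ge0.
move=> x /andP[x0 x1]; have x01 : 0 <= x < 1 by rewrite ltW.
have [K [K0 HK]] := Hbox n x x01.
have [d [nd Kd]] : exists d, (n <= d)%N /\ K * x ^+ d.+1 <= 1.
  have e0 : 0 < (K + 1)^-1 by rewrite invr_gt0 ltr_wpDl.
  have [N HN] := expr_small x01 e0; exists (maxn n N); split; first exact: leq_maxl.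
  apply: (@le_trans _ _ ((K + 1) * x ^+ (maxn n N).+1)).
    by rewrite ler_wpM2r ?exprn_ge0 ?(ltW x0) // lerDl.
  by rewrite mulrC -ler_pdivlMr ?ltr_wpDl // mul1r HN //; lia.
pose deg (al : multi_index) := (\sum_(j < n) al j)%N.
pose b (a : {ffun 'I_n -> 'I_d.+1}) := c (mi (seq_of a)) * (x ^+ deg (mi (seq_of a)))%:C.
have bM y : (forall j, normc (y j) <= 1) -> normc (mpoly_at b y) <= M + 1.
  move=> y1; pose w := const_vec (fun j => x%:C * y j).
  have wx j : normc (x%:C * y j) <= x.
    by rewrite Normc.normcM normcR ger0_norm ?(ltW x0) // ler_piMr ?(ltW x0).
  have [w1 w2 _] := const_vecE (ltW x0) wx.
  have -> : mpoly_at b y = \sum_(al <- box n d.+1) c al * monomial w al.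
    rewrite big_box; apply: eq_bigr => a _; rewrite /b -mulrA; congr (_ * _).
    rewrite (monomial_const_vec (ltW x0) wx); last first.
      by move=> j nj; rewrite miE nth_default // size_seq_of.
    rewrite /deg -prodrXr rmorph_prod /= -big_split /=; apply: eq_bigr => j _.
    by rewrite !miE !nth_seq_of exprMn rmorphXn.
  have wD : Dinfty w by apply/DinftyP; exists x.
  have := HK d.+1 w w1 w2; set S := \sum_(al <- _) _ => h.
  have -> : S = f w - (f w - S) by rewrite opprB addrC subrK.
  by apply: le_trans (ler_normcB _ _) _; apply: lerD (fM w wD) (le_trans h Kd).
pose s (j : 'I_n) := normc (z j).
have s0 j : 0 <= s j by exact: normc_ge0.
have sz j : 0 <= s j <= decr_rearr z (rk j) by rewrite s0 rkz.
have := coefficient_sum_bound bM r01 kw k0 s0 B0 (fun i => HB n d rk s i rk_inj rk0 sz).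
apply: le_trans.
pose F al := normc (c al) * x ^+ deg al * normc (monomial z al).
have F0 al : 0 <= F al by rewrite !mulr_ge0 ?normc_ge0 // exprn_ge0 // ltW.
apply: (@le_trans _ _ (\sum_(al <- box n d.+1) F al)); last first.
  rewrite big_box le_eqVlt; apply/orP; left; apply/eqP; apply: eq_bigr => a _.
  rewrite /F /b Normc.normcM normcR ger0_norm ?exprn_ge0 ?(ltW x0) //; congr (_ * _).
  rewrite (@monomialE _ _ _ n) => [|j nj]; last by rewrite miE nth_default // size_seq_of.
  by rewrite normc_prod; apply: eq_bigr => j _; rewrite normcX miE nth_seq_of.
apply: (@le_trans _ _ (\sum_(al <- A) F al)); last first.
  apply: ler_sum_fset => //; apply/fsubsetP => al /mis_sizeP aln.
  by apply: mi_size_box; [exact: mi_size_first|exact: leq_trans aln (leqW nd)].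
rewrite mulr_suml [leLHS]big_seq_cond [leRHS]big_seq_cond.
apply: ler_sum => al; rewrite andbT => /mis_sizeP aln.
rewrite Normc.normcM /F mulrAC ler_wpM2r ?normc_ge0 // ler_wpM2l ?normc_ge0 //.
rewrite ler_wiXn2l ?(ltW x0) ?(ltW x1) // /deg.
apply: (@leq_trans (\sum_(j < n) n)); last by rewrite sum_nat_const card_ord.
by apply: leq_sum => j _; have [h _] := mi_sizeP al j; exact: leq_trans (ltnW h) aln.
Qed.

End WeightedCoefficients.

Section Sufficiency.
Variable R : realType.
Local Notation C := R[i].

Lemma differentiable_near (f : linfty R -> C) (z : linfty R) (e : R) :
  differentiable f z -> 0 < e ->
  exists2 d : R, 0 < d & forall w : linfty R,
    (forall j, normc (w j - z j) <= d) -> normc (f w - f z) <= e.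
Proof.
move=> /differentiable_continuous /cvgrPdist_le/(_ e%:C).
rewrite ltcR => cf e0; have /nbhs_ballP[d /= d0 Hd] := cf e0.
have [dR dE] : exists r, d = r%:C by exists (complex.Re d); rewrite RRe_real ?gtr0_real.
move: d0 Hd; rewrite dE ltcR => d0 Hd.
have d2 : 0 < dR / 2 by rewrite divr_gt0.
exists (dR / 2) => // w wz.
have : ball z dR%:C w.
  rewrite -ball_normE /ball_ /= distrC.
  have h : `|w - z| <= (dR / 2)%:C by apply: linfty_norm_le => //; exact: ltW.
  have h3 : (dR / 2)%:C < dR%:C by rewrite ltcR ltr_pdivrMr // ltr_pMr // ltr1n.
  exact: (le_lt_trans h h3).
by move=> /Hd; rewrite /= normr_normc lecR normcB.
Qed.

(** Once the family is absolutely summable, it is enough to approach [f z] by sums over arbitrarily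
    large boxes. A box sum at [z] is also one at the truncation [w] of [z], where it is close to
    [f w]; and [w] is close to [z] in norm. *)
Lemma mon_of_limsup (z : linfty R) : Dinfty z ->
  (limn_esup (fun n : nat =>
      ((ln n%:R)^-1 * \sum_(1 <= j < n.+1) decr_rearr z j ^+ 2)%:E)
    < (2^-1)%:E)%E -> mon_Hinfty z.
Proof.
move=> zD /limn_esup_lt[a' a'1 [N HN]]; split=> // f Hf.
have /DinftyP[X X01 zX] := zD; have /andP[X0 X1] := X01.
(* The maximum with 1/4 makes [a] positive and keeps it below 1/2; from rank 2 on the logarithm is
   positive and can be multiplied out. *)
pose a := Num.max a' 4^-1; pose N0 := maxn N 2.
have a0 : 0 < a by rewrite /a lt_max; apply/orP; right; lra.
have a1 : 2 * a < 1.
  suff : a < 2^-1 by lra.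
  by rewrite /a gt_max a'1 /=; lra.
have zs_sum n : (N0 <= n)%N -> \sum_(1 <= j < n.+1) decr_rearr z j ^+ 2 <= a * ln n%:R.
  rewrite geq_max => /andP[/HN h n2].
  have ln0 : 0 < ln n%:R :> R by rewrite ln_gt0 // ltr1n.
  rewrite -ler_pdivrMr // mulrC; apply: le_trans h _.
  by rewrite /a le_max lexx.
have zsX n : (0 < n)%N -> 0 <= decr_rearr z n <= X.
  by move=> n0; rewrite decr_rearr_ge0 // decr_rearr_bound.
have zs_anti m n : (0 < m)%N -> (m <= n)%N -> decr_rearr z n <= decr_rearr z m.
  exact: decr_rearr_anti.
have [r [B [k [r01 B0 kw k0 HB]]]] := top_support_bound X01 a0 a1 zsX zs_anti zs_sum.
have [M M0 fM] : exists2 M : R, 0 <= M & forall z, Dinfty z -> normc (f z) <= M.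
  have FF : ProperFilter (globally (@Dinfty R)) by exact: (globally_properfilter zD).
  have [_ /(@ex_bound _ _ _ _ _ FF)[M HM]] := Hf.
  have HM' w : Dinfty w -> normc (f w) <= complex.Re M.
    by move=> /HM /=; rewrite normr_normc lecE => /andP[].
  by exists (complex.Re M) => //; apply: le_trans (HM' z zD); exact: normc_ge0.
have [c [cM cf Hbox]] := monomial_expansion Hf fM.
rewrite (monomial_coefE cf); apply/abs_sumP; split.
  by apply: (bounded_coefs M0 Hf fM Hbox r01 B0 kw k0).
move=> e A e0; have e2 : 0 < e / 2 by rewrite divr_gt0.
have [d d0 Hd] := differentiable_near (Hf.1 z zD) e2.
have [k1 zk1] : exists k1, forall j, (k1 <= j)%N -> normc (z j) <= d.
  have [|n1 Hn1] := @zs_small _ _ X a N0 X01 a0 zsX zs_anti zs_sum ((d / 2) ^+ 2).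
    by rewrite exprn_gt0 // divr_gt0.
  apply: (@decr_rearr_small _ _ n1.+1) => //; apply: (@le_lt_trans _ _ (d / 2)); last by lra.
  have := Hn1 _ (leqnn n1.+1).
  by rewrite ler_pXn2r // ?nnegrE ?decr_rearr_ge0 // ltW // divr_gt0.
pose l := maxn k1 (mis_size A).
pose w := mkl (fun j => if (j < l)%N then z j else 0).
have wg : polydisc X (fun j => if (j < l)%N then z j else 0 : C).
  by move=> j; case: ifP => _ //; rewrite Normc.normc0.
have wE := mklE wg; rewrite -/w in wE.
have wX : polydisc X w by rewrite wE.
have wl : first_coords l w by move=> j lj; rewrite wE ltnNge lj.
have [K [K0 HK]] := Hbox l X X01.
have [L [AL KL]] : exists L, (mis_size A <= L)%N /\ K * X ^+ L <= e / 2.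
  have h : 0 < (e / 2) / (K + 1) by rewrite divr_gt0 // ltr_wpDl.
  have [L0 HL] := expr_small X01 h; exists (maxn L0 (mis_size A)); split; first exact: leq_maxr.
  apply: (@le_trans _ _ ((K + 1) * X ^+ maxn L0 (mis_size A))).
    by rewrite ler_wpM2r ?exprn_ge0 // lerDl.
  by rewrite mulrC -ler_pdivlMr ?ltr_wpDl // HL // leq_maxl.
exists (box l L).
  apply/fsubsetP => al /mis_sizeP aA; apply: mi_size_box; last exact: leq_trans AL.
  by apply: mi_size_first; apply: leq_trans aA _; exact: leq_maxr.
have -> : \sum_(al <- box l L) c al * monomial z al = \sum_(al <- box l L) c al * monomial w al.
  rewrite big_seq_cond [RHS]big_seq_cond; apply: eq_bigr => al.
  rewrite andbT => /boxP[all _]; rewrite !(monomialE _ all); congr (_ * _).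
  by apply: eq_bigr => j _; rewrite wE ltn_ord.
have := HK L w wX wl; set S := \sum_(al <- _) _ => h.
have wz j : normc (w j - z j) <= d.
  rewrite wE.
  case: ltnP => lj; first by rewrite subrr Normc.normc0 ltW.
  by rewrite sub0r normcN zk1 // (leq_trans _ lj) // leq_maxl.
have -> : S - f z = (S - f w) + (f w - f z) by rewrite addrA subrK.
apply: le_trans (le_normcD _ _) _; rewrite [e]splitr; apply: lerD; last exact: Hd.
by rewrite normcB; exact: le_trans KL.
Qed.

End Sufficiency.

(** * Random polynomials *)

Section LargeCoordinates.
Variable R : realType.
Local Notation C := R[i].

(** The infima and suprema in the rearrangement need not be attained. Coordinates are picked one by
    one with error [e], which costs at most 2 e on a square since all moduli are at most 1. *)
Lemma large_coordinates (z : linfty R) (e : R) n : polydisc 1 z -> 0 < e <= 1 ->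
  exists s : seq nat, [/\ uniq s, size s = n &
    \sum_(1 <= j < n.+1) decr_rearr z j ^+ 2 - 2 * e * n%:R <=
    \sum_(j <- s) normc (z j) ^+ 2].
Proof.
move=> z1 /andP[e0 e1]; elim: n => [|n [s [us ss Hs]]].
  by exists [::]; rewrite big_geq // big_nil mulr0 subr0.
pose J := seq_fset tt s.
have sJ : (#|` J| < n.+1)%N.
  by rewrite /J size_seq_fset ltnS -ss size_undup.
have hJ := decr_rearr_le z sJ.
have [j jJ hj] : exists2 j, j \notin J & decr_rearr z n.+1 - e < normc (z j).
  have [k kJ] := notin_fset J; have [_ [j /= jJ <-] hj] : exists2 y,
      [set normc (z j) | j in [set j | j \notin J]] y & sup_off z J - e < y.
    apply: sup_adherent => //; split; first by exists (normc (z k)), k.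
    by exists 1 => _ [j _ <-]; exact: z1.
  by exists j => //; apply: le_lt_trans hj; rewrite lerD2r.
exists (rcons s j); split.
- by rewrite rcons_uniq us andbT; move: jJ; rewrite /J seq_fsetE.
- by rewrite size_rcons ss.
rewrite -cats1 big_cat big_seq1 big_nat_recr //= -natr1.
have d0 : 0 <= decr_rearr z n.+1 by exact: decr_rearr_ge0.
have d1 : decr_rearr z n.+1 <= 1 by exact: decr_rearr_bound.
have zj0 : 0 <= normc (z j) by exact: normc_ge0.
suff : decr_rearr z n.+1 ^+ 2 - 2 * e <= normc (z j) ^+ 2 by lra.
set d := decr_rearr z n.+1 in hj d0 d1 *; set y := normc (z j) in hj zj0 *.
have [de|ed] := leP d e; last by nra.
apply: (@le_trans _ _ 0); last exact: sqr_ge0.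
by rewrite subr_le0 expr2; nra.
Qed.

End LargeCoordinates.

Section Signs.
Variable R : realType.

(** The sharp exponent is x ^ 2 / 2, but a constant is immaterial here. For small x the bounds 1 /
    (1 - x) and 1 / (1 + x) suffice; otherwise |x| <= 2 x ^ 2. *)
Lemma cosh_le (x : R) : expR x + expR (- x) <= 2 * expR (2 * x ^+ 2).
Proof.
have [x2|x2] := leP (x ^+ 2) 2^-1.
  have x1 : -1 < x < 1 by apply/andP; split; nra.
  have /andP[x1a x1b] := x1.
  have hp : expR x <= (1 - x)^-1.
    rewrite -[x]opprK expRN opprK lef_pV2 ?posrE ?expR_gt0 //; last by rewrite subr_gt0.
    exact: expR_ge1Dx.
  have hm : expR (- x) <= (1 + x)^-1.
    by rewrite expRN lef_pV2 ?posrE ?expR_gt0 //; [exact: expR_ge1Dx|lra].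
  apply: (@le_trans _ _ (2 * (1 - x ^+ 2)^-1)).
    apply: le_trans (lerD hp hm) _; rewrite le_eqVlt; apply/orP; left; apply/eqP.
    by field; apply/and3P; split; rewrite gt_eqF //; nra.
  rewrite ler_pM2l // -div1r ler_pdivrMr; last by nra.
  have := expR_ge1Dx (2 * x ^+ 2); set E := expR _ => h.
  have : (1 + 2 * x ^+ 2) * (1 - x ^+ 2) <= E * (1 - x ^+ 2).
    by rewrite ler_wpM2r // subr_ge0; lra.
  by have := sqr_ge0 x; nra.
rewrite mulrDl mul1r; apply: lerD; rewrite ler_expR; nra.
Qed.

(* Some choice of signs does not exceed the average of the sum over [j] of the
   exponential moments [expR (+- l X_j)]. *)
Lemma signs_exist (I J : finType) (v : J -> I -> R) (V L : R) :
  0 < V -> 0 < L -> (2 * #|J|)%:R <= expR L ->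
  (forall j, \sum_i v j i ^+ 2 <= V) ->
  exists e : {ffun I -> bool},
    forall j, `|\sum_i (-1) ^+ (e i) * v j i| <= 3 * Num.sqrt (L * V).
Proof.
(* With l ^ 2 V = L each mean moment is at most exp (2 L), and the number of moments, at most exp L,
   brings the total to exp (3 L); hence the bound 3 L / l. *)
move=> V0 L0 JL vV; pose l := Num.sqrt (L / V).
have l0 : 0 < l by rewrite sqrtr_gt0 divr_gt0.
have l2 : l ^+ 2 = L / V by rewrite sqr_sqrtr // divr_ge0 // ltW.
pose X (e : {ffun I -> bool}) j := \sum_i (-1) ^+ (e i) * v j i.
pose Phi e := \sum_j (expR (l * X e j) + expR (- (l * X e j))).
have mean u j : u ^+ 2 = l ^+ 2 ->
    \sum_(e : {ffun I -> bool}) expR (u * X e j) <= 2 ^+ #|I| * expR (2 * L).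
  move=> u2; rewrite (eq_bigr (fun e : {ffun I -> bool} =>
     \prod_i expR (u * ((-1) ^+ (e i) * v j i)))); last first.
    by move=> e _; rewrite mulr_sumr expR_sum.
  rewrite -(bigA_distr_bigA (fun i (b : bool) => expR (u * ((-1) ^+ b * v j i)))) /=.
  apply: (@le_trans _ _ (\prod_i (2 * expR (2 * (u * v j i) ^+ 2)))).
    apply: ler_prod => i _; rewrite big_bool /= expr1 expr0 mul1r mulN1r mulrN addrC cosh_le andbT.
    by rewrite addr_ge0 ?expR_ge0.
  rewrite big_split /= prodr_const ler_wpM2l ?exprn_ge0 // -expR_sum ler_expR.
  rewrite (eq_bigr (fun i => 2 * l ^+ 2 * v j i ^+ 2)); last first.
    by move=> i _; rewrite exprMn u2 mulrA.
  rewrite -mulr_sumr -mulrA ler_wpM2l // l2 -ler_pdivlMl; last by rewrite divr_gt0.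
  apply: le_trans (vV j) _; rewrite invf_div divfK //; last by rewrite gt_eqF.
have total : \sum_(e : {ffun I -> bool}) Phi e <= 2 ^+ #|I| * ((2 * #|J|)%:R * expR (2 * L)).
  rewrite exchange_big /=.
  apply: (@le_trans _ _ (\sum_(j : J) (2 * (2 ^+ #|I| * expR (2 * L))))).
    apply: ler_sum => j _; rewrite big_split /= mulrDl mul1r; apply: lerD; first exact: mean.
    under eq_bigr do rewrite -mulNr; apply: mean; exact: sqrrN.
  rewrite sumr_const -mulr_natl natrM le_eqVlt; apply/orP; left; apply/eqP; ring.
have [e He] : exists e, Phi e <= expR (3 * L).
  apply: contrapT => H; have {}H e : expR (3 * L) < Phi e.
    by rewrite ltNge; apply/negP => h; apply: H; exists e.
  have : \sum_(e : {ffun I -> bool}) expR (3 * L) < \sum_(e : {ffun I -> bool}) Phi e.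
    apply: ltr_sum => //; apply/hasP; exists [ffun=> false] => //; exact: mem_index_enum.
  rewrite sumr_const card_ffun card_bool -[X in X < _]mulr_natl natrX => h.
  have := lt_le_trans h total; rewrite ltr_pM2l ?exprn_gt0 //.
  rewrite (_ : 3 * L = L + 2 * L); last by ring.
  by rewrite expRD ltr_pM2r ?expR_gt0 // ltNge JL.
exists e => j; rewrite -/(X e j).
have h : expR (l * `|X e j|) <= expR (3 * L).
  apply: le_trans He; rewrite /Phi (bigD1 j) //= -[leLHS]addr0; apply: lerD.
    have [h|h] := leP 0 (X e j); first by rewrite ger0_norm // lerDl expR_ge0.
    by rewrite ltr0_norm // mulrN lerDr expR_ge0.
  by apply: sumr_ge0 => i _; rewrite addr_ge0 ?expR_ge0.
move: h; rewrite ler_expR -ler_pdivlMl // => h; apply: le_trans h _.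
rewrite mulrCA ler_wpM2l // ler_pdivrMl // -[leRHS]sqrtrM ?divr_ge0 ?(ltW L0) ?(ltW V0) //.
rewrite (_ : L / V * (L * V) = L ^+ 2); last by field; rewrite gt_eqF.
by rewrite sqrtr_sqr ger0_norm ?(ltW L0).
Qed.

End Signs.

Section RandomPolynomials.
Variable R : realType.
Local Notation C := R[i].

Lemma mpoly_at_recl n d (b : {ffun 'I_n.+1 -> 'I_d} -> C) (x : 'I_n.+1 -> C) :
  mpoly_at b x = \sum_(m < d) x ord0 ^+ m *
    mpoly_at (fun g => b (fcons m g)) (fun j => x (lift ord0 j)).
Proof.
rewrite /mpoly_at big_ffun_recl; apply: eq_bigr => m _; rewrite mulr_sumr.
apply: eq_bigr => g _; rewrite big_ord_recl fcons0 mulrCA; congr (_ * (_ * _)).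
by apply: eq_bigr => j _; rewrite fconsS.
Qed.

(** One coordinate is changed at a time. In that coordinate the degree is at most 2 and the
    coefficients are at most [M], so the increment is at most |u - v| (M + 2 M). *)
Lemma mpoly_lipschitz n (b : {ffun 'I_n -> 'I_3} -> C) (M : R) (x y : 'I_n -> C) :
  (forall y : 'I_n -> C, (forall j, normc (y j) <= 1) -> normc (mpoly_at b y) <= M) ->
  (forall j, normc (x j) <= 1) -> (forall j, normc (y j) <= 1) ->
  normc (mpoly_at b x - mpoly_at b y) <= 3 * M * \sum_j normc (x j - y j).
Proof.
elim: n b x y => [|n IH] b x y bM x1 y1.
  rewrite big_ord0 mulr0 (_ : mpoly_at b x = mpoly_at b y) ?subrr ?Normc.normc0 //.
  by apply: eq_bigr => a _; rewrite !big_ord0.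
pose cons (w : C) (u : 'I_n -> C) (j : 'I_n.+1) := if unlift ord0 j is Some i then u i else w.
have cons0 w u : cons w u ord0 = w by rewrite /cons unlift_none.
have consS w u j : cons w u (lift ord0 j) = u j by rewrite /cons liftK.
have cons1 w u : normc w <= 1 -> (forall j, normc (u j) <= 1) -> forall j, normc (cons w u j) <= 1.
  by move=> w1 u1 j; rewrite /cons; case: unliftP.
have consE w u : mpoly_at b (cons w u) = \sum_(m < 3) w ^+ m * mpoly_at (fun g => b (fcons m g)) u.
  rewrite mpoly_at_recl cons0; apply: eq_bigr => m _; congr (_ * _).
  by apply: eq_bigr => g _; congr (_ * _); apply: eq_bigr => j _; rewrite consS.
pose xt j := x (lift ord0 j); pose yt j := y (lift ord0 j).
have xE : mpoly_at b x = mpoly_at b (cons (x ord0) xt) by rewrite consE mpoly_at_recl.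
have yE : mpoly_at b y = mpoly_at b (cons (y ord0) yt) by rewrite consE mpoly_at_recl.
pose bx (g : {ffun 'I_n -> 'I_3}) := \sum_(m < 3) x ord0 ^+ m * b (fcons m g).
have bxE u : mpoly_at bx u = mpoly_at b (cons (x ord0) u).
  rewrite consE /mpoly_at; under eq_bigr do rewrite mulr_suml.
  rewrite exchange_big; apply: eq_bigr => m _; rewrite mulr_sumr.
  by apply: eq_bigr => g _; rewrite mulrA.
have tail : normc (mpoly_at b (cons (x ord0) xt) - mpoly_at b (cons (x ord0) yt)) <=
    3 * M * \sum_j normc (xt j - yt j).
  by rewrite -!bxE; apply: IH => [u u1|j|j]; rewrite ?bxE; [apply: bM; exact: cons1|exact: x1|exact: y1].
pose A m := mpoly_at (fun g => b (fcons m g)) yt.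
have AM m : normc (A m) <= M.
  (* [A m] is read as a coefficient of a polynomial in the first variable alone, bounded by [M] on
     the circle. *)
  pose p : {poly C} := \poly_(i < 3) A (inord i).
  have -> : A m = p`_m by rewrite coef_poly ltn_ord inord_val.
  apply: poly_coef_bound => w w1; rewrite horner_poly.
  rewrite (_ : \sum_(i < 3) _ = mpoly_at b (cons w yt)); last first.
    by rewrite consE; apply: eq_bigr => i _; rewrite inord_val mulrC.
  by apply/bM/cons1 => [|j]; rewrite ?w1 //; exact: y1.
have head : normc (mpoly_at b (cons (x ord0) yt) - mpoly_at b (cons (y ord0) yt)) <=
    3 * M * normc (x ord0 - y ord0).
  rewrite !consE -sumrB !big_ord_recl big_ord0 addr0 /= !expr0 subrr add0r !expr1.
  set A1 := mpoly_at _ _; set A2 := mpoly_at _ _.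
  have h1 : normc A1 <= M by exact: AM. have h2 : normc A2 <= M by exact: AM.
  set u := x ord0; set v := y ord0; set d := normc (u - v).
  have d0 : 0 <= d by exact: normc_ge0.
  have -> : u * A1 - v * A1 + (u ^+ 2 * A2 - v ^+ 2 * A2) =
      (u - v) * A1 + (u - v) * ((u + v) * A2) by ring.
  apply: le_trans (le_normcD _ _) _; rewrite !Normc.normcM -/d.
  have uv : normc (u + v) <= 2.
    by apply: le_trans (le_normcD _ _) _; apply: (lerD (x1 ord0) (y1 ord0)).
  have : normc (u + v) * normc A2 <= 2 * M by apply: ler_pM; rewrite ?normc_ge0.
  move=> /(ler_wpM2l d0); have := ler_wpM2l d0 h1; lra.
rewrite xE yE big_ord_recl mulrDr.
have -> : mpoly_at b (cons (x ord0) xt) - mpoly_at b (cons (y ord0) yt) =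
  (mpoly_at b (cons (x ord0) yt) - mpoly_at b (cons (y ord0) yt)) +
  (mpoly_at b (cons (x ord0) xt) - mpoly_at b (cons (x ord0) yt)) by ring.
exact: le_trans (le_normcD _ _) (lerD head tail).
Qed.

(** Rounding towards 0 keeps |q| <= |u|, so that rounding both parts of a point of the disc does not
    leave the disc. *)
Lemma interval_net N (u : R) : (0 < N)%N -> `|u| <= 1 ->
  exists (s : bool) (i : 'I_N.+1), let q := (-1) ^+ s * (i%:R / N%:R) in
    `|q| <= `|u| /\ `|u - q| <= N%:R^-1.
Proof.
move=> N0 u1; have N0' : 0 < N%:R :> R by rewrite ltr0n.
have x0 : 0 <= N%:R * `|u| by rewrite mulr_ge0.
have /andP[h1 h2] := truncn_itv x0; set i := Num.Def.truncn _ in h1 h2.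
have iN : (i < N.+1)%N.
  by rewrite ltnS -(ler_nat R); apply: le_trans h1 _; rewrite ler_piMr.
exists (u < 0), (Ordinal iN) => /=.
have q0 : 0 <= i%:R / N%:R :> R by rewrite divr_ge0.
have qu : i%:R / N%:R <= `|u| by rewrite ler_pdivrMr // mulrC.
have uq : `|u| - i%:R / N%:R <= N%:R^-1.
  rewrite lerBlDr (_ : _ + _ = i.+1%:R / N%:R); last by rewrite -natr1; field; rewrite gt_eqF.
  by rewrite ler_pdivlMr // mulrC ltW.
have [u0|u0] := ltP u 0.
  rewrite expr1 mulN1r normrN ger0_norm //; split=> //.
  by rewrite -normrN opprD opprK -{1}(ltr0_norm u0) [leLHS]ger0_norm // subr_ge0.
rewrite expr0 mul1r ger0_norm //; split=> //.
by rewrite -{1}(ger0_norm u0) [leLHS]ger0_norm // subr_ge0.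
Qed.

Lemma disc_net N : (0 < N)%N -> exists (T : finType) (pt : T -> C),
  [/\ #|T| = (4 * N.+1 ^ 2)%N, forall t, normc (pt t) <= 1 &
   forall w, normc w <= 1 -> exists t, normc (w - pt t) <= 2 / N%:R].
Proof.
move=> N0; pose q (s : bool) (i : 'I_N.+1) : R := (-1) ^+ s * (i%:R / N%:R).
pose pt0 (t : (bool * 'I_N.+1) * (bool * 'I_N.+1)) := q t.1.1 t.1.2 +i* q t.2.1 t.2.2.
pose pt t := if normc (pt0 t) <= 1 then pt0 t else 0.
exists ((bool * 'I_N.+1) * (bool * 'I_N.+1))%type, pt; split.
- by rewrite !card_prod card_bool card_ord; lia.
- by move=> t; rewrite /pt; case: ifP => // _; rewrite Normc.normc0.
move=> w w1; have [s [i []]] := interval_net N0 (le_trans (Re_le_normc w) w1).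
have [s' [i' []]] := interval_net N0 (le_trans (Im_le_normc w) w1).
rewrite -/(q s i) -/(q s' i') => a1 a2 b1 b2; exists ((s, i), (s', i')).
have -> : pt ((s, i), (s', i')) = q s i +i* q s' i'.
  rewrite /pt ifT //; apply: le_trans w1.
  rewrite -ler_sqr ?nnegrE ?normc_ge0 // !normcM2 /=.
  by apply: lerD; rewrite -[leLHS]real_normK ?num_real // -[leRHS]real_normK ?num_real //; apply: lerXn2r; rewrite ?nnegrE.
apply: le_trans (normc_le_ReIm _) _; case: w w1 a1 a2 b1 b2 => u v /= _ _ a2 _ b2.
by rewrite mulrDl mul1r; exact: lerD.
Qed.

(* A net of mesh [1 / (6 n)] in each variable suffices, by [mpoly_lipschitz]; the
   signs are chosen for all its points at once. *)
Lemma random_polynomial n (s : 'I_n -> R) : (0 < n)%N -> (forall j, 0 <= s j <= 1) ->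
  exists e : {ffun {ffun 'I_n -> 'I_3} -> bool},
  forall y : 'I_n -> C, (forall j, normc (y j) <= 1) ->
  normc (mpoly_at (fun a => ((-1) ^+ (e a) * \prod_j s j ^+ a j)%:C) y) <=
  12 * Num.sqrt (2 * n%:R * ln (52 * n%:R) * \sum_(a : {ffun 'I_n -> 'I_3}) (\prod_j s j ^+ a j) ^+ 2).
Proof.
move=> n0 s01; have n0' : 0 < n%:R :> R by rewrite ltr0n.
set L := 2 * n%:R * ln (52 * n%:R); set V := \sum_a _.
have n1 : 1 <= n%:R :> R by rewrite ler1n.
have L0 : 0 < L by rewrite !mulr_gt0 // ln_gt0 //; lra.
have V0 : 0 < V.
  rewrite /V (bigD1 [ffun=> ord0]) //= ltr_pwDl ?sumr_ge0 // => [|a _]; last exact: sqr_ge0.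
  by rewrite big1 ?expr1n // => j _; rewrite ffunE expr0.
pose N := (12 * n)%N; have N0 : (0 < N)%N by rewrite muln_gt0.
have [T [pt [cardT pt1 ptw]]] := disc_net N0.
pose z (g : {ffun 'I_n -> T}) (a : {ffun 'I_n -> 'I_3}) : C := \prod_j ((s j)%:C * pt (g j)) ^+ a j.
pose v (gb : {ffun 'I_n -> T} * bool) a := if gb.2 then complex.Re (z gb.1 a) else complex.Im (z gb.1 a).
have zs g a : normc (z g a) <= \prod_j s j ^+ a j.
  rewrite normc_prod; apply: ler_prod => j _; have /andP[h1 h2] := s01 j.
  rewrite normc_ge0 normcX Normc.normcM normcR ger0_norm //=.
  by apply: lerXn2r; rewrite ?nnegrE ?mulr_ge0 ?normc_ge0 // ler_piMr.
have s0 (a : {ffun 'I_n -> 'I_3}) : 0 <= \prod_j s j ^+ a j.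
  by apply: prodr_ge0 => j _; rewrite exprn_ge0 //; case/andP: (s01 j).
have [||e He] := @signs_exist _ _ _ v V L V0 L0.
- rewrite card_prod card_bool card_ffun card_ord cardT /N.
  (* There are 4 |T| ^ n moments in all, at most (4 |T|) ^ n with |T| = 4 (12 n + 1) ^ 2; the 52
     comes from 4 (12 n + 1) <= 52 n. *)
  apply: (@le_trans _ _ ((52 * n) ^ (2 * n))%:R); last first.
    by rewrite /L -natrM expRM_natl lnK ?posrE ?mulr_gt0 // -natrM -natrX.
  rewrite ler_nat expnM; apply: (@leq_trans ((4 * (4 * (12 * n).+1 ^ 2)) ^ n)).
    rewrite [leqRHS]expnMn [leqLHS]mulnC -mulnA [leqLHS]mulnC leq_mul2r; apply/orP; right.
    by rewrite (_ : 2 * 2 = 4 ^ 1)%N // leq_exp2l.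
  by rewrite leq_exp2r // -!mulnn; nia.
- move=> gb; apply: ler_sum => a _; apply: (@le_trans _ _ (normc (z gb.1 a) ^+ 2)).
    rewrite normcM2 /v; case: ifP => _; rewrite ?lerDl ?lerDr sqr_ge0 //.
  by apply: lerXn2r; rewrite ?nnegrE ?normc_ge0.
exists e; pose b (a : {ffun 'I_n -> 'I_3}) := ((-1) ^+ (e a) * \prod_j s j ^+ a j)%:C.
rewrite -/b; set S : R := Num.sqrt _ in He *.
have onnet (g : {ffun 'I_n -> T}) : normc (mpoly_at b (fun j => pt (g j))) <= 6 * S.
  have E : mpoly_at b (fun j => pt (g j)) = \sum_a ((-1) ^+ (e a))%:C * z g a.
    apply: eq_bigr => a _; rewrite /b rmorphM -mulrA; congr (_ * _) => /=.
    rewrite /z rmorph_prod -big_split; apply: eq_bigr => j _ /=.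
    by rewrite rmorphXn exprMn.
  have ReE : complex.Re (mpoly_at b (fun j => pt (g j))) = \sum_a (-1) ^+ (e a) * v (g, true) a.
    rewrite E raddf_sum; apply: eq_bigr => a _.
    by rewrite /v /=; case: (z g a) => x y /=; rewrite mul0r subr0.
  have ImE : complex.Im (mpoly_at b (fun j => pt (g j))) = \sum_a (-1) ^+ (e a) * v (g, false) a.
    rewrite E raddf_sum; apply: eq_bigr => a _.
    by rewrite /v /=; case: (z g a) => x y /=; rewrite mul0r addr0.
  apply: le_trans (normc_le_ReIm _) _; rewrite ReE ImE.
  by have := lerD (He (g, true)) (He (g, false)); lra.
pose A := [set normc (mpoly_at b y) | y in [set y : 'I_n -> C | forall j, normc (y j) <= 1]].
have supA : has_sup A.
  split.
    by exists (normc (mpoly_at b (fun=> 0))), (fun=> 0) => // j; rewrite Normc.normc0.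
  exists (\sum_a normc (b a)) => _ [y /= y1 <-]; apply: le_trans (ler_normc_sum _ _ _) _.
  apply: ler_sum => a _; rewrite Normc.normcM ler_piMr ?normc_ge0 // normc_prod.
  by apply: Num.Theory.prodr_ile1 => j _; rewrite normcX exprn_ge0 ?normc_ge0 //= exprn_ile1 ?normc_ge0.
have leA y : (forall j, normc (y j) <= 1) -> normc (mpoly_at b y) <= sup A.
  by move=> y1; apply: ub_le_sup; [exact: supA.2|exists y].
have A0 : 0 <= sup A.
  by apply: le_trans (leA (fun=> 0) _) => [|j]; rewrite ?normc_ge0 // Normc.normc0.
(* The supremum is finite, so half of it can be absorbed: moving to the net costs 3 (sup A) n (2 /
   N), which is (sup A) / 2 for N = 12 n. *)
suff half : sup A <= 6 * S + sup A / 2 by move=> y /leA; lra.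
apply: ge_sup; first exact: supA.1.
move=> _ [y /= y1 <-]; have [g Hg] := choice (fun j => ptw (y j) (y1 j)).
have gE j : pt ([ffun j => g j] j) = pt (g j) by rewrite ffunE.
have := mpoly_lipschitz leA y1 (fun j => pt1 ([ffun j => g j] j)).
have := onnet [ffun j => g j]; set w := mpoly_at b (fun j => _) => h1 h2.
have -> : mpoly_at b y = w + (mpoly_at b y - w) by rewrite addrC subrK.
apply: le_trans (le_normcD _ _) _; apply: lerD => //; apply: le_trans h2 _.
apply: (@le_trans _ _ (3 * sup A * \sum_(j < n) (2 / N%:R))).
  rewrite ler_wpM2l ?mulr_ge0 //; apply: ler_sum => j _; rewrite gE; exact: Hg.
rewrite sumr_const card_ord -mulr_natl /N natrM le_eqVlt; apply/orP; left; apply/eqP.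
by field; rewrite gt_eqF.
Qed.

End RandomPolynomials.

(** * Uniform limits and gluing *)

Section Frechet.
Variable R : realType.
Local Notation C := R[i].
Implicit Types (f g : linfty R -> C) (p u v h : linfty R).

(* [polydisc x h] reads [||h|| <= x]. *)
Definition frechet f p (T : linfty R -> C) :=
  [/\ forall (a : C) u v, T (a *: u + v) = a * T u + T v,
   exists K : R, forall x u, 0 <= x -> polydisc x u -> normc (T u) <= K * x &
   forall e : R, 0 < e -> exists2 d : R, 0 < d & forall x h, 0 <= x <= d -> polydisc x h ->
     normc (f (h + p) - f p - T h) <= e * x].

Lemma linfty_normE u : exists2 x : R, 0 <= x /\ polydisc x u & `|u| = x%:C.
Proof.
exists (sup (range (fun n => normc (u n)))) => //; split.
  by apply: le_trans (linfty_norm_ub u 0); exact: normc_ge0.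
by move=> j; exact: linfty_norm_ub.
Qed.

Lemma frechet_differentiable f p T : frechet f p T -> differentiable f p.
Proof.
move=> [Tlin [K HK] HT].
have Tl : linear T by move=> a u v; rewrite Tlin.
pose L : {linear linfty R -> C} := HB.pack T (GRing.isLinear.Build C (linfty R) C *:%R T Tl).
have Lc : continuous L.
  apply: bounded_linear_continuous; apply/linear_boundedP.
  exists `|K|%:C; split; first by rewrite ger0_real // lecR.
  move=> r /ltW Kr u; have [x [x0 ux] ->] := linfty_normE u.
  apply: le_trans (_ : `|K|%:C * x%:C <= _); last by rewrite ler_wpM2r // lecR.
  rewrite normr_normc -rmorphM lecR; apply: le_trans (HK x u x0 ux) _.
  by rewrite ler_wpM2r // ler_norm.
have fE : f \o shift p = cst (f p) + L +o_ 0 id.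
  apply/eqaddoP => e e0; have [eR eE] : exists r : R, e = r%:C.
    by exists (complex.Re e); rewrite RRe_real ?gtr0_real.
  move: e0; rewrite eE ltcR => e0; have [d d0 Hd] := HT eR e0.
  apply/nbhs_ballP; exists d%:C; first by rewrite /= ltcR.
  move=> h; rewrite -ball_normE /ball_ /= sub0r normrN !fctE /=.
  have [x [x0 hx] ->] := linfty_normE h; rewrite ltcR => xd.
  rewrite normr_normc -rmorphM lecR opprD addrA; apply: Hd => //.
  by rewrite x0 ltW.
have dE := diff_unique Lc fE.
by apply/diff_locallyP; rewrite dE.
Qed.

(** By x + rho <= 1 the line stays in the ball over the whole unit disc. The linear coefficient is
    identified by comparing, at a small real [t], the remainder of order 2 with the definition of
    the derivative. *)
Lemma line_series f (M x rho : R) p v : (forall z, Dinfty z -> differentiable f z) ->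
  (forall z, Dinfty z -> normc (f z) <= M) -> 0 <= x -> x + rho <= 1 -> 0 < rho ->
  polydisc x p -> polydisc rho v ->
  exists a, [/\ power_series M a (fun w => f (w *: v + p)), a 0%N = f p & a 1%N = 'd f p v].
Proof.
move=> df fM x0 xr r0 px vr; have x1 : x < 1 by lra.
have inD w : normc w < 1 -> Dinfty (w *: v + p).
  move=> w1; apply/DinftyP; exists (x + normc w * rho) => [|j].
    have := normc_ge0 w; have : normc w * rho < 1 * rho by rewrite ltr_pM2r.
    by move=> h1 h2; rewrite addr_ge0 ?mulr_ge0 ?(ltW r0) //=; lra.
  rewrite (_ : (w *: v + p) j = w * v j + p j) // addrC.
  apply: le_trans (le_normcD _ _) _; rewrite Normc.normcM; apply: lerD; first exact: px.
  by rewrite ler_wpM2l ?normc_ge0.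
have [a Ha] : exists a, power_series M a (fun w => f (w *: v + p)).
  apply: holo_power_series => w w1; last exact/fM/inD.
  exact/differentiable_holo/df/inD.
have [aM as_] := Ha.
have a0 : a 0%N = f p by rewrite (power_series0 Ha) scale0r add0r.
have dp : differentiable f p by rewrite -[p]add0r -(scale0r v); apply/df/inD; rewrite Normc.normc0.
exists a; split=> //; rewrite -deriveE //.
have M0 : 0 <= M by exact: le_trans (normc_ge0 (a 0%N)) (aM 0%N).
apply/eqP; rewrite -subr_eq0; apply/eqP/normc_le0.
apply/ler_addgt0Pr => e e0; rewrite add0r.
have e2 : 0 < e / 2 by rewrite divr_gt0.
have [d d0 Hd] := derivable_line (diff_derivable (v := v) dp) e2.
pose t := Num.min (d / 2) (Num.min (2^-1) (e / (4 * (M + 1)))).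
have M1 : 0 < 4 * (M + 1) by rewrite mulr_gt0 // ltr_wpDl.
have t0 : 0 < t by rewrite /t !lt_min invr_gt0 ltr0n !divr_gt0.
have [td t2 te] : [/\ t < d, t <= 2^-1 & t * (4 * (M + 1)) <= e].
  rewrite -ler_pdivlMr // /t; split.
  - by rewrite gt_min; apply/orP; left; rewrite ltr_pdivrMr // ltr_pMr // ltr1n.
  - by rewrite !ge_min lexx !orbT.
  - by rewrite !ge_min lexx !orbT.
have tE : normc t%:C = t by rewrite normcR gtr0_norm.
have := Hd t%:C; rewrite tE => /(_ td) h1.
have := as_ t%:C 2%N; rewrite tE => /(_ (le_lt_trans t2 _)) h2.
have {}h2 : normc (f (t%:C *: v + p) - \sum_(i < 2) a i * t%:C ^+ i) <= 2 * M * t ^+ 2.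
  apply: le_trans (h2 _) _; first by lra.
  rewrite ler_pdivrMr; last by lra.
  by have := mulr_ge0 M0 (sqr_ge0 t); nra.
have E : t%:C * (a 1%N - 'D_v f p) =
    (f (t%:C *: v + p) - f p - t%:C * 'D_v f p) -
    (f (t%:C *: v + p) - \sum_(i < 2) a i * t%:C ^+ i).
  by rewrite !big_ord_recl big_ord0 /= expr0 expr1 a0; ring.
have : t * normc (a 1%N - 'D_v f p) <= t * e.
  rewrite -{1}tE -Normc.normcM E; apply: le_trans (ler_normcB _ _) _.
  apply: le_trans (lerD h1 h2) _; nra.
by rewrite ler_pM2l.
Qed.

Lemma polydisc0 u : polydisc 0 u -> u = 0.
Proof. by move=> u0; apply/val_inj/funext => j; exact/normc_le0/u0. Qed.

Lemma rescale u (y rho : R) : 0 < y -> 0 < rho -> polydisc y u ->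
  exists2 v : linfty R, polydisc rho v & u = (y / rho)%:C *: v.
Proof.
move=> y0 r0 uy; exists ((rho / y)%:C *: u) => [j|].
  rewrite (_ : ((rho / y)%:C *: u) j = (rho / y)%:C * u j) // Normc.normcM normcR.
  by rewrite ger0_norm ?divr_ge0 ?(ltW y0) ?(ltW r0) // mulrAC ler_pdivrMr // ler_pM2l.
by rewrite scalerA -rmorphM mulrA divfK ?gt_eqF // divff ?gt_eqF // scale1r.
Qed.

Lemma diff_scale f p v (t : C) : 'd f p (t *: v) = t * 'd f p v.
Proof. by rewrite linearZ. Qed.

Lemma diff_zero f p : 'd f p (0 : linfty R) = 0.
Proof. exact: linear0. Qed.

(** The constant depends on [M] and [x] only, so the estimate survives a limit of functions with a
    common bound. *)
Lemma second_order f (M x : R) p : (forall z, Dinfty z -> differentiable f z) ->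
  (forall z, Dinfty z -> normc (f z) <= M) -> 0 <= x < 1 -> polydisc x p ->
  forall y h, 0 <= y <= (1 - x) / 2 -> polydisc y h ->
    normc (f (h + p) - f p - 'd f p h) <= 2 * M * (y / (1 - x)) ^+ 2.
Proof.
move=> df fM /andP[x0 x1] px y h /andP[y0 yr] hy; have r0 : 0 < 1 - x by rewrite subr_gt0.
have xr : x + (1 - x) <= 1 by rewrite addrC subrK.
have [ye|yn] := eqVneq y 0.
  move: hy; rewrite ye => /polydisc0 ->; rewrite diff_zero add0r subrr subr0 Normc.normc0.
  by rewrite mul0r expr0n mulr0.
have yp : 0 < y by rewrite lt_def yn.
have [v vr hE] := rescale yp r0 hy.
have [a [[aM as_] a0 a1]] := line_series df fM x0 xr r0 px vr.
have M0 : 0 <= M by exact: le_trans (normc_ge0 (a 0%N)) (aM 0%N).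
set t := y / (1 - x) in hE *; have t0 : 0 <= t by rewrite divr_ge0 // ltW.
have t2 : t <= 2^-1 by rewrite ler_pdivrMr // mulrC.
have tE : normc t%:C = t by rewrite normcR ger0_norm.
have := as_ t%:C 2%N; rewrite tE -hE => h2.
have -> : f (h + p) - f p - 'd f p h = f (h + p) - \sum_(i < 2) a i * t%:C ^+ i.
  by rewrite !big_ord_recl big_ord0 /= expr0 expr1 a0 a1 {2}hE diff_scale; ring.
apply: le_trans (h2 _) _; first by lra.
rewrite ler_pdivrMr; last by lra.
by have := mulr_ge0 M0 (sqr_ge0 t); nra.
Qed.

(* [S] and [T] are kept abstract because unifying ['d f p] with ['d g p] unfolds
   both differentials. *)
Lemma diff_sub_bound f g (S T : linfty R -> C) (M e x : R) p :
  (forall u, S u = 'd f p u) -> (forall u, T u = 'd g p u) ->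
  (forall z, Dinfty z -> differentiable f z) -> (forall z, Dinfty z -> differentiable g z) ->
  (forall z, Dinfty z -> normc (f z) <= M) -> (forall z, Dinfty z -> normc (g z) <= M) ->
  (forall z, Dinfty z -> normc (f z - g z) <= e) -> 0 <= x < 1 -> polydisc x p ->
  forall y u, 0 <= y -> polydisc y u -> normc (S u - T u) <= e / (1 - x) * y.
Proof.
move=> SE TE df dg fM gM fg /andP[x0 x1] px y u y0 uy; have r0 : 0 < 1 - x by rewrite subr_gt0.
have xr : x + (1 - x) <= 1 by rewrite addrC subrK.
have [ye|yn] := eqVneq y 0.
  have u0 : u = 0 by apply: polydisc0; rewrite -ye.
  have S0 : S u = 0 by rewrite SE u0; exact: diff_zero.
  have T0 : T u = 0 by rewrite TE u0; exact: diff_zero.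
  by rewrite S0 T0 subrr Normc.normc0 ye mulr0.
have yp : 0 < y by rewrite lt_def yn.
have [v vr uE] := rescale yp r0 uy.
have Su : S u = (y / (1 - x))%:C * S v by rewrite !SE uE; exact: diff_scale.
have Tu : T u = (y / (1 - x))%:C * T v by rewrite !TE uE; exact: diff_scale.
have [a [Ha _ a1]] := line_series df fM x0 xr r0 px vr.
have [b [Hb _ b1]] := line_series dg gM x0 xr r0 px vr.
have Sv : S v = a 1%N by rewrite SE; exact: esym a1.
have Tv : T v = b 1%N by rewrite TE; exact: esym b1.
have h := cauchy_estimate (B := e) (power_seriesB Ha Hb) _ 1%N.
rewrite Su Tu Sv Tv -mulrBr Normc.normcM normcR ger0_norm ?divr_ge0 ?(ltW r0) //.
rewrite [leRHS](_ : _ = y / (1 - x) * e); last by ring.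
rewrite ler_wpM2l ?divr_ge0 ?(ltW r0) //; apply: h => w w1; apply: fg.
apply/DinftyP; exists (x + normc w * (1 - x)) => [|j].
  have := normc_ge0 w; have : normc w * (1 - x) < 1 * (1 - x) by rewrite ltr_pM2r.
  by move=> h1 h2; rewrite addr_ge0 ?mulr_ge0 ?(ltW r0) //=; lra.
rewrite (_ : (w *: v + p) j = w * v j + p j) // addrC.
apply: le_trans (le_normcD _ _) _; rewrite Normc.normcM; apply: lerD; first exact: px.
by rewrite ler_wpM2l ?normc_ge0.
Qed.

Lemma le_vanishing (e : nat -> R) (A B c : R) :
  (forall r : R, 0 < r -> exists k, e k <= r) -> 0 <= c ->
  (forall k, A <= B + c * e k) -> A <= B.
Proof.
move=> e0 c0 H; apply/ler_addgt0Pr => r r0.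
have c1 : 0 < c + 1 by rewrite ltr_wpDl.
have [k Hk] := e0 _ (divr_gt0 r0 c1); apply: le_trans (H k) _; rewrite lerD2l.
apply: le_trans (ler_wpM2l c0 Hk) _; rewrite mulrA ler_pdivrMr // mulrC.
by rewrite ler_pM2l // lerDl.
Qed.

(** Cauchy's estimate on lines makes the differentials converge to some [T], uniformly on bounded
    sets; the uniform second-order remainder then passes to the limit and shows that [T] is the
    differential of [f]. *)
Theorem Hinfty_limit (G : nat -> linfty R -> C) f (e : nat -> R) (B : R) :
  (forall k z, Dinfty z -> differentiable (G k) z) ->
  (forall k z, Dinfty z -> normc (G k z) <= B) ->
  (forall k z, Dinfty z -> normc (G k z - f z) <= e k) ->
  (forall r : R, 0 < r -> exists k, e k <= r) ->
  forall p, Dinfty p -> differentiable f p.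
Proof.
move=> dG GB Ge e0 p pD; have /DinftyP[x x01 px] := pD; have /andP[x0 x1] := x01.
have r0 : 0 < 1 - x by rewrite subr_gt0.
have B0 : 0 <= B by exact: le_trans (normc_ge0 _) (GB 0%N p pD).
have ek k : 0 <= e k by exact: le_trans (normc_ge0 _) (Ge k p pD).
have [D DE] : exists D : nat -> linfty R -> C, forall k u, D k u = 'd (G k) p u by exists (fun k u => 'd (G k) p u).
have Dlin k (a : C) u v : D k (a *: u + v) = a * D k u + D k v.
  by rewrite !DE linearD diff_scale.
have lim u : exists t, forall y, 0 <= y -> polydisc y u -> forall k,
    normc (D k u - t) <= 2 * (e k / (1 - x)) * y.
  have [y [y0 uy] yn] := linfty_normE u.
  have [|t Ht] := @complex_limit _ (fun k => D k u) (fun k => e k / (1 - x) * y).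
    move=> k l; rewrite -!mulrDl.
    apply: (diff_sub_bound (DE k) (DE l) (dG k) (dG l) (GB k) (GB l) _ x01 px) => // z zD.
    rewrite (_ : G k z - G l z = (G k z - f z) - (G l z - f z)); last by ring.
    by apply: le_trans (ler_normcB _ _) _; apply: lerD; exact: Ge.
  exists t => y' y'0 uy' k; apply: le_trans (Ht k) _; rewrite mulrA ler_wpM2l //.
    by rewrite mulr_ge0 // divr_ge0 // ltW.
  by have := linfty_norm_le y'0 uy'; rewrite yn lecR.
have [T HT] := choice lim.
apply: (@frechet_differentiable _ _ T); split.
- move=> a u v; apply/eqP; rewrite -subr_eq0; apply/eqP/normc_le0.
  have [y [y0 uy] _] := linfty_normE u; have [y' [y'0 vy'] _] := linfty_normE v.
  have auv : polydisc (normc a * y + y') (a *: u + v).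
    move=> j; rewrite (_ : (a *: u + v) j = a * u j + v j) //.
    apply: le_trans (le_normcD _ _) _; rewrite Normc.normcM.
    by apply: lerD => //; rewrite ler_wpM2l ?normc_ge0.
  have ay0 : 0 <= normc a * y by rewrite mulr_ge0 ?normc_ge0.
  apply: (@le_vanishing e _ _ (4 * (normc a * y + y') / (1 - x)) e0) => [|k].
    by rewrite divr_ge0 ?(ltW r0) // mulr_ge0 // addr_ge0.
  rewrite add0r.
  have -> : T (a *: u + v) - (a * T u + T v) =
      (a * (D k u - T u) + (D k v - T v)) - (D k (a *: u + v) - T (a *: u + v)).
    by rewrite Dlin; ring.
  apply: le_trans (ler_normcB _ _) _; apply: le_trans (lerD (le_normcD _ _) (HT _ _ _ auv k)) _.
    by rewrite addr_ge0.
  rewrite Normc.normcM.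
  have h1 := ler_wpM2l (normc_ge0 a) (HT u y y0 uy k); have h2 := HT v y' y'0 vy' k.
  apply: le_trans (lerD (lerD h1 h2) (lexx _)) _.
  by rewrite le_eqVlt; apply/orP; left; apply/eqP; field; rewrite gt_eqF.
- exists ((B + 2 * e 0%N) / (1 - x)) => y u y0 uy.
  have h1 : normc (D 0%N u) <= B / (1 - x) * y.
    rewrite -[D 0%N u]subr0.
    apply: (@diff_sub_bound (G 0%N) (cst 0) (D 0%N) (fun=> 0) B B x p (DE 0%N) _ (dG 0%N) _ (GB 0%N) _ _ x01 px) => //.
    - by move=> v; rewrite diff_cst.
    - by move=> z zD; rewrite Normc.normc0.
    - by move=> z zD; rewrite subr0; exact: GB.
  have h2 := HT u y y0 uy 0%N.
  rewrite (_ : T u = D 0%N u - (D 0%N u - T u)); last by ring.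
  apply: le_trans (ler_normcB _ _) _; apply: le_trans (lerD h1 h2) _.
  by rewrite le_eqVlt; apply/orP; left; apply/eqP; field; rewrite gt_eqF.
move=> r rp; pose c := 2 * B / (1 - x) ^+ 2.
have c0 : 0 <= c by rewrite /c divr_ge0 ?sqr_ge0 // mulr_ge0.
have c1 : 0 < c + 1 by rewrite ltr_wpDl.
exists (Num.min ((1 - x) / 2) (r / (c + 1))); first by rewrite lt_min !divr_gt0.
move=> y h /andP[y0]; rewrite le_min => /andP[y1 y2] hy.
have hD : Dinfty (h + p).
  apply/DinftyP; exists (y + x); first by rewrite addr_ge0 //=; lra.
  move=> j; rewrite (_ : (h + p) j = h j + p j) //.
  by apply: le_trans (le_normcD _ _) _; exact: lerD.
apply: (@le_trans _ _ (c * y ^+ 2)); last first.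
  rewrite expr2 mulrA ler_wpM2r //; move: y2; rewrite ler_pdivlMr // => y2.
  by apply: le_trans y2; rewrite mulrC ler_wpM2l // lerDl.
apply: (@le_vanishing e _ _ (2 + 2 * (y / (1 - x))) e0) => [|k].
  by rewrite addr_ge0 // mulr_ge0 // divr_ge0 // ltW.
have -> : f (h + p) - f p - T h = (G k (h + p) - G k p - D k h) +
    ((G k p - f p) - (G k (h + p) - f (h + p)) + (D k h - T h)) by ring.
have h1 : normc (G k (h + p) - G k p - D k h) <= 2 * B * (y / (1 - x)) ^+ 2.
  by rewrite DE; apply: (second_order (dG k) (GB k) x01 px) => //; rewrite y0.
apply: le_trans (le_normcD _ _) _; apply: lerD.
  apply: le_trans h1 _; rewrite /c le_eqVlt; apply/orP; left; apply/eqP.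
  by field; rewrite gt_eqF.
apply: le_trans (le_normcD _ _) _.
apply: le_trans (lerD (ler_normcB _ _) (HT h y y0 hy k)) _.
apply: le_trans (lerD (lerD (Ge k p pD) (Ge k _ hD)) (lexx _)) _.
by rewrite le_eqVlt; apply/orP; left; apply/eqP; field; rewrite gt_eqF.
Qed.

End Frechet.

(** * Polynomials with disjoint supports *)

Section Gluing.
Variable R : realType.
Local Notation C := R[i].
Implicit Types (f g : linfty R -> C) (p w z : linfty R) (S : {fset multi_index}).

Lemma differentiable_bigsum (I : Type) (r : seq I) (F : I -> linfty R -> C) p :
  (forall i, differentiable (F i) p) -> differentiable (fun w => \sum_(i <- r) F i w) p.
Proof.
move=> dF; elim: r => [|i r IH].
  rewrite (_ : (fun w => _) = cst 0); last by apply/funext => w; rewrite big_nil.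
  exact: differentiable_cst.
rewrite (_ : (fun w => _) = (fun w => F i w + \sum_(i <- r) F i w)).
  exact: differentiableD (dF i) IH.
by apply/funext => w; rewrite big_cons.
Qed.

Lemma differentiable_bigprod (I : Type) (r : seq I) (F : I -> linfty R -> C) p :
  (forall i, differentiable (F i) p) -> differentiable (fun w => \prod_(i <- r) F i w) p.
Proof.
move=> dF; elim: r => [|i r IH].
  rewrite (_ : (fun w => _) = cst 1); last by apply/funext => w; rewrite big_nil.
  exact: differentiable_cst.
rewrite (_ : (fun w => _) = (fun w => F i w * \prod_(i <- r) F i w)).
  exact: differentiableM (dF i) IH.
by apply/funext => w; rewrite big_cons.
Qed.

Lemma differentiable_coord j p : differentiable (fun w : linfty R => w j) p.
Proof.
apply: (@frechet_differentiable _ _ _ (fun w => w j)); split=> //.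
  by exists 1 => x u _ ux; rewrite mul1r.
move=> e e0; exists 1 => // x h /andP[x0 _] _.
rewrite (_ : (h + p) j = h j + p j) // addrK subrr Normc.normc0.
by rewrite mulr_ge0 // ltW.
Qed.

Lemma differentiable_monomial al p : differentiable (fun w => monomial w al) p.
Proof.
apply: differentiable_bigprod => j; elim: (al j) => [|n IH].
  exact: differentiable_cst.
rewrite (_ : (fun w => _) = (fun w : linfty R => w j * w j ^+ n)).
  exact: differentiableM (differentiable_coord j p) IH.
by apply/funext => w; rewrite exprS.
Qed.

Definition fpoly S (b : multi_index -> C) w := \sum_(al <- S) b al * monomial w al.

Lemma differentiable_fpoly S b p : differentiable (fpoly S b) p.
Proof.
apply: differentiable_bigsum => al.
apply: differentiableM; first exact: differentiable_cst.
exact: differentiable_monomial.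
Qed.

Lemma monomial_eq0 w al k : first_coords k w -> ~ first_indices k al -> monomial w al = 0.
Proof.
move=> wk alk; have [j [kj aj]] : exists j, (k <= j)%N /\ al j != 0%N.
  apply: contrapT => H; apply: alk => j kj; apply/eqP/negPn/negP => aj.
  by apply: H; exists j.
have js : j \in finsupp al by rewrite mem_finsupp.
by rewrite /monomial (big_fsetD1 j) //= wk // expr0n (negbTE aj) mul0r.
Qed.

Lemma fpoly_coefs S b : is_monomial_coefs (fpoly S b) (fun al => if al \in S then b al else 0).
Proof.
move=> k z zD zk; apply/abs_sum_patchP.
pose v al := patch (fun=> 0) (first_indices k)
  (fun al => (if al \in S then b al else 0) * monomial z al) al.
have v0 al : al \notin S -> v al = 0.
  by move=> /negbTE alS; rewrite /v /patch alS mul0r; case: ifP.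
rewrite -/v (_ : fpoly S b z = \sum_(al <- S) v al); first exact: abs_sum_fset.
rewrite /fpoly big_seq_cond [RHS]big_seq_cond; apply: eq_bigr => al; rewrite andbT => alS.
rewrite /v /patch alS; case: ifPn => // h.
by rewrite (monomial_eq0 zk) ?mulr0 // => h'; move/negP: h; apply; rewrite inE.
Qed.

Lemma is_monomial_coefsD f g c d : is_monomial_coefs f c -> is_monomial_coefs g d ->
  is_monomial_coefs (fun w => f w + g w) (fun al => c al + d al).
Proof.
move=> fc gd k z zD zk; apply/abs_sum_patchP.
have /abs_sum_patchP h1 := fc k z zD zk; have /abs_sum_patchP h2 := gd k z zD zk.
apply: eq_abs_sum (abs_sumD h1 h2) => al; rewrite /patch.
by case: ifP => _; rewrite ?addr0 // mulrDl.
Qed.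

Lemma eq_monomial_coefs f g c d : f =1 g -> c =1 d ->
  is_monomial_coefs f c -> is_monomial_coefs g d.
Proof. by move=> /funext <- /funext <-. Qed.

Lemma fpoly_sum_coefs k (S : nat -> {fset multi_index}) (b : nat -> multi_index -> C) :
  is_monomial_coefs (fun w => \sum_(m < k) fpoly (S m) (b m) w)
    (fun al => \sum_(m < k) if al \in S m then b m al else 0).
Proof.
elim: k => [|k IH].
  apply: eq_monomial_coefs (fpoly_coefs fset0 (fun=> 0)) => [w|al].
    by rewrite big_ord0 /fpoly big_seq_fset0.
  by rewrite /= big_ord0.
have H := is_monomial_coefsD IH (fpoly_coefs (S k) (b k)).
apply: (eq_monomial_coefs _ _ H) => [w|al] /=.
  by rewrite big_ord_recr.
by rewrite big_ord_recr.
Qed.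

(* The functions are glued along disjoint sets of monomials, so that no coefficient
   of one interferes with those of the others. *)
Theorem gluing z (S : nat -> {fset multi_index}) (b : nat -> multi_index -> C) :
  (forall m l al, al \in S m -> al \in S l -> m = l) ->
  (forall m w, Dinfty w -> normc (fpoly (S m) (b m) w) <= 2^-1 ^+ m.+1) ->
  (forall m, 1 <= \sum_(al <- S m) normc (b m al * monomial z al)) ->
  ~ mon_Hinfty z.
Proof.
move=> Sdisj gM zS [zD zmon].
pose h : R := 2^-1; have h0 : 0 < h by rewrite invr_gt0.
pose G k w := \sum_(m < k) fpoly (S m) (b m) w.
have hS n : h ^+ n.+1 + h ^+ n.+1 = h ^+ n.
  by rewrite -mulr2n -mulr_natl exprS mulrA divff ?mul1r.
have Gcauchy k n w : Dinfty w -> normc (G (k + n)%N w - G k w) <= h ^+ k - h ^+ (k + n).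
  move=> wD; elim: n => [|n IH]; first by rewrite addn0 !subrr Normc.normc0.
  rewrite addnS /G big_ord_recr /= -/(G _ w) addrAC.
  apply: le_trans (le_normcD _ _) _; apply: le_trans (lerD IH (gM _ _ wD)) _.
  by have := hS (k + n)%N; rewrite -/h; lra.
pose e k := 2 * h ^+ k.
have G1 k w : Dinfty w -> normc (G k w) <= 1.
  move=> wD; have := Gcauchy 0%N k w wD; rewrite add0n expr0 {2}/G big_ord0 subr0 => H.
  by apply: le_trans H _; rewrite gerBl exprn_ge0 // ltW.
have lim w : exists t, Dinfty w -> forall k, normc (G k w - t) <= e k.
  have [wD|nwD] := pselect (Dinfty w); last by exists 0.
  have [|t Ht] := @complex_limit _ (fun k => G k w) (fun k => h ^+ k).
    have H k l : (k <= l)%N -> normc (G l w - G k w) <= h ^+ k + h ^+ l.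
      move=> /subnKC <-; apply: le_trans (Gcauchy k (l - k)%N w wD) _.
      by rewrite lerD2l -subr_ge0 opprK addr_ge0 // exprn_ge0 // ltW.
    move=> k l; have [kl|lk] := leqP k l; first by rewrite normcB; exact: H.
    by rewrite [leRHS]addrC; apply: H; exact: ltnW.
  by exists t.
have [f Hf] := choice lim.
have dG k p : differentiable (G k) p by apply: differentiable_bigsum => m; exact: differentiable_fpoly.
have h01 : 0 <= h < 1 by rewrite ltW //= /h; lra.
have e0 (r : R) : 0 < r -> exists k, e k <= r.
  move=> r0; have [N HN] := expr_small h01 (divr_gt0 r0 (ltr0Sn R 1)).
  by exists N; have := HN N (leqnn N); rewrite /e; lra.
have df p : Dinfty p -> differentiable f p.
  apply: (@Hinfty_limit _ G f e 1 (fun k z _ => dG k z) G1 _ e0) => k w wD.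
  exact: Hf.
have fH k : Hinfty (fun w => f w - G k w).
  split=> [p pD|]; first by apply: differentiableB; [exact: df|exact: dG].
  have FF : ProperFilter (globally (@Dinfty R)) by exact: (globally_properfilter zD).
  apply/(@ex_bound _ _ _ _ _ FF); exists (e k)%:C => w wD.
  by rewrite /= normr_normc lecR normcB; exact: Hf.
pose c := monomial_coef f.
(* [f - G l] is bounded by [e l], hence so are its coefficients. By uniqueness the coefficient of
   [f] at [al] differs from [b m al] by at most [e l], for all large [l]. *)
have cE m al : al \in S m -> c al = b m al.
  move=> alS; apply/eqP; rewrite -subr_eq0; apply/eqP/normc_le0.
  apply: (@le_vanishing _ (fun k => e (m.+1 + k)%N) _ _ 1) => // [r r0|k].
    have [k Hk] := e0 r r0; exists k; apply: le_trans Hk.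
    rewrite /e ler_pM2l // exprD ler_piMl ?exprn_ge0 ?(ltW h0) // exprn_ile1 ?(ltW h0) //.
    by case/andP: h01 => _ /ltW.
  rewrite add0r mul1r; set l := (m.+1 + k)%N.
  have [|d [dM dH _]] := @monomial_expansion _ _ (e l) (fH l).
    by move=> w wD; rewrite normcB; exact: Hf.
  have fc : is_monomial_coefs f (fun al => d al + \sum_(m < l) if al \in S m then b m al else 0).
    apply: (eq_monomial_coefs _ _ (is_monomial_coefsD dH (fpoly_sum_coefs l S b))) => // w.
    exact: subrK.
  rewrite [c al](congr1 (fun c => c al) (monomial_coefE fc)).
  have ml : (m < l)%N by rewrite /l; lia.
  rewrite (bigD1 (Ordinal ml)) //= alS big1 ?addr0 => [|i im]; last first.
    case: ifP => // alSi; move/negP: im; case; apply/eqP/val_inj => /=.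
    exact: Sdisj alSi alS.
  by rewrite addrK.
have fHinf : Hinfty f.
  have E : (fun w => f w - G 0%N w) = f by apply/funext => w; rewrite /G big_ord0 subr0.
  by rewrite -E.
have /abs_sumP[[K HK] _] := zmon f fHinf.
(* The union of [n] disjoint blocks carries absolute mass at least [n], against the bound [K] on
   finite sums. *)
have large n : exists A : {fset multi_index}, (forall al, al \in A -> exists2 m, (m < n)%N & al \in S m) /\
    n%:R <= \sum_(al <- A) normc (c al * monomial z al).
  elim: n => [|n [A [HA An]]].
    by exists fset0; split=> [al|]; rewrite ?inE // big_seq_fset0.
  exists (A `|` S n)%fset; split=> [al|].
    rewrite inE => /orP[/HA[m mn alS]|alS]; first by exists m => //; exact: leqW.
    by exists n.
  rewrite (@sum_fset_sub _ A _ _ _ (fsubsetUl _ _)) -natr1; apply: lerD => //.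
  have -> : ((A `|` S n) `\` A)%fset = S n.
    apply/fsetP => al; rewrite !inE; case: (boolP (al \in A)) => //= /HA[m mn alS].
    by apply/esym/negP => alSn; have := Sdisj _ _ _ alS alSn; lia.
  apply: le_trans (zS n) _; rewrite big_seq_cond [leRHS]big_seq_cond.
  by apply: ler_sum => al; rewrite andbT => /cE ->.
have [A [_ HA]] := large (Num.Def.truncn K).+1.
have := le_trans HA (HK A).
have K0 : 0 <= K by apply: le_trans (HK fset0); rewrite big_seq_fset0.
by have /andP[_ h2] := truncn_itv K0; rewrite leNgt h2.
Qed.

End Gluing.

(** * A necessary condition for monomial convergence *)

Section Blocks.
Variable R : realType.
Local Notation C := R[i].

(** Squaring a bound 1 + u + c u ^ 2 gives one of the same form at 2 u, with a constant [c'] smaller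
    than [c] when [U] is small enough. *)
Lemma expR_double (u U c c' : R) : 0 <= u <= U -> 0 <= c -> expR u <= 1 + u + c * u ^+ 2 ->
  1 + 2 * c + 2 * c * U + c ^+ 2 * U ^+ 2 <= 4 * c' ->
  expR (2 * u) <= 1 + 2 * u + c' * (2 * u) ^+ 2.
Proof.
move=> /andP[u0 uU] c0 hu hc; rewrite (_ : 2 * u = u + u); last by ring.
have U0 : 0 <= U by exact: le_trans uU.
rewrite expRD; apply: le_trans (ler_pM (expR_ge0 _) (expR_ge0 _) hu hu) _.
have h1 : c * u <= c * U by rewrite ler_wpM2l.
have h2 : c ^+ 2 * u ^+ 2 <= c ^+ 2 * U ^+ 2.
  by rewrite ler_wpM2l ?sqr_ge0 //; apply: lerXn2r; rewrite ?nnegrE.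
have : 0 <= u ^+ 2 * (4 * c' - (1 + 2 * c + 2 * c * u + c ^+ 2 * u ^+ 2)).
  by rewrite mulr_ge0 ?sqr_ge0 //; lra.
rewrite -subr_ge0; congr (0 <= _); ring.
Qed.

(** From exp u <= 1 / (1 - u) at u = x / 8, three doublings improve the constant through 8/7, 9/10,
    5/6 and 1. *)
Lemma expR_le_quadratic (x : R) : 0 <= x <= 1 -> expR x <= 1 + x + x ^+ 2.
Proof.
move=> /andP[x0 x1]; pose u := x / 8.
have u0 : 0 <= u <= 8^-1 by rewrite /u; apply/andP; split; lra.
have h1 : expR u <= 1 + u + 8 / 7 * u ^+ 2.
  have /andP[a b] := u0.
  have : expR u <= (1 - u)^-1.
    rewrite -[u]opprK expRN opprK lef_pV2 ?posrE ?expR_gt0 //; last by lra.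
    exact: expR_ge1Dx.
  move=> h; apply: le_trans h _; rewrite -div1r ler_pdivrMr; last by lra.
  have : 0 <= u ^+ 2 * (1 - 8 * u) by rewrite mulr_ge0 ?sqr_ge0 //; lra.
  by move=> H; rewrite [leRHS](_ : _ = 1 + u ^+ 2 * (1 - 8 * u) / 7); [lra|field].
have h2 := @expR_double u 8^-1 (8 / 7) (9 / 10) u0.
have h3 := @expR_double (2 * u) 4^-1 (9 / 10) (5 / 6).
have h4 := @expR_double (2 * (2 * u)) 2^-1 (5 / 6) 1.
rewrite (_ : x = 2 * (2 * (2 * u))); last by rewrite /u; field.
rewrite -[X in _ + X]mul1r; apply: h4; first by lra.
- lra.
- apply: h3; [lra|lra| |lra].
  by apply: h2 => //; lra.
- lra.
Qed.

(** The right side is the product of the 1 + s_j ^ 2 + s_j ^ 4. This explains the exponents {0,1,2}: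
    1 + x lies below exp x, but 1 + x + x ^ 2 dominates it on [0, 1]. *)
Lemma sum_sqr_ge n (s : 'I_n -> R) : (forall j, 0 <= s j <= 1) ->
  expR (\sum_j s j ^+ 2) <= \sum_(a : {ffun 'I_n -> 'I_3}) (\prod_j s j ^+ a j) ^+ 2.
Proof.
move=> s01; rewrite (eq_bigr (fun a : {ffun 'I_n -> 'I_3} => \prod_j (s j ^+ a j) ^+ 2)); last first.
  by move=> a _; rewrite -prodrXl.
rewrite -(bigA_distr_bigA (fun j (i : 'I_3) => (s j ^+ i) ^+ 2)) /= expR_sum.
apply: ler_prod => j _; rewrite expR_ge0 /= !big_ord_recl big_ord0 /=.
rewrite expr0 expr1n expr1 addr0 addrA.
have -> : (s j ^+ 2) ^+ 2 = (s j ^+ 2) ^+ 2 by [].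
apply: expR_le_quadratic; have /andP[h1 h2] := s01 j.
by rewrite sqr_ge0 exprn_ile1.
Qed.

(** For t = ln n this says that n ^ b wins over n log n. The -1 in the exponent leaves room for the
    total error of [large_coordinates]. *)
Lemma expR_beats (b A c : R) : 1 < b -> 0 <= A -> 0 <= c ->
  exists T, forall t, T <= t -> A * (t + c) * expR t <= expR (b * t - 1).
Proof.
move=> b1 A0 c0; pose d := b - 1; have d0 : 0 < d by rewrite subr_gt0.
exists (Num.max c (Num.max (2 / d) (16 * A / d ^+ 2))) => t.
rewrite !ge_max => /and3P[ct t1 t2]; have t0 : 0 <= t by exact: le_trans ct.
rewrite (_ : b * t - 1 = (d * t - 1) + t); last by rewrite /d; ring.
rewrite expRD ler_wpM2r ?expR_ge0 //.
have dt : 2 <= d * t by rewrite mulrC -ler_pdivrMr.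
have dt2 : 16 * A <= t * d ^+ 2 by rewrite -ler_pdivrMr // exprn_gt0.
have x0 : 0 <= d * t - 1 by lra.
apply: le_trans (expR_ge1Dxn 1 x0); apply: (@le_trans _ _ (2 * A * t)).
  by have := ler_wpM2l A0 ct; lra.
have h : (d * t / 2) ^+ 2 <= (d * t - 1) ^+ 2.
  by apply: lerXn2r; rewrite ?nnegrE; lra.
have h2 : 16 * A * t <= t * d ^+ 2 * t by rewrite ler_wpM2r.
rewrite (_ : 2`!%:R = 2 :> R) //.
have -> : 2 * A * t = 16 * A * t / 8 by field.
have E : (d * t / 2) ^+ 2 = t * d ^+ 2 * t / 4 by field.
lra.
Qed.

Variables (j0 m n : nat) (J : 'I_n -> nat).
Hypothesis J_inj : injective J.

Definition block_bound := (maxn j0 (\max_i J i)).+1.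

(** The index of the monomial w_(j0) ^ (3 m) times the product of the w_(J i) ^ (a i). As [j0] may
    be one of the [J i], multiples of 3 are used: its exponent stays between 3 m and 3 m + 2, which
    separates the blocks. *)
Definition block_index (a : {ffun 'I_n -> 'I_3}) : multi_index :=
  mi (mkseq (fun j => 3 * m * (j == j0) + \sum_(i | J i == j) a i)%N block_bound).

Lemma block_indexE a j : block_index a j = (3 * m * (j == j0) + \sum_(i | J i == j) a i)%N.
Proof.
rewrite miE; have [jb|bj] := ltnP j block_bound; first by rewrite nth_mkseq.
have Jj i : (J i < j)%N.
  by apply: leq_trans bj; rewrite ltnS (leq_trans (leq_bigmax i)) // leq_maxr.
rewrite nth_default ?size_mkseq // big_pred0 => [|i]; last by apply/eqP; have := Jj i; lia.
have jj0 : (j0 < j)%N by apply: leq_trans bj; rewrite ltnS leq_maxl.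
by rewrite gtn_eqF // muln0.
Qed.

Lemma sum_fiber (a : {ffun 'I_n -> 'I_3}) i : (\sum_(i' | J i' == J i) a i')%N = a i.
Proof. by rewrite (big_pred1 i) // => i'; rewrite /= (inj_eq J_inj). Qed.

Definition block_exponent (al : multi_index) : {ffun 'I_n -> 'I_3} :=
  [ffun i => inord (al (J i) - 3 * m * (J i == j0))%N].

Lemma block_indexK : cancel block_index block_exponent.
Proof.
move=> a; apply/ffunP => i; rewrite ffunE block_indexE sum_fiber addKn.
exact: inord_val.
Qed.

Lemma block_index_range a : (3 * m <= block_index a j0 < 3 * m.+1)%N.
Proof.
rewrite block_indexE eqxx muln1 leq_addr /= mulnS addnC ltn_add2r.
have [[i <-]|H] := pselect (exists i, J i = j0); first by rewrite sum_fiber.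
by rewrite big_pred0 // => i; apply/eqP => h; apply: H; exists i.
Qed.

Lemma block_monomial (w : linfty R) a :
  monomial w (block_index a) = w j0 ^+ (3 * m) * \prod_i w (J i) ^+ a i.
Proof.
have Jb i : (J i < block_bound)%N by rewrite ltnS (leq_trans (leq_bigmax i)) // leq_maxr.
have j0b : (j0 < block_bound)%N by rewrite ltnS leq_maxl.
rewrite (@monomialE _ _ _ block_bound) => [|j bj]; last first.
  by rewrite miE nth_default // size_mkseq.
rewrite (eq_bigr (fun j : 'I_block_bound =>
   w j ^+ (3 * m * ((j : nat) == j0))%N * w j ^+ (\sum_(i | J i == j) a i)%N)); last first.
  by move=> j _; rewrite -exprD -block_indexE.
rewrite big_split /=; congr (_ * _).
  rewrite (bigD1 (Ordinal j0b)) //= eqxx muln1 big1 ?mulr1 // => j jj0.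
  by rewrite (negbTE (jj0 : (j : nat) != j0)) muln0 expr0.
rewrite [RHS](partition_big (fun i => Ordinal (Jb i)) xpredT) //=.
apply: eq_bigr => j _; rewrite -prodrXr; apply: eq_bigr => i /eqP Jij.
by rewrite Jij.
Qed.

Definition block : {fset multi_index} :=
  [fset block_index a | a in [set: {ffun 'I_n -> 'I_3}]%SET]%fset.

Lemma big_block (A : Type) (idx : A) (op : Monoid.com_law idx) (F : multi_index -> A) :
  \big[op/idx]_(al <- block) F al = \big[op/idx]_(a : {ffun 'I_n -> 'I_3}) F (block_index a).
Proof.
rewrite big_imfset /=; last by move=> a b _ _; exact: can_inj block_indexK _ _.
by rewrite [LHS]big_enum /=; apply: eq_bigl => a; rewrite inE.
Qed.

End Blocks.

Section Necessity.
Variable R : realType.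
Local Notation C := R[i].

Lemma block_exists (z : linfty R) (b : R) j0 m : Dinfty z -> z j0 != 0 -> 1 < b ->
  (forall N, exists2 n, (N <= n)%N &
     b < (ln n%:R)^-1 * \sum_(1 <= j < n.+1) decr_rearr z j ^+ 2) ->
  exists Sb : {fset multi_index} * (multi_index -> C),
  [/\ forall al, al \in Sb.1 -> (3 * m <= al j0 < 3 * m.+1)%N,
   forall w, Dinfty w -> normc (fpoly Sb.1 Sb.2 w) <= 2^-1 ^+ m.+1 &
   1 <= \sum_(al <- Sb.1) normc (Sb.2 al * monomial z al)].
Proof.
move=> zD zj0 b1 Hb; have /DinftyP[X /andP[X0 X1] zX] := zD.
have z1 : polydisc 1 z by move=> j; exact: le_trans (zX j) (ltW X1).
have y0 : 0 < normc (z j0) by rewrite lt_def normc_eq0 zj0 normc_ge0.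
pose h : R := 2^-1; have h0 : 0 < h by rewrite invr_gt0.
(* The factor by which the mass must exceed the norm: the polynomial is scaled to norm 2 ^ - m.+1
   and multiplied by a power whose value at [z] is |z_(j0)| ^ (3 m). *)
pose tau := (h ^+ m.+1 * normc (z j0) ^+ (3 * m))^-1.
have tau0 : 0 < tau by rewrite invr_gt0 mulr_gt0 ?exprn_gt0.
have ln52 : 0 <= ln 52 :> R by rewrite ln_ge0 // ler1n.
have A0 : 0 <= 288 * tau ^+ 2 by rewrite mulr_ge0 ?sqr_ge0 ?ler0n.
have [T HT] := expR_beats b1 A0 ln52.
have [n nN bn] := Hb (maxn 2 (Num.Def.truncn (expR T)).+1).
have n2 : (1 < n)%N by apply: leq_trans nN; exact: leq_maxl.
have n0 : (0 < n)%N by exact: ltnW. have n0' : 0 < n%:R :> R by rewrite ltr0n.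
pose t := ln n%:R : R; have t0 : 0 < t by rewrite ln_gt0 // ltr1n.
have nE : expR t = n%:R by rewrite lnK // posrE.
have Tt : T <= t.
  rewrite -ler_expR nE; have /andP[_ /ltW h1] := truncn_itv (expR_ge0 T).
  by apply: le_trans h1 _; rewrite ler_nat (leq_trans _ nN) // leq_maxr.
have Sn : b * t <= \sum_(1 <= j < n.+1) decr_rearr z j ^+ 2.
  by move: bn; rewrite ltr_pdivlMl // mulrC => /ltW.
(* With this accuracy the [n] picks lose 1 in total. *)
pose e := (2 * n%:R)^-1 : R.
have e01 : 0 < e <= 1.
  rewrite invr_gt0 mulr_gt0 //= invf_le1 ?mulr_gt0 //.
  by rewrite -natrM ler1n muln_gt0.
have [s [us ss]] := large_coordinates n z1 e01.
rewrite (_ : 2 * e * n%:R = 1); last by rewrite /e; field; rewrite gt_eqF.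
rewrite [leRHS](big_nth 0%N) ss [leRHS]big_mkord => hs.
pose J (i : 'I_n) := nth 0%N s i.
have J_inj : injective J.
  by move=> i i' /eqP; rewrite nth_uniq ?ss // => /eqP/val_inj.
pose r (i : 'I_n) := normc (z (J i)).
have r01 i : 0 <= r i <= 1 by rewrite normc_ge0; exact: z1.
have [sg Hsg] := random_polynomial n0 r01.
move: Hsg; set L := 2 * n%:R * ln (52 * n%:R); set V := \sum_a _ => Hsg.
have LE : L = 2 * (t + ln 52) * expR t.
  by rewrite /L lnM ?posrE // nE -/t [ln 52 + _]addrC; ring.
have L0 : 0 < L by rewrite LE mulr_gt0 ?expR_gt0 // mulr_gt0 // ltr_pwDl.
(* Here 144 = 12 ^ 2 comes from squaring tau 12 sqrt (L V) <= V, and the 288 given to [expR_beats]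
   includes the factor 2 of [L]. *)
have LV : 144 * tau ^+ 2 * L <= V.
  have -> : 144 * tau ^+ 2 * L = 288 * tau ^+ 2 * (t + ln 52) * expR t by rewrite LE; ring.
  apply: le_trans (HT t Tt) _; apply: le_trans (sum_sqr_ge r01).
  by rewrite ler_expR; lra.
have V0 : 0 < V.
  by apply: lt_le_trans LV; rewrite mulr_gt0 // mulr_gt0 ?exprn_gt0 ?ltr0n.
pose Q := 12 * Num.sqrt (L * V); have Q0 : 0 < Q by rewrite mulr_gt0 // sqrtr_gt0 mulr_gt0.
have QV : tau * Q <= V.
  have -> : tau * Q = Num.sqrt ((12 * tau) ^+ 2 * (L * V)).
    rewrite sqrtrM ?sqr_ge0 // sqrtr_sqr ger0_norm ?mulr_ge0 ?(ltW tau0) //.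
    by rewrite /Q; ring.
  rewrite -[leRHS](ger0_norm (ltW V0)) -sqrtr_sqr ler_wsqrtr //.
  rewrite (_ : _ * (L * V) = 144 * tau ^+ 2 * L * V); last by ring.
  by rewrite [leRHS]expr2 ler_wpM2r // ltW.
pose kappa := h ^+ m.+1 / Q.
have k0 : 0 < kappa by rewrite divr_gt0 ?exprn_gt0.
pose q (a : {ffun 'I_n -> 'I_3}) := (-1) ^+ (sg a) * \prod_j r j ^+ a j.
exists (block j0 m J, fun al => (kappa * q (block_exponent j0 m J al))%:C); split.
- move=> al /imfsetP[/= a _ ->]; exact: block_index_range.
- move=> w /DinftyP[x /andP[x0 /ltW x1] wx] /=.
  have w1 j : normc (w j) <= 1 by exact: le_trans (wx j) x1.
  rewrite /fpoly big_block //.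
  rewrite (_ : \sum_a _ = kappa%:C * w j0 ^+ (3 * m) *
     mpoly_at (fun a => (q a)%:C) (fun i => w (J i))); last first.
    rewrite /mpoly_at mulr_sumr; apply: eq_bigr => a _.
    rewrite block_indexK // block_monomial rmorphM /=; ring.
  rewrite !Normc.normcM normcR gtr0_norm // normcX.
  apply: (@le_trans _ _ (kappa * 1 * Q)); last by rewrite mulr1 /kappa divfK // gt_eqF.
  apply: ler_pM; [|exact: normc_ge0| |exact: Hsg].
    by rewrite mulr_ge0 ?(ltW k0) // exprn_ge0 // normc_ge0.
  by rewrite ler_wpM2l ?(ltW k0) // exprn_ile1 ?normc_ge0.
rewrite big_block //= (eq_bigr (fun a : {ffun 'I_n -> 'I_3} =>
  kappa * normc (z j0) ^+ (3 * m) * (\prod_j r j ^+ a j) ^+ 2)); last first.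
  move=> a _; have p0 : 0 <= \prod_j r j ^+ a j.
    by apply: prodr_ge0 => j _; rewrite exprn_ge0 ?normc_ge0.
  rewrite block_indexK // block_monomial !Normc.normcM normcR normrM gtr0_norm //.
  rewrite /q normrM normrX normrN1 expr1n mul1r ger0_norm // normcX.
  rewrite normc_prod; under [X in _ * (_ * X) = _]eq_bigr do rewrite normcX.
  by rewrite expr2; ring.
rewrite -mulr_sumr -/V /kappa.
have -> : h ^+ m.+1 / Q * normc (z j0) ^+ (3 * m) * V = V / (tau * Q).
  by rewrite /tau; field; rewrite !gt_eqF ?exprn_gt0.
by rewrite ler_pdivlMr ?mul1r // mulr_gt0.
Qed.

Lemma limsup_of_mon (z : linfty R) : mon_Hinfty z ->
  (limn_esup (fun n : nat =>
      ((ln n%:R)^-1 * \sum_(1 <= j < n.+1) decr_rearr z j ^+ 2)%:E)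
    <= 1%:E)%E.
Proof.
move=> zmon; have [zD _] := zmon; apply: limn_esup_le => b b1; apply: contrapT => H.
have Hb N : exists2 n, (N <= n)%N & b < (ln n%:R)^-1 * \sum_(1 <= j < n.+1) decr_rearr z j ^+ 2.
  apply: contrapT => H'; apply: H; exists N => n Nn; rewrite leNgt; apply/negP => h.
  by apply: H'; exists n.
(* If [z] were 0 the averages would vanish and could not exceed b > 1. *)
have [j0 zj0] : exists j, z j != 0.
  apply: contrapT => z0; have {}z0 : polydisc 0 z.
    move=> j; have [->|zj] := eqVneq (z j) 0; first by rewrite Normc.normc0.
    by case: z0; exists j.
  have [n _] := Hb 0%N; rewrite big_nat big1 ?mulr0 => [|j /andP[j0 _]]; first by lra.
  apply/eqP; rewrite expf_eq0 /= eq_le decr_rearr_ge0 // andbT.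
  exact: decr_rearr_bound.
have [Sb HSb] := choice (fun m => block_exists m zD zj0 b1 Hb).
apply: (@gluing _ z (fun m => (Sb m).1) (fun m => (Sb m).2)) zmon => [m l al h1 h2|m|m].
- by have [/(_ _ h1) h3 _ _] := HSb m; have [/(_ _ h2) h4 _ _] := HSb l; lia.
- by case: (HSb m).
- by case: (HSb m).
Qed.

End Necessity.

Theorem theorem3p1 (R : realType) (z : linfty R) (hz : Dinfty z) :
  ((limn_esup (fun n : nat =>
      ((ln n%:R)^-1 * \sum_(1 <= j < n.+1) decr_rearr z j ^+ 2)%:E)
    < (2^-1)%:E)%E -> mon_Hinfty z) /\
  (mon_Hinfty z ->
   (limn_esup (fun n : nat =>
      ((ln n%:R)^-1 * \sum_(1 <= j < n.+1) decr_rearr z j ^+ 2)%:E)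
    <= 1%:E)%E).
Proof. by split; [exact: mon_of_limsup|exact: limsup_of_mon]. Qed.
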